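(* Let $\bar\varepsilon\in\mathcal{U}_e$. Let $e\in\mathcal{E}$ be a kinematically admissible strain field such that $\langle e\rangle=\bar\varepsilon$ and let $s\in\mathcal{S}$ be a statically admissible stress field. Then $$\mathcal{P}(s,e)=\langle r(\cdot,s,e)\rangle,\qquad \mathcal{P}(Le,e)=\tfrac12\|\nabla\mathcal{J}(e-\bar\varepsilon)\|^2_{\mathcal{H}_e},\qquad \mathcal{P}(s,L^{-1}s)=\tfrac12\|\nabla\mathcal{J}_c(s)\|^2_{\mathcal{H}_s},$$ $$\mathcal{P}(Le,L^{-1}s)=\tfrac12\|\nabla\mathcal{J}_c(s)\|^2_{\mathcal{H}_s}+\langle r(\cdot,s,e)\rangle+\tfrac12\|\nabla\mathcal{J}(e-\bar\varepsilon)\|^2_{\mathcal{H}_e}.$$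
   Context: Let $\mathcal{V}\subset\mathbb{R}^d$ be a unit cell that tiles $\mathbb{R}^d$ by translation along a lattice $\mathcal{R}$ generated by $d$ vectors. ''Periodic'' means $\mathcal{R}$-periodic. $L^2_{\mathrm{per}}(\mathcal{V})$ is the space of periodic functions in $L^2_{\mathrm{loc}}(\mathbb{R}^d)$, and $H^1_{\mathrm{per}}(\mathcal{V})$ the space of periodic functions in $H^1_{\mathrm{loc}}(\mathbb{R}^d)$. All fields are real-valued. Write $\langle f\rangle=\frac1{|\mathcal{V}|}\int_{\mathcal{V}}f\,dx$ and $s:e=\sum_{i,j}s_{ij}e_{ij}$. $L_0$ is a uniform (constant in $x$) positive definite fourth-order tensor with major and minor symmetries; it acts on second-order tensors, $(L_0\eta)_{ij}=\sum_{k,l}(L_0)_{ijkl}\eta_{kl}$, and it is thus an invertible, symmetric positive definite linear map on symmetric $d\times d$ matrices. $L=L(x)$ is the periodic fourth-order elasticity tensor field of the composite, with major and minor symmetries, components in $L^\infty(\mathcal{V})$, and uniformly positive definite (there is $\mu>0$ with $L(x)e:e\ge\mu\, e:e$ for a.e. $x$ and all symmetric $e$); it acts pointwise, $(L\eta)(x)=L(x)\eta(x)$, and $L^{-1}$ is its pointwise inverse on symmetric matrices. $\mathcal{H}_e$ (strain fields) is the space of symmetric second-order tensor fields with components in $L^2_{\mathrm{per}}(\mathcal{V})$, with energetic scalar product $(\eta,\tilde\eta)_{\mathcal{H}_e}=\langle L_0\eta:\tilde\eta\rangle$. $\mathcal{H}_s$ (stress fields) is the same set of tensor fields, with energetic scalar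 product $(\tau,\tilde\tau)_{\mathcal{H}_s}=\langle\tau:L_0^{-1}\tilde\tau\rangle$. $\|\cdot\|_{\mathcal{H}_e}$, $\|\cdot\|_{\mathcal{H}_s}$ are the associated norms and $I$ is the identity operator. $\mathcal{U}_e\subset\mathcal{H}_e$ is the subspace of uniform (constant) fields. $\mathcal{E}_0=\{e^*\in\mathcal{H}_e:\ \exists\,w^*\in H^1_{\mathrm{per}}(\mathcal{V})^d,\ e^*=\frac12(\nabla w^*+(\nabla w^* )^{\top})\}$ and $\mathcal{E}=\mathcal{U}_e\oplus\mathcal{E}_0$. $\mathcal{S}$ is the space of $s\in\mathcal{H}_s$ such that $\operatorname{div}s=0$ in $\mathcal{V}$ and $s\cdot n$ is anti-periodic on $\partial\mathcal{V}$ ($n$ the unit outward normal), i.e. the periodic field $s$ is divergence-free on $\mathbb{R}^d$ in the sense of distributions. $P_{\mathcal{E}_0}$ is the orthogonal projector of $\mathcal{H}_e$ onto $\mathcal{E}_0$; $P_{\mathcal{S}^\perp}$ is the orthogonal projector of $\mathcal{H}_s$ onto the orthogonal complement $\mathcal{S}^\perp$ of $\mathcal{S}$ in $\mathcal{H}_s$ (orthogonality for the respective energetic scalar products). Functionals (for given $\bar\varepsilon$): for $(\tau,\eta)\in\mathcal{H}_s\times\mathcal{H}_e$, $r(x,\tau,\eta)=\frac12(\tau-L\eta):L^{-1}(\tau-L\eta)$ and $$\mathcal{P}(\tau,\eta)=\tfrac12\|(I-P_{\mathcal{E}_0})\eta-\bar\varepsilon\|^2_{\mathcal{H}_e}+\langle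 r(\cdot,\tau,\eta)\rangle+\tfrac12\|P_{\mathcal{S}^\perp}\tau\|^2_{\mathcal{H}_s}.$$ $\mathcal{J}:\mathcal{E}_0\to\mathbb{R}$, $\mathcal{J}(e^* )=\frac12\langle L(\bar\varepsilon+e^* ):(\bar\varepsilon+e^* )\rangle$; its gradient $\nabla\mathcal{J}(e^* )$ is the element of $\mathcal{E}_0$ such that $(\nabla\mathcal{J}(e^* ),\tilde e^* )_{\mathcal{H}_e}=\lim_{t\to0}\frac{\mathcal{J}(e^*+t\tilde e^* )-\mathcal{J}(e^* )}{t}$ for all $\tilde e^*\in\mathcal{E}_0$. $\mathcal{J}_c:\mathcal{S}\to\mathbb{R}$, $\mathcal{J}_c(s)=\frac12\langle s:L^{-1}s\rangle-\langle s\rangle:\bar\varepsilon$; its gradient $\nabla\mathcal{J}_c(s)$ is the element of $\mathcal{S}$ such that $(\nabla\mathcal{J}_c(s),\tilde s)_{\mathcal{H}_s}=\lim_{t\to0}\frac{\mathcal{J}_c(s+t\tilde s)-\mathcal{J}_c(s)}{t}$ for all $\tilde s\in\mathcal{S}$. *)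

(* Defs.v *)
From HB Require Import structures.
From mathcomp Require Import all_boot all_order all_algebra.
From mathcomp Require Import all_classical all_reals all_analysis.
Set Implicit Arguments.
Unset Strict Implicit.
Unset Printing Implicit Defensive.
Import Order.TTheory GRing.Theory Num.Theory.
Import numFieldNormedType.Exports.
Local Open Scope classical_set_scope.
Local Open Scope ring_scope.

Section measurable_rV.
Context {d : measure_display} {T : sigmaRingType d} (n : nat).

Let coor : 'I_n -> 'rV[T]_n -> T := fun i x => x ord0 i.

Let rV_set0 : g_sigma_preimage coor set0.
Proof. exact: sigma_algebra0. Qed.

Let rV_setC A : g_sigma_preimage coor A -> g_sigma_preimage coor (~` A).
Proof. exact: sigma_algebraC. Qed.

Let rV_bigcup (F : _^nat) : (forall i, g_sigma_preimage coor (F i)) ->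
  g_sigma_preimage coor (\bigcup_i (F i)).
Proof. exact: sigma_algebra_bigcup. Qed.

HB.instance Definition _ := @isMeasurable.Build (measure_tuple_display d)
  'rV[T]_n (g_sigma_preimage coor) rV_set0 rV_setC rV_bigcup.

End measurable_rV.


Lemma measurable_coord_rV d (T : measurableType d) n (i : 'I_n) :
  measurable_fun [set: 'rV[T]_n] (fun x : 'rV[T]_n => x ord0 i).
Proof.
move=> _ Y mY; rewrite setTI; apply: sub_sigma_algebra => /=.
rewrite -bigcup_seq/=; exists i => /=; first by rewrite mem_index_enum.
by exists Y => //; rewrite setTI.
Qed.

Lemma measurable_fun_rVP d1 d2 (T1 : measurableType d1) (T2 : measurableType d2)
    n (f : T1 -> 'rV[T2]_n) :
  measurable_fun [set: T1] f <->
  forall i, measurable_fun [set: T1] (fun x => f x ord0 i).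
Proof.
split=> [mf i|mf].
  by apply: (measurableT_comp (measurable_coord_rV i)).
have -> : measurable_fun [set: T1] f <->
    (g_sigma_preimage (fun i x => f x ord0 i) `<=` measurable).
  have -> : (fun i x => f x ord0 i) =
      (fun i => (fun x : 'rV[T2]_n => x ord0 i) \o f).
    by [].
  rewrite g_sigma_preimage_comp; split=> [h A [/= C preC <-]|prefS].
    exact: h.
  by move=> _ A mA; apply: prefS; exists A.
apply: smallest_sub; first exact: sigma_algebra_measurable.
move=> A; rewrite -bigcup_seq/= => -[i _ [B mB <-]].
exact: mf.
Qed.

Section lebesgue_rV.
Context {R : realType}.

Definition rV_cons n (p : R * 'rV[R]_n) : 'rV[R]_n.+1 :=
  row_mx (const_mx p.1 : 'rV[R]_1) p.2.

Definition rV_uncons n (v : 'rV[R]_n.+1) : R * 'rV[R]_n :=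
  (v ord0 ord0, \row_i v ord0 (lift ord0 i)).

Lemma rV_cons0 n (p : R * 'rV[R]_n) : rV_cons p ord0 ord0 = p.1.
Proof. by rewrite /rV_cons mxE; case: splitP => j //= _; rewrite mxE. Qed.

Lemma rV_consS n (p : R * 'rV[R]_n) (i : 'I_n) :
  rV_cons p ord0 (lift ord0 i) = p.2 ord0 i.
Proof.
rewrite /rV_cons mxE; case: splitP => [[[]]//|j /=].
by rewrite /bump/= !add1n => -[] /val_inj ->.
Qed.

Lemma rV_consK n : cancel (@rV_cons n) (@rV_uncons n).
Proof.
move=> [a v]; rewrite /rV_uncons rV_cons0; congr pair.
by apply/rowP => i; rewrite mxE rV_consS.
Qed.

Lemma measurable_rV_cons n : measurable_fun [set: R * 'rV[R]_n] (@rV_cons n).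
Proof.
apply/measurable_fun_rVP => i; case: (unliftP ord0 i) => [j ->|->].
- rewrite (_ : (fun _ => _) = (fun v : 'rV[R]_n => v ord0 j) \o snd).
    exact: measurableT_comp (measurable_coord_rV j) measurable_snd.
  by apply/funext => x; rewrite rV_consS.
- rewrite (_ : (fun _ => _) = fst) //; apply/funext => x; exact: rV_cons0.
Qed.

Lemma measurable_rV_uncons n : measurable_fun [set: 'rV[R]_n.+1] (@rV_uncons n).
Proof.
apply/measurable_fun_pairP; split; first exact: measurable_coord_rV.
apply/measurable_fun_rVP => i.
rewrite (_ : (fun _ => _) = (fun v : 'rV[R]_n.+1 => v ord0 (lift ord0 i))).
  exact: measurable_coord_rV.
by apply/funext => x; rewrite /= mxE.
Qed.

Section step.
Local Open Scope ereal_scope.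
Context n (mu : {sigma_finite_measure set 'rV[R]_n -> \bar R}).

Definition lebesgue_rVS : set 'rV[R]_n.+1 -> \bar R :=
  pushforward (@lebesgue_measure R \x mu) (@rV_cons n).

Let lebesgue_rVS0 : lebesgue_rVS set0 = 0.
Proof. by rewrite /lebesgue_rVS /pushforward preimage_set0 measure0. Qed.

Let lebesgue_rVS_ge0 A : 0 <= lebesgue_rVS A.
Proof. exact: (measure_ge0 (@lebesgue_measure R \x mu)). Qed.

Let lebesgue_rVS_sigma_additive : semi_sigma_additive lebesgue_rVS.
Proof.
move=> F mF tF mUF; rewrite /lebesgue_rVS /pushforward preimage_bigcup.
apply: measure_semi_sigma_additive.
- by move=> k; rewrite -[X in measurable X]setTI; exact: measurable_rV_cons.
- apply/trivIsetP => /= i j _ _ ij; rewrite -preimage_setI.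
  by move/trivIsetP : tF => /(_ _ _ _ _ ij) ->//; rewrite preimage_set0.
- by rewrite -preimage_bigcup -[X in measurable X]setTI; exact: measurable_rV_cons.
Qed.

HB.instance Definition _ := isMeasure.Build _ _ _
  lebesgue_rVS lebesgue_rVS0 lebesgue_rVS_ge0 lebesgue_rVS_sigma_additive.

Let lebesgue_rVS_sigma_finite : sigma_finite setT lebesgue_rVS.
Proof.
have /sigma_finiteP[F [TF ndF Foo]] := sigma_finiteT (@lebesgue_measure R).
have /sigma_finiteP[G [TG ndG Goo]] := sigma_finiteT mu.
exists (fun k => @rV_uncons n @^-1` (F k `*` G k)).
  rewrite -preimage_bigcup; apply/esym/seteqP; split => // v _ /=.
  have [i _ Fi] : (\bigcup_i F i) (rV_uncons v).1 by rewrite -TF.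
  have [k _ Gk] : (\bigcup_i G i) (rV_uncons v).2 by rewrite -TG.
  exists (maxn i k) => //; split.
  - exact: (subsetPset _ _ (ndF _ _ (leq_maxl i k))).
  - exact: (subsetPset _ _ (ndG _ _ (leq_maxr i k))).
move=> k; have [mF Fk] := Foo k; have [mG Gk] := Goo k; split.
  rewrite -[X in measurable X]setTI; apply: measurable_rV_uncons => //.
  exact: measurableX.
rewrite /lebesgue_rVS /pushforward -comp_preimage.
rewrite (_ : rV_uncons (n:=n) \o _ = id); last first.
  by apply/funext => x; rewrite /= rV_consK.
rewrite preimage_id product_measure1E// lte_mul_pinfty// ge0_fin_numE//.
Qed.

HB.instance Definition _ := @Measure_isSigmaFinite.Build _ _ _
  lebesgue_rVS lebesgue_rVS_sigma_finite.

End step.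

Lemma sigma_finite_dirac_rV0 : sigma_finite setT (@dirac _ 'rV[R]_0 0 R).
Proof. by apply: fin_num_fun_sigma_finite => //; rewrite measure0. Qed.

Fixpoint lebesgue_rV n : {sigma_finite_measure set 'rV[R]_n -> \bar R} :=
  match n with
  | 0 => @dirac _ 'rV[R]_0 0 R
  | m.+1 => lebesgue_rVS (lebesgue_rV m)
  end.

End lebesgue_rV.

Lemma lebesgue_rV_box (R : realType) n (A : 'I_n -> set R) :
  (forall i, measurable (A i)) ->
  lebesgue_rV n [set x | forall i, A i (x ord0 i)] =
  (\prod_(i < n) lebesgue_measure (A i))%E.
Proof.
elim: n A => [|n IHn] A mA.
  rewrite big_ord0 /= diracE mem_set//; by case.
have mB : measurable [set x : 'rV[R]_n | forall i, A (lift ord0 i) (x ord0 i)].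
  have -> : [set x : 'rV[R]_n | forall i, A (lift ord0 i) (x ord0 i)] =
      \bigcap_(i in [set: 'I_n])
        ((fun x : 'rV[R]_n => x ord0 i) @^-1` A (lift ord0 i)).
    by apply/seteqP; split=> [x Ax i _|x Ax i]; [exact: Ax|exact: (Ax i)].
  apply: fin_bigcap_measurable; first exact: finite_finset.
  move=> i _; rewrite -[X in measurable X]setTI; exact: measurable_coord_rV.
rewrite big_ord_recl -(IHn (fun i => A (lift ord0 i)))// -product_measure1E//=.
congr (product_measure1 _ _ _).
apply/seteqP; split=> [[a v] /= h|[a v] /= [h1 h2] i].
- split=> [|i]; first by have := h ord0; rewrite rV_cons0.
  by have := h (lift ord0 i); rewrite rV_consS.
- by case: (unliftP ord0 i) => [j ->|->]; rewrite ?rV_consS ?rV_cons0.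
- exact: (mA ord0).
Qed.

(* Functions below are Borel representatives of L2 classes; periodicity,
   symmetry and equality of fields are required almost everywhere. *)
Section fields.
Context {R : realType} {d : nat}.
Local Notation Rd := 'rV[R]_d.
Local Notation Md := 'M[R]_d.
Local Notation leb := (lebesgue_rV d : {measure set Rd -> \bar R}).

Definition tensor4 := 'I_d -> 'I_d -> 'I_d -> 'I_d -> R.

Definition tensor4_app (T : tensor4) (e : Md) : Md :=
  \matrix_(i, j) \sum_k \sum_l T i j k l * e k l.

Definition ddot (s e : Md) : R := \sum_i \sum_j s i j * e i j.

Definition sym_mx (e : Md) := e^T = e.

Definition minor_symmetric (T : tensor4) :=
  forall i j k l, T i j k l = T j i k l /\ T i j k l = T i j l k.

Definition major_symmetric (T : tensor4) :=
  forall i j k l, T i j k l = T k l i j.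

Definition posdef_tensor4 (T : tensor4) :=
  forall e, sym_mx e -> e != 0 -> 0 < ddot (tensor4_app T e) e.

(* Inverse on symmetric matrices. Such an inverse tensor is unique thanks to
   the minor symmetries; the value is 0 when there is none. *)
Definition tensor4_inv (T : tensor4) : tensor4 :=
  xget (fun _ _ _ _ => 0) [set S | minor_symmetric S /\
    forall e, sym_mx e ->
      tensor4_app S (tensor4_app T e) = e /\
      tensor4_app T (tensor4_app S e) = e].

(* The lattice generated by the rows of B. *)
Definition lattice (B : Md) : set Rd :=
  [set r | exists z : 'rV[int]_d, r = map_mx intr z *m B].

(* V may or may not contain its boundary, so the tiling is up to null sets. *)
Definition unit_cell (B : Md) (V : set Rd) :=
  [/\ measurable V,
      forall r, lattice B r -> r != 0 ->
        leb.-negligible (V `&` [set x | V (x - r)]) &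
      \forall x \ae leb, exists2 r, lattice B r & V (x - r)].

Definition lattice_periodic (B : Md) (T : Type) (f : Rd -> T) :=
  forall r, lattice B r -> \forall x \ae leb, f (x + r) = f x.

Definition L2loc (f : Rd -> R) := measurable_fun setT f /\
  forall K : set Rd, compact K -> leb.-integrable K (fun x => (f x ^+ 2)%:E).

Definition basis_vec (i : 'I_d) : Rd := delta_mx ord0 i.

Definition pderiv (i : 'I_d) (f : Rd -> R) : Rd -> R :=
  fun x => 'D_(basis_vec i) f x.

Definition smooth_rV (f : Rd -> R) := forall s : seq 'I_d,
  continuous (foldr pderiv f s) /\
  forall i x, derivable (foldr pderiv f s) x (basis_vec i).

Definition test_function (phi : Rd -> R) :=
  smooth_rV phi /\ compact (closure [set x | phi x != 0]).

Definition weak_pderiv (i : 'I_d) (u g : Rd -> R) := forall phi,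
  test_function phi ->
  \int[leb]_x (u x * pderiv i phi x) = - \int[leb]_x (g x * phi x).

Definition H1loc (u : Rd -> R) := L2loc u /\
  forall i, exists2 g, L2loc g & weak_pderiv i u g.

Definition H1per (B : Md) (u : Rd -> R) := H1loc u /\ lattice_periodic B u.

(* G j i is the i-th weak derivative of the j-th component of w. *)
Definition weak_grad (w : Rd -> Rd) (G : Rd -> Md) := forall j i,
  L2loc (fun x => G x j i) /\
  weak_pderiv i (fun x => w x ord0 j) (fun x => G x j i).

Definition tensor_field := Rd -> Md.

Definition tensor4_fapp (L : Rd -> tensor4) (eta : tensor_field) :
    tensor_field :=
  fun x => tensor4_app (L x) (eta x).

Definition tensor4_finv (L : Rd -> tensor4) : Rd -> tensor4 :=
  fun x => tensor4_inv (L x).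

Definition cell_mean (V : set Rd) (f : Rd -> R) : R :=
  (fine (leb V))^-1 * \int[leb]_(x in V) f x.

Definition cell_mean_mx (V : set Rd) (f : tensor_field) : Md :=
  \matrix_(i, j) cell_mean V (fun x => f x i j).

(* The underlying set of both the strain space and the stress space. *)
Definition L2per_sym (B : Md) (eta : tensor_field) :=
  [/\ forall i j, L2loc (fun x => eta x i j),
      \forall x \ae leb, sym_mx (eta x) &
      lattice_periodic B eta].

Definition ip_e (V : set Rd) (L0 : tensor4) (eta eta' : tensor_field) : R :=
  cell_mean V (fun x => ddot (tensor4_app L0 (eta x)) (eta' x)).

Definition ip_s (V : set Rd) (L0 : tensor4) (tau tau' : tensor_field) : R :=
  cell_mean V (fun x => ddot (tau x) (tensor4_app (tensor4_inv L0) (tau' x))).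

Definition ip_norm (ip : tensor_field -> tensor_field -> R)
    (eta : tensor_field) : R :=
  Num.sqrt (ip eta eta).

Definition uniform_fields (B : Md) (u : tensor_field) :=
  L2per_sym B u /\ exists c : Md, \forall x \ae leb, u x = c.

Definition strain_fluct (B : Md) (e : tensor_field) := L2per_sym B e /\
  exists w : Rd -> Rd, (forall j, H1per B (fun x => w x ord0 j)) /\
  exists2 G, weak_grad w G & \forall x \ae leb, e x = 2^-1 *: (G x + (G x)^T).

Definition strain_adm (B : Md) (e : tensor_field) := L2per_sym B e /\
  exists u e', [/\ uniform_fields B u, strain_fluct B e' &
    \forall x \ae leb, e x = u x + e' x].

(* The i-th row of the distributional divergence of s on the whole space. *)
Definition stress_adm (B : Md) (s : tensor_field) := L2per_sym B s /\
  forall i phi, test_function phi ->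
    \int[leb]_x (\sum_j s x i j * pderiv j phi x) = 0.

Definition energetic_orthogonal (B : Md)
    (ip : tensor_field -> tensor_field -> R) (K : set tensor_field) :
    set tensor_field :=
  [set eta | L2per_sym B eta /\ forall k, K k -> ip eta k = 0].

Definition orth_projector (B : Md) (ip : tensor_field -> tensor_field -> R)
    (K : set tensor_field) (P : tensor_field -> tensor_field) :=
  forall eta, L2per_sym B eta -> K (P eta) /\
    forall k, K k -> ip (eta - P eta) k = 0.

(* Two elements with this property are equal almost everywhere. *)
Definition energetic_gradient (ip : tensor_field -> tensor_field -> R)
    (K : set tensor_field) (J : tensor_field -> R) (e : tensor_field) : tensor_field :=
  xget (cst 0) [set g | K g /\ forall h, K h ->
    t^-1 * (J (e + t *: h) - J e) @[t --> (0 : R)^'] --> ip g h].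

Definition uniform_stiffness (L0 : tensor4) :=
  [/\ minor_symmetric L0, major_symmetric L0 & posdef_tensor4 L0].

Definition stiffness_field (B : Md) (V : set Rd) (L : Rd -> tensor4) :=
  [/\ (forall i j k l, measurable_fun setT (fun x => L x i j k l) /\
        exists M, \forall x \ae leb, V x -> `|L x i j k l| <= M),
      lattice_periodic B L,
      \forall x \ae leb, minor_symmetric (L x) /\ major_symmetric (L x) &
      exists2 mu, 0 < mu & \forall x \ae leb, forall e, sym_mx e ->
        mu * ddot e e <= ddot (tensor4_app (L x) e) e].

Definition residual (L : Rd -> tensor4) (tau eta : tensor_field) (x : Rd) :
    R :=
  let z := tau x - tensor4_app (L x) (eta x) in
  2^-1 * ddot z (tensor4_app (tensor4_inv (L x)) z).

Definition error_functional (V : set Rd) (L0 : tensor4) (L : Rd -> tensor4)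
    (PE PS : tensor_field -> tensor_field) (ebar : Md)
    (tau eta : tensor_field) : R :=
  2^-1 * ip_norm (ip_e V L0) (eta - PE eta - cst ebar) ^+ 2 +
  cell_mean V (residual L tau eta) + 2^-1 * ip_norm (ip_s V L0) (PS tau) ^+ 2.

Definition primal_energy (V : set Rd) (L : Rd -> tensor4) (ebar : Md)
    (e : tensor_field) : R :=
  2^-1 * cell_mean V (fun x =>
    ddot (tensor4_app (L x) (ebar + e x)) (ebar + e x)).

Definition dual_energy (V : set Rd) (L : Rd -> tensor4) (ebar : Md)
    (s : tensor_field) : R :=
  2^-1 * cell_mean V (fun x => ddot (s x) (tensor4_app (tensor4_inv (L x)) (s x))) -
  ddot (cell_mean_mx V s) ebar.

End fields.

Arguments tensor4 : clear implicits.
Arguments tensor_field : clear implicits.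

(* Main.v *)
Require Import Defs.
From HB Require Import structures.
From mathcomp Require Import finmap.
From mathcomp Require Import all_boot all_order all_algebra.
From mathcomp Require Import all_classical all_reals all_analysis.
From mathcomp Require Import measurable_realfun.
From mathcomp Require Import zify ring lra.

(** Write A for the pointwise action of L0. The functional P is the sum of a
    kinematic defect, which measures the failure of its second argument to be
    ebar plus a strain fluctuation, the mean residual of the constitutive law,
    and a static defect, which measures the failure of its first argument to be
    divergence-free. The residual vanishes for the pairs (Le, e) and (s, L^-1
    s), and takes the same value at (Le, L^-1 s) and (s, e). The theorem thus
    amounts to four facts: the kinematic defect of an admissible strain is 0
    ([strain_defect]), the static defect of a stress is 0 ([ip_s_PS_stress]),
    the static defect of Le is half the squared norm of the gradient of the
    primal energy ([primal_gradient_norm]), and the kinematic defect of L^-1 s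
    is half the squared norm of the gradient of the dual energy
    ([dual_gradient_norm]).

    These facts follow from the duality between strain fluctuations and
    stresses: a field is a stress exactly when it is orthogonal to all strain
    fluctuations ([stress_admP]). Through A, the complement of the stresses
    corresponds to the strain fluctuations, and the two projectors to each other
    ([ip_s_PS]). The energies being quadratic, their gradients are then
    identified with the strain part of L0^-1 L e and with the image under A of
    the defect field of L^-1 s.

    One half of the duality is elementary once the distributional divergence on
    the whole space is expressed by periodic strains: the symmetrised gradient
    of a periodised test function unfolds to it ([test_strain]). The other half,
    Hill's lemma for square integrable fields ([stress_strain_orthogonal]), is
    deduced from the existence of the projectors and a uniqueness statement: a
    strain fluctuation e for which A e is divergence-free vanishes
    ([strain_stress_eq0]). For smooth fields the latter is an integration by
    parts over the cell; the general case reduces to it by convolution with all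
    test functions, and the fundamental lemma of the calculus of variations
    recovers the field ([fundamental_lemma]).

    The remaining work is measure-theoretic. Means of periodic functions do not
    depend on the cell, up to null sets ([integral_unit_cell]), so that a
    general cell can be replaced by a bounded parallelepiped. The pointwise
    inverse of the stiffness is a measurable bounded field
    ([measurable_tensor4_inv]), because it is a rational function of the
    stiffness on a measurable set. *)

Import Order.TTheory GRing.Theory Num.Theory.
Import numFieldNormedType.Exports.
Set Implicit Arguments.
Unset Strict Implicit.
Unset Printing Implicit Defensive.
Local Open Scope classical_set_scope.
Local Open Scope ring_scope.

(** * Translation invariance of the Lebesgue measure *)

Lemma lebesgue_measure_translation (R : realType) (a : R) (A : set R) :
  measurable A -> lebesgue_measure ((fun x => x + a) @^-1` A) = lebesgue_measure A.
Proof.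
move=> mA.
have mf : measurable_fun [set: R] (fun x : R => x + a) by exact: measurable_funD.
have mf' : @measurable_fun _ _ (measurableTypeR R) (measurableTypeR R)
    setT (fun x => x + a) by exact: mf.
rewrite [RHS](@lebesgue_measure_unique R (pushforward (@lebesgue_measure R)
  (fun x : measurableTypeR R => x + a : measurableTypeR R)))//.
move=> _ [[b c] _ <-]; rewrite /=/pushforward.
rewrite (_ : _ @^-1` _ = `]b - a, c - a]%classic); last first.
  by apply/seteqP; split => x /=; rewrite !in_itv/= ltrBlDr lerBrDr.
rewrite !lebesgue_measure_itv/= !lte_fin ltrBlDr subrK -!EFinB.
by case: ifP => // _; congr EFin; ring.
Qed.

Section translation.
Context {R : realType}.
Local Open Scope ereal_scope.

Lemma ge0_integral_translation1 (a : R) (f : R -> \bar R) :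
  measurable_fun setT f -> (forall x, 0 <= f x) ->
  \int[lebesgue_measure]_x f (x + a)%R = \int[lebesgue_measure]_x f x.
Proof.
move=> mf f0.
have mt : measurable_fun [set: R] (fun x : R => x + a)%R by exact: measurable_funD.
rewrite -(preimage_setT (fun x : measurableTypeR R => x + a : measurableTypeR R)%R).
rewrite -[LHS](@ge0_integral_pushforward _ _ _ _ R
  (fun x : measurableTypeR R => x + a : measurableTypeR R)%R)//.
apply: eq_measure_integral => A mA _.
exact: lebesgue_measure_translation.
Qed.

Lemma measurable_translation n (y : 'rV[R]_n) :
  measurable_fun setT (fun x : 'rV[R]_n => x + y)%R.
Proof.
apply/measurable_fun_rVP => i.
rewrite (_ : (fun _ => _) = (fun x : 'rV[R]_n => x ord0 i + y ord0 i)%R); last first.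
  by apply/funext => x; rewrite mxE.
by apply: measurable_funD => //; exact: measurable_coord_rV.
Qed.

Lemma ge0_integral_lebesgue_rVS n (f : 'rV[R]_n.+1 -> \bar R) :
  measurable_fun setT f -> (forall x, 0 <= f x) ->
  \int[lebesgue_rV n.+1]_x f x =
  \int[lebesgue_measure]_a \int[lebesgue_rV n]_v f (rV_cons (a, v)).
Proof.
move=> mf f0.
transitivity (\int[lebesgue_measure \x lebesgue_rV n]_p f (rV_cons p)).
  rewrite -(preimage_setT (@rV_cons R n)).
  by rewrite -[RHS]ge0_integral_pushforward//; exact: measurable_rV_cons.
have mg : measurable_fun setT (fun p : R * 'rV[R]_n => f (rV_cons p)).
  exact: measurableT_comp mf (@measurable_rV_cons R n).
exact: (@fubini_tonelli1 _ _ _ _ R (@lebesgue_measure R) (lebesgue_rV n) _ mg).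
Qed.

(** By induction on the dimension: the first coordinate is translated by the
    one-dimensional case and the others by the induction hypothesis, Tonelli's
    theorem separating the two. *)
Lemma ge0_integral_translation n (y : 'rV[R]_n) (f : 'rV[R]_n -> \bar R) :
  measurable_fun setT f -> (forall x, 0 <= f x) ->
  \int[lebesgue_rV n]_x f (x + y)%R = \int[lebesgue_rV n]_x f x.
Proof.
elim: n y f => [|n IHn] y f mf f0.
  rewrite (_ : y = 0%R); last by apply/rowP; case.
  by under eq_integral do rewrite addr0.
rewrite !ge0_integral_lebesgue_rVS//; last first.
  apply: measurableT_comp mf _; exact: measurable_translation.
have E a v : f (rV_cons (a, v) + y)%R =
    f (rV_cons (a + (rV_uncons y).1, v + (rV_uncons y).2))%R.
  congr f; apply/rowP => i; rewrite mxE.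
  by case: (unliftP ord0 i) => [j ->|->]; rewrite ?rV_consS ?rV_cons0 //= !mxE.
under eq_integral do under eq_integral do rewrite E.
pose g a := \int[lebesgue_rV n]_v f (rV_cons (a, v)).
have mc a : measurable_fun setT (fun v : 'rV[R]_n => f (rV_cons (a, v))).
  apply: measurableT_comp mf _; apply: measurableT_comp (@measurable_rV_cons R n) _.
  exact: pair1_measurable.
rewrite -(@ge0_integral_translation1 (rV_uncons y).1 g).
- by apply: eq_integral => a _; rewrite /g -(IHn (rV_uncons y).2).
- apply: (measurable_fun_fubini_tonelli_F (fun p => f (rV_cons p))) => //.
  by apply: measurableT_comp mf _; exact: measurable_rV_cons.
- by move=> a; exact: integral_ge0.
Qed.

End translation.

Section lebesgue_translation.
Context {R : realType} {n : nat}.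
Local Notation Rn := 'rV[R]_n.
Local Notation leb := (lebesgue_rV n : {measure set Rn -> \bar R}).
Local Open Scope ereal_scope.

Lemma measurable_preimage_translation (y : Rn) (A : set Rn) :
  measurable A -> measurable ((fun x => x + y)%R @^-1` A).
Proof.
by move=> mA; rewrite -[X in measurable X]setTI; exact: measurable_translation.
Qed.

Lemma integral_translation (y : Rn) (f : Rn -> \bar R) :
  measurable_fun setT f ->
  \int[leb]_x f (x + y)%R = \int[leb]_x f x.
Proof.
move=> mf; rewrite [LHS]integralE [RHS]integralE.
congr (_ - _).
- rewrite -(ge0_integral_translation y (measurable_funepos mf))//.
  by apply: eq_integral => x _; rewrite funepos_comp.
- rewrite -(ge0_integral_translation y (measurable_funeneg mf))//.
  by apply: eq_integral => x _; rewrite funeneg_comp.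
Qed.

Lemma lebesgue_rV_translation (y : Rn) (A : set Rn) : measurable A ->
  leb ((fun x => x + y)%R @^-1` A) = leb A.
Proof.
move=> mA; have mA' := measurable_preimage_translation y mA.
have m1A : measurable_fun setT (fun x : Rn => (\1_A x)%:E : \bar R).
  by apply/measurable_EFinP; exact: measurable_indic.
have := integral_translation y m1A.
rewrite (@integral_indic _ _ _ leb setT _ A)// setIT => <-.
have := @integral_indic _ _ _ leb setT measurableT _ mA'.
by rewrite setIT => <-.
Qed.

Lemma Rintegral_translation (y : Rn) (f : Rn -> R) : measurable_fun setT f ->
  (\int[leb]_x f (x + y) = \int[leb]_x f x)%R.
Proof.
move=> mf; rewrite /Rintegral.
have mf' : measurable_fun setT (fun x => (f x)%:E) by exact/measurable_EFinP.
by rewrite -(integral_translation y mf').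
Qed.

Lemma integrable_translation (y : Rn) (f : Rn -> \bar R) :
  leb.-integrable setT f -> leb.-integrable setT (fun x => f (x + y)%R).
Proof.
case/integrableP => mf fi; apply/integrableP; split.
  exact: measurableT_comp mf (measurable_translation y).
have mf' : measurable_fun setT (fun x => `|f x|) by exact: measurableT_comp.
by rewrite (integral_translation y mf').
Qed.

Lemma ae_translation (y : Rn) (P : Rn -> Prop) :
  (\forall x \ae leb, P x) -> \forall x \ae leb, P (x + y)%R.
Proof.
move=> [N [mN N0 PN]]; exists ((fun x => x + y)%R @^-1` N); split.
- exact: measurable_preimage_translation.
- by rewrite lebesgue_rV_translation.
- by move=> x /= Px; exact: PN.
Qed.

End lebesgue_translation.

Section borel_rV.
Context {R : realType} {n : nat}.
Local Notation Rn := 'rV[R]_n.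
Local Notation leb := (lebesgue_rV n : {measure set Rn -> \bar R}).

Lemma measurable_forall_coord (A : 'I_n -> set R) : (forall i, measurable (A i)) ->
  measurable [set x : Rn | forall i, A i (x ord0 i)].
Proof.
move=> mA.
have -> : [set x : Rn | forall i, A i (x ord0 i)] =
    \bigcap_(i in [set: 'I_n]) ((fun x : Rn => x ord0 i) @^-1` A i).
  by apply/seteqP; split=> [x Ax i _|x Ax i]; [exact: Ax|exact: (Ax i)].
apply: fin_bigcap_measurable; first exact: finite_finset.
by move=> i _; rewrite -[X in measurable X]setTI; exact: measurable_coord_rV.
Qed.

Lemma ball_rVE (x y : Rn) (e : R) : ball x e y <->
  0 < e /\ forall i, `|x ord0 i - y ord0 i| < e.
Proof.
split=> [[e0 h]|[e0 h]]; first by split => // i; exact: h.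
by split => // i j; rewrite (ord1 i); exact: h.
Qed.

Lemma measurable_ball_rV (x : Rn) (e : R) : measurable (ball x e).
Proof.
have [e0|e0] := ltP 0 e; last first.
  rewrite (_ : ball x e = set0)//; apply/seteqP; split => // y /ball_rVE[].
  by rewrite ltNge e0.
rewrite (_ : ball x e =
    [set y | forall i, ball (x ord0 i : R^o) e (y ord0 i)]); last first.
  apply/seteqP; split => y; first by move=> /ball_rVE[_ h].
  by move=> h; apply/ball_rVE.
apply: (@measurable_forall_coord (fun i => ball (x ord0 i : R^o) e)) => i.
exact: measurable_ball.
Qed.

(** The measurable sets are those generated by the coordinates, and balls are
    products of intervals for the sup norm. An open set is the union of the
    countably many balls with rational centre and radius [1 / k.+1] that it
    contains. *)
Lemma open_measurable_rV (U : set Rn) : open U -> measurable U.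
Proof.
move=> oU.
pose F (p : 'rV[rat]_n * nat) : set Rn :=
  ball (map_mx (@ratr R) p.1 : Rn) (p.2.+1%:R^-1).
rewrite (_ : U = \bigcup_p (if `[< F p `<=` U >] then F p else set0)).
  apply: countable_bigcupT_measurable; first exact: countableP.
  by move=> p; case: ifP => // _; exact: measurable_ball_rV.
apply/seteqP; split => [x Ux|x [p _]]; last by case: asboolP => // pU /pU.
have /nbhs_ballP[e /= e0 xeU] : nbhs x U by exact: open_nbhs_nbhs.
have [k ke] : exists k, k.+1%:R^-1 < e / 2.
  have := near_infty_natSinv_lt (PosNum (divr_gt0 e0 (ltr0Sn R 1))).
  by move=> [k _ h]; exists k; exact: (h k (leqnn k)).
have ch i : exists q : rat, `|x ord0 i - ratr q| < k.+1%:R^-1.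
  have : (ball (x ord0 i : R^o) k.+1%:R^-1 `&` range (@ratr R)) !=set0.
    apply: dense_rat; last exact: ball_open.
    by exists (x ord0 i); apply: ballxx; rewrite invr_gt0.
  by move=> [r [xr [q _ qr]]]; exists q; rewrite qr.
have [q xq] := choice ch.
exists (\row_i q i, k) => //.
case: asboolP => [_|]; last first.
  move=> h; exfalso; apply: h; rewrite /F/= => y /ball_rVE[_ qy].
  apply: xeU; apply/ball_rVE; split => // i.
  have := qy i; have := xq i; rewrite !mxE.
  move: ke; set u := k.+1%:R^-1; move=> ke h1 h2.
  rewrite -(subrK (ratr (q i)) (x ord0 i)) -addrA.
  rewrite (le_lt_trans (ler_normD _ _))// (splitr e) ltrD//.
    exact: lt_trans ke.
  exact: lt_trans ke.
by apply/ball_rVE; split => [|i]; [rewrite invr_gt0|rewrite !mxE distrC].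
Qed.

Lemma continuous_measurable_rV (f : Rn -> R) : continuous f ->
  measurable_fun setT f.
Proof.
move=> /continuousP cf.
apply: (measurability _ (RGenOpens.measurableE R)) => //.
move=> _ [_ [a [b ->]] <-]; rewrite setTI; apply: open_measurable_rV.
by apply: cf; exact: interval_open.
Qed.

End borel_rV.

(** * Test functions and local square integrability *)

Section boxes.
Context {R : realType} {n : nat}.
Local Notation Rn := 'rV[R]_n.
Local Notation leb := (lebesgue_rV n : {measure set Rn -> \bar R}).

Definition cbox (M : R) : set Rn := [set x | forall i, `[- M, M]%classic (x ord0 i)].

Lemma compact_cbox M : compact (cbox M).
Proof. by apply: (@rV_compact R n (fun=> `[- M, M]%classic)) => i; exact: segment_compact. Qed.

Lemma measurable_cbox M : measurable (cbox M).
Proof.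
have mI (i : 'I_n) : measurable `[- M, M]%classic by exact: measurable_itv.
exact: measurable_forall_coord mI.
Qed.

Lemma lebesgue_cbox_lty M : (leb (cbox M) < +oo)%E.
Proof.
have mI (i : 'I_n) : measurable `[- M, M]%classic by exact: measurable_itv.
have -> : leb (cbox M) = (\prod_(i < n) lebesgue_measure (`[(- M)%R, M]%classic : set R))%E.
  exact: lebesgue_rV_box mI.
rewrite ltey_eq; apply/orP; left; apply: prode_fin_num => i _.
by rewrite lebesgue_measure_itv/=; case: ifP.
Qed.

Lemma compact_measurable (K : set Rn) : compact K -> measurable K.
Proof.
move=> cK; rewrite -(setCK K); apply: measurableC; apply: open_measurable_rV.
by apply: closed_openC; apply: compact_closed => //; exact: norm_hausdorff.
Qed.

Lemma compact_sub_cbox (K : set Rn) : compact K -> exists M, 0 <= M /\ K `<=` cbox M.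
Proof.
move=> /compact_bounded [M [Mr KM]].
exists (Num.max 0 (M + 1)); split; first by rewrite le_max lexx.
move=> x /KM => /(_ (Num.max 0 (M + 1))).
rewrite lt_max ltrDl ltr01 orbT => /(_ isT) xM i /=.
rewrite in_itv/= -ler_norml (le_trans _ xM)//.
have /mapP[j Hj ->] : `|x ord0 i| \in [seq `|x j.1 j.2| | j : 'I_1 * 'I_n].
  by apply/mapP; exists (ord0, i) => //=; rewrite mem_enum.
by rewrite [leRHS]/Num.norm /= mx_normrE; apply/bigmax_geP; right => /=; exists j.
Qed.

Lemma continuous_bounded_cbox (f : Rn -> R) M : continuous f ->
  exists C, 0 <= C /\ forall x, cbox M x -> `|f x| <= C.
Proof.
move=> cf.
have : compact (f @` cbox M).
  apply: continuous_compact; last exact: compact_cbox.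
  exact: continuous_subspaceT.
move=> /compact_bounded [C [Cr fC]].
exists (Num.max 0 (C + 1)); split; first by rewrite le_max lexx.
move=> x Kx; apply: (fC (Num.max 0 (C + 1))) => //.
  by rewrite lt_max ltrDl ltr01 orbT.
Qed.

End boxes.

Section test_functions.
Context {R : realType} {n : nat}.
Local Notation Rn := 'rV[R]_n.
Local Notation leb := (lebesgue_rV n : {measure set Rn -> \bar R}).

Lemma pderiv_locally0 i (f : Rn -> R) (x : Rn) :
  (\forall y \near x, f y = 0) -> pderiv i f x = 0.
Proof.
move=> f0; rewrite /pderiv.
rewrite (@near_eq_derive _ _ _ f (cst 0))//; first exact: derive_cst.
Qed.

Lemma smooth_pderiv i (f : Rn -> R) : smooth_rV f -> smooth_rV (pderiv i f).
Proof. by move=> sf s; have := sf (rcons s i); rewrite foldr_rcons. Qed.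

Lemma smooth_continuous (f : Rn -> R) : smooth_rV f -> continuous f.
Proof. by move=> sf; have [] := sf [::]. Qed.

Lemma smooth_derivable (f : Rn -> R) : smooth_rV f ->
  forall i x, derivable f x (basis_vec i).
Proof. by move=> sf; have [] := sf [::]. Qed.

Lemma closed_support_subset (f : Rn -> R) (K : set Rn) : closed K ->
  (forall x, ~ K x -> f x = 0) -> closure [set x | f x != 0] `<=` K.
Proof.
move=> cK f0; rewrite [X in _ `<=` X]((closure_id K).1 cK).
by apply: closureS => y /= /eqP fy; apply: contrapT => /f0.
Qed.

Lemma test_function_pderiv i (f : Rn -> R) :
  test_function f -> test_function (pderiv i f).
Proof.
case=> sf cf; split; first exact: smooth_pderiv.
apply: subclosed_compact cf _; first exact: closed_closure.
apply: closed_support_subset; first exact: closed_closure.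
move=> x nx; apply: pderiv_locally0.
have oc : open (~` closure [set x | f x != 0]) by exact/closed_openC/closed_closure.
have : nbhs x (~` closure [set x | f x != 0]) by exact: open_nbhs_nbhs.
apply: filterS => y ny; apply/eqP; apply: contrapT => /negP fy.
by apply: ny; exact: subset_closure.
Qed.

Lemma test_function_bounded (f : Rn -> R) : test_function f ->
  exists M, [/\ 0 <= M, forall x, ~ cbox M x -> f x = 0,
    forall x i, ~ cbox M x -> pderiv i f x = 0 &
    exists C, 0 <= C /\ forall x, `|f x| <= C].
Proof.
move=> tf; have [sf cf] := tf.
have [M [M0 fM]] := compact_sub_cbox cf.
have f0 x : ~ cbox M x -> f x = 0.
  move=> Mx; apply/eqP; apply: contrapT => /negP fx; apply: Mx; apply: fM.
  exact: subset_closure.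
exists M; split => //.
  move=> x i Mx; apply/eqP; apply: contrapT => /negP fx; apply: Mx; apply: fM.
  apply: contrapT => nx; move/eqP : fx; apply; apply: pderiv_locally0.
  have oc : open (~` closure [set x | f x != 0]) by exact/closed_openC/closed_closure.
  have : nbhs x (~` closure [set x | f x != 0]) by exact: open_nbhs_nbhs.
  apply: filterS => y ny; apply/eqP; apply: contrapT => /negP fy.
  by apply: ny; exact: subset_closure.
have [C [C0 fC]] := continuous_bounded_cbox M (smooth_continuous sf).
exists C; split=> // x; have [/fC//|/f0 ->] := pselect (cbox M x).
by rewrite normr0.
Qed.

End test_functions.

Section local_integrability.
Context {R : realType} {n : nat}.
Local Notation Rn := 'rV[R]_n.
Local Notation leb := (lebesgue_rV n : {measure set Rn -> \bar R}).

Lemma L2loc_measurable (f : Rn -> R) : L2loc f -> measurable_fun setT f.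
Proof. by case. Qed.

Lemma integrable_sqr_cbox (f : Rn -> R) M : L2loc f ->
  leb.-integrable (cbox M) (fun x => (f x ^+ 2)%:E).
Proof. by case=> _; apply; exact: compact_cbox. Qed.

Lemma integrable_cst_cbox M (c : R) : leb.-integrable (cbox M) (fun=> c%:E).
Proof.
apply/integrableP; split; first exact: measurable_cst.
rewrite integral_cst ?lte_mul_pinfty//; first exact: lebesgue_cbox_lty.
exact: measurable_cbox.
Qed.

(** Since [|f g| <= f^2 + g^2]. *)
Lemma integrableM_L2 (D : set Rn) (f g : Rn -> R) : measurable D ->
  measurable_fun D f -> measurable_fun D g ->
  leb.-integrable D (fun x => (f x ^+ 2)%:E) ->
  leb.-integrable D (fun x => (g x ^+ 2)%:E) ->
  leb.-integrable D (fun x => (f x * g x)%:E).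
Proof.
move=> mD mf mg f2 g2.
apply: (le_integrable mD _ _ (integrableD mD f2 g2)).
  by apply/measurable_EFinP; exact: measurable_funM.
move=> x Dx /=; rewrite lee_fin [leRHS]ger0_norm ?addr_ge0 ?sqr_ge0//.
rewrite normrM -(normr_id (f x)) -(normr_id (g x)).
rewrite -(real_normK (num_real (f x))) -(real_normK (num_real (g x))).
rewrite !normr_id; nra.
Qed.

Lemma integrableM_cbox (f g : Rn -> R) M : L2loc f -> L2loc g ->
  leb.-integrable (cbox M) (fun x => (f x * g x)%:E).
Proof.
move=> f2 g2; apply: integrableM_L2.
- exact: measurable_cbox.
- by apply: measurable_funS (L2loc_measurable f2).
- by apply: measurable_funS (L2loc_measurable g2).
- exact: integrable_sqr_cbox.
- exact: integrable_sqr_cbox.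
Qed.

Lemma L2loc_cst (c : R) : L2loc (fun _ : Rn => c).
Proof.
split; first exact: measurable_cst.
move=> K cK; have [M [M0 KM]] := compact_sub_cbox cK.
apply: (integrableS (measurable_cbox M)) => //.
  exact: compact_measurable.
exact: integrable_cst_cbox.
Qed.

Lemma L2locD (f g : Rn -> R) : L2loc f -> L2loc g -> L2loc (fun x => f x + g x).
Proof.
move=> f2 g2; have mf := L2loc_measurable f2; have mg := L2loc_measurable g2.
split; first exact: measurable_funD.
move=> K cK; have mK := compact_measurable cK.
have h := integrableD mK (f2.2 K cK) (g2.2 K cK).
apply: (le_integrable mK _ _ (integrableD mK h h)).
  apply/measurable_EFinP; apply: measurable_funS measurableT _ _ => //.
  by apply: measurable_funX; exact: measurable_funD.
move=> x Kx /=; rewrite lee_fin !ger0_norm ?addr_ge0 ?sqr_ge0//.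
have := sqr_ge0 (f x - g x); rewrite !expr2; nra.
Qed.

Lemma L2loc_dominated (f g : Rn -> R) (c : R) : measurable_fun setT f -> L2loc g ->
  (\forall x \ae leb, f x ^+ 2 <= c * g x ^+ 2) -> L2loc f.
Proof.
move=> mf g2 fg; split => // K cK; have mK := compact_measurable cK.
have gK := integrableZl mK c (g2.2 K cK).
have mf2 : measurable_fun K (fun x => (f x ^+ 2)%:E).
  apply/measurable_EFinP; apply: measurable_funS measurableT _ _ => //.
  exact: measurable_funX.
apply/integrableP; split => //.
apply: le_lt_trans (integrableP _ _ _ gK).2.
apply: ae_ge0_le_integral => //.
- exact: measurableT_comp.
- by apply: measurableT_comp => //; exact: measurable_int gK.
apply: filterS fg => x fgx _; rewrite -EFinM /= lee_fin.
by rewrite ger0_norm ?sqr_ge0// (le_trans fgx)// ler_norm.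
Qed.

Lemma L2locZ (c : R) (f : Rn -> R) : L2loc f -> L2loc (fun x => c * f x).
Proof.
move=> f2; apply: (@L2loc_dominated _ f (c ^+ 2)) => //.
  by apply: measurable_funM => //; exact: L2loc_measurable.
by apply: aeW => x; rewrite exprMn.
Qed.

Lemma L2loc_sum (I : Type) (r : seq I) (F : I -> Rn -> R) :
  (forall i, L2loc (F i)) -> L2loc (fun x => \sum_(i <- r) F i x).
Proof.
move=> F2; elim: r => [|i r IHr].
  under eq_fun do rewrite big_nil; exact: L2loc_cst.
by under eq_fun do rewrite big_cons; exact: L2locD.
Qed.

Lemma continuous_L2loc (f : Rn -> R) : continuous f -> L2loc f.
Proof.
move=> cf; split; first exact: continuous_measurable_rV.
move=> K cK; have mK := compact_measurable cK.
have [M [M0 KM]] := compact_sub_cbox cK.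
have [C [C0 fC]] := continuous_bounded_cbox M cf.
have iC := integrableS (measurable_cbox M) mK KM (integrable_cst_cbox M (C ^+ 2)).
apply: (le_integrable mK _ _ iC).
  apply/measurable_EFinP; apply: measurable_funS measurableT _ _ => //.
  by apply: measurable_funX; exact: continuous_measurable_rV.
move=> x Kx /=; rewrite lee_fin normrX [leRHS]ger0_norm ?sqr_ge0//.
by rewrite ler_sqr ?nnegrE// fC//; exact: KM.
Qed.

(** The integrand vanishes outside a box, on which it is a product of square
    integrable functions. *)
Lemma integrableM_compact_support (f g : Rn -> R) M : L2loc f -> L2loc g ->
  (forall x, ~ cbox M x -> g x = 0) ->
  leb.-integrable setT (fun x => (f x * g x)%:E).
Proof.
move=> f2 g2 g0.
have := integrableM_cbox M f2 g2.
rewrite (integrable_mkcond _ (measurable_cbox M)).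
congr (_.-integrable _ _); apply/funext => x; rewrite patchE.
case: ifPn => // /negP; rewrite inE => /g0 ->.
by rewrite mulr0.
Qed.

Lemma test_function_L2loc (f : Rn -> R) : test_function f -> L2loc f.
Proof. by case=> sf _; apply: continuous_L2loc; exact: smooth_continuous. Qed.

Lemma integrableM_test (f phi : Rn -> R) : L2loc f -> test_function phi ->
  leb.-integrable setT (fun x => (f x * phi x)%:E).
Proof.
move=> f2 tphi; have [M [_ phi0 _ _]] := test_function_bounded tphi.
exact: (integrableM_compact_support f2 (test_function_L2loc tphi) phi0).
Qed.

Lemma Rintegral_sum (D : set Rn) (I : Type) (r : seq I) (F : I -> Rn -> R) : measurable D ->
  (forall i, leb.-integrable D (fun x => (F i x)%:E)) ->
  \int[leb]_(x in D) (\sum_(i <- r) F i x) = \sum_(i <- r) \int[leb]_(x in D) F i x.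
Proof.
move=> mD iF; elim: r => [|i r IHr].
  by under eq_Rintegral do rewrite big_nil; rewrite big_nil /Rintegral integral0.
have isum : leb.-integrable D (fun x => (\sum_(j <- r) F j x)%:E).
  under eq_fun do rewrite -sumEFin; exact: integrable_sum.
by under eq_Rintegral do rewrite big_cons; rewrite big_cons (RintegralD mD (iF i) isum) IHr.
Qed.

End local_integrability.

(** * Lattices and unit cells *)

Section lattice.
Context {R : realType} {d : nat}.
Local Notation Rd := 'rV[R]_d.
Local Notation Zd := 'rV[int]_d.
Local Notation leb := (lebesgue_rV d : {measure set Rd -> \bar R}).
Variable B : 'M[R]_d.

Definition lattice_point (z : Zd) : Rd := map_mx intr z *m B.

Lemma lattice_latticeP z : lattice B (lattice_point z).
Proof. by exists z. Qed.

Lemma lattice_pointN z : lattice_point (- z) = - lattice_point z.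
Proof. by rewrite /lattice_point map_mxN mulNmx. Qed.

Lemma lattice_pointB z z' : lattice_point (z - z') = lattice_point z - lattice_point z'.
Proof. by rewrite /lattice_point map_mxB mulmxBl. Qed.

Lemma lattice_pointD z z' : lattice_point (z + z') = lattice_point z + lattice_point z'.
Proof. by rewrite /lattice_point map_mxD mulmxDl. Qed.

Lemma lattice_point_eq0 (hB : B \in unitmx) z : lattice_point z = 0 -> z = 0.
Proof.
move=> /(congr1 (mulmx^~ (invmx B))); rewrite mul0mx mulmxK// => z0.
apply/rowP => i; rewrite mxE; have := congr1 (fun v : Rd => v ord0 i) z0.
by rewrite !mxE => /eqP; rewrite intr_eq0 => /eqP.
Qed.

Lemma ae_forall_countable (T : countType) (P : T -> Rd -> Prop) :
  (forall t, \forall x \ae leb, P t x) -> \forall x \ae leb, forall t, P t x.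
Proof.
move=> aeP.
have : \forall x \ae leb, forall k : nat,
    if pickle_inv k is Some t then P t x else True.
  by apply: ae_foralln => k; case: pickle_inv => [t|]; [exact: aeP|exact: aeW].
by apply: filterS => x Px t; have := Px (pickle t); rewrite pickleK_inv.
Qed.

Lemma ae_periodic (T : Type) (f : Rd -> T) : lattice_periodic B f ->
  \forall x \ae leb, forall z, f (x + lattice_point z) = f x.
Proof.
by move=> fp; apply: ae_forall_countable => z; apply: fp; exact: lattice_latticeP.
Qed.

Hypothesis hB : B \in unitmx.

Lemma unit_cell_exists_unique (V : set Rd) : unit_cell B V ->
  \forall x \ae leb, exists z : Zd, V (x - lattice_point z) /\
     forall z', V (x - lattice_point z') -> z' = z.
Proof.
case=> mV dV cV.
have dis : \forall x \ae leb, forall p : Zd * Zd, p.2 != 0 ->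
    ~ (V (x - lattice_point p.1) /\ V (x - lattice_point p.1 - lattice_point p.2)).
  apply: ae_forall_countable => -[z w]/=.
  have [->|w0] := eqVneq w 0; first exact: aeW.
  have r0 : lattice_point w != 0 by apply: contra_neq w0; exact: lattice_point_eq0.
  have [N [mN N0 VN]] := dV _ (lattice_latticeP w) r0.
  have : \forall x \ae leb, ~ (V x /\ V (x - lattice_point w)).
    by exists N; split => // x /= /contrapT [Vx Vxw]; apply: VN.
  by move=> /(ae_translation (- lattice_point z)); apply: filterS => x h _.
apply: filterS2 cV dis => x [_ [z ->]] Vxz dis; exists z; split => // z' Vxz'.
apply/eqP; apply: contrapT => /negP z'z; apply: (dis (z, z' - z)); first by rewrite subr_eq0.
split => //=; by rewrite lattice_pointB opprB addrA subrK.
Qed.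

(** Lattice vectors are numbered by their codes, so that a sum over the lattice
    becomes a series of functions; a code of no vector gets weight 0. The family
    [g] is either the lattice points or their opposites, for translates of [V]
    in both directions. *)
Definition tile_weight (V : set Rd) (g : Zd -> Rd) (k : nat) (x : Rd) : R :=
  if pickle_inv k is Some z then \1_V (x + g z) else 0.

Lemma tile_weight_ge0 V g k x : 0 <= tile_weight V g k x.
Proof. by rewrite /tile_weight; case: pickle_inv. Qed.

Lemma measurable_tile_weight V g k : measurable V ->
  measurable_fun setT (tile_weight V g k).
Proof.
move=> mV; rewrite /tile_weight; case: pickle_inv => [z|]; last exact: measurable_cst.
apply: measurableT_comp (measurable_translation (g z)).
exact: measurable_indic.
Qed.

Lemma tile_weight_sum V g x : (exists z, V (x + g z) /\ forall z', V (x + g z') -> z' = z) ->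
  (\sum_(0 <= k <oo) (tile_weight V g k x)%:E = 1)%E.
Proof.
move=> [z [Vz uz]].
rewrite (@nneseriesD1 _ _ (pickle z))//; last first.
  by move=> k _; rewrite lee_fin tile_weight_ge0.
rewrite {1}/tile_weight pickleK_inv indicE mem_set// eseries0 ?adde0// => k _ /= kz.
rewrite /tile_weight; have := @pickle_invK Zd k; case: pickle_inv => // z' /= z'k.
rewrite indicE memNset// => /uz z'z; move: kz.
by rewrite -z'k z'z eqxx.
Qed.

Lemma unit_cell_sumN V : unit_cell B V -> \forall x \ae leb,
  (\sum_(0 <= k <oo) (tile_weight V (fun z => - lattice_point z)%R k x)%:E = 1)%E.
Proof.
move=> /unit_cell_exists_unique; apply: filterS => x; exact: tile_weight_sum.
Qed.

Lemma unit_cell_sum V : unit_cell B V -> \forall x \ae leb,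
  (\sum_(0 <= k <oo) (tile_weight V lattice_point k x)%:E = 1)%E.
Proof.
move=> /unit_cell_exists_unique; apply: filterS => x [z [Vz uz]].
apply: tile_weight_sum; exists (- z); rewrite lattice_pointN; split => // z' Vz'.
by rewrite -(uz (- z')) ?opprK// lattice_pointN opprK.
Qed.

Local Open Scope ereal_scope.

(** Cut [V] along the translates of [V'] and [V'] along the opposite translates
    of [V]. The pieces correspond to each other by lattice translations, which
    preserve the measure and the function. *)
Lemma ge0_integral_unit_cell V V' (f : Rd -> R) :
  unit_cell B V -> unit_cell B V' ->
  measurable_fun setT f -> (forall x, 0 <= f x)%R -> lattice_periodic B f ->
  \int[leb]_(x in V) (f x)%:E = \int[leb]_(x in V') (f x)%:E.
Proof.
move=> cV cV' mf f0 pf.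
have mV : measurable V by case: cV.
have mV' : measurable V' by case: cV'.
have key (W U : set Rd) (g : Zd -> Rd) : measurable W -> measurable U ->
    (\forall x \ae leb, \sum_(0 <= k <oo) (tile_weight U g k x)%:E = 1) ->
  \int[leb]_(x in W) (f x)%:E =
    \sum_(0 <= k <oo) \int[leb]_x (\1_W x * f x * tile_weight U g k x)%:E.
  move=> mW mU U1.
  have mw k : measurable_fun setT (fun x => (\1_W x * f x * tile_weight U g k x)%:E).
    apply/measurable_EFinP; apply: measurable_funM; last exact: measurable_tile_weight.
    by apply: measurable_funM.
  have w0 k x : 0 <= (\1_W x * f x * tile_weight U g k x)%:E.
    by rewrite lee_fin mulr_ge0// ?mulr_ge0// ?tile_weight_ge0// indicE.
  rewrite -integral_nneseries//.
  rewrite [LHS]integral_mkcond; apply: ge0_ae_eq_integral => //.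
  - apply/(measurable_restrictT _ _).1 => //; apply: measurable_funTS.
    exact/measurable_EFinP.
  - exact: ge0_emeasurable_sum.
  - by move=> x _; rewrite patchE; case: ifPn => //; rewrite lee_fin.
  - by move=> x _; exact: nneseries_ge0.
  apply: filterS U1 => x U1 _; rewrite patchE.
  under eq_eseriesr do rewrite EFinM.
  rewrite nneseriesZl; last by move=> k _; rewrite lee_fin tile_weight_ge0.
  rewrite U1 mule1 indicE; case: ifPn => _; first by rewrite mul1r.
  by rewrite mul0r.
rewrite (key V V' _ mV mV' (unit_cell_sumN cV')) (key V' V _ mV' mV (unit_cell_sum cV)).
apply: eq_eseriesr => k _.
rewrite /tile_weight; case: pickle_inv => [z|]; last first.
  by apply: eq_integral => x _; rewrite !mulr0.
have m1 (A : set Rd) (r : Rd) : measurable A -> measurable_fun setT (fun x : Rd => \1_A (x + r)%R : R).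
  move=> mA; apply: measurableT_comp (measurable_translation r).
  exact: measurable_indic.
have mVV : measurable_fun setT (fun x : Rd => (\1_V x * f x * \1_V' (x - lattice_point z))%:E).
  apply/measurable_EFinP; apply: measurable_funM; last exact: m1.
  by apply: measurable_funM.
rewrite -(integral_translation (lattice_point z) mVV).
apply: ge0_ae_eq_integral => //.
- apply: measurableT_comp mVV _; exact: measurable_translation.
- apply/measurable_EFinP; apply: measurable_funM; last exact: m1.
  by apply: measurable_funM.
- by move=> x _; rewrite lee_fin !mulr_ge0.
- by move=> x _; rewrite lee_fin !mulr_ge0.
apply: filterS (pf _ (lattice_latticeP z)) => x -> _.
rewrite addrK; congr EFin; ring.
Qed.

Lemma integral_unit_cell V V' (f : Rd -> R) :
  unit_cell B V -> unit_cell B V' ->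
  measurable_fun setT f -> lattice_periodic B f ->
  \int[leb]_(x in V) (f x)%:E = \int[leb]_(x in V') (f x)%:E.
Proof.
move=> cV cV' mf pf; rewrite [LHS]integralE [RHS]integralE; congr (_ - _).
- rewrite !(funerpos f) /=; apply: ge0_integral_unit_cell => //.
    exact: measurable_funrpos.
  by move=> r /pf; apply: filterS => x; rewrite /funrpos => ->.
- rewrite !(funerneg f) /=; apply: ge0_integral_unit_cell => //.
    exact: measurable_funrneg.
  by move=> r /pf; apply: filterS => x; rewrite /funrneg => ->.
Qed.
End lattice.

Lemma continuous_sum_fun (R : realType) (T : topologicalType) (I : Type) (r : seq I)
    (F : I -> T -> R) :
  (forall i, continuous (F i)) -> continuous (fun x => \sum_(i <- r) F i x).
Proof.
move=> cF; elim: r => [|i r IHr].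
  by under eq_fun do rewrite big_nil; move=> x; exact: cvg_cst.
under eq_fun do rewrite big_cons.
by move=> x; apply: cvgD; [exact: cF|exact: IHr].
Qed.

(** Balls have positive measure. *)
Lemma ae_ball_rV (R : realType) (n : nat) (P : 'rV[R]_n -> Prop) (x : 'rV[R]_n) (e : R) :
  0 < e -> (\forall y \ae (lebesgue_rV n : {measure set 'rV[R]_n -> \bar R}), P y) ->
  exists2 y, ball x e y & P y.
Proof.
move=> e0 [N [mN N0 PN]]; apply: contrapT => h.
have bN : ball x e `<=` N by move=> y bxy; apply: PN => /= Py; apply: h; exists y.
pose leb := (lebesgue_rV n : {measure set 'rV[R]_n -> \bar R}).
have : (leb (ball x e) <= leb N)%E.
  by apply: le_measure; rewrite ?inE//; exact: measurable_ball_rV.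
rewrite leNgt => /negP; apply.
rewrite (_ : leb N = 0%E)//.
have mA (i : 'I_n) : measurable (ball (x ord0 i : R^o) e) by exact: measurable_ball.
have -> : leb (ball x e) = (\prod_(i < n) lebesgue_measure (ball (x ord0 i : R^o) e))%E.
  rewrite -(lebesgue_rV_box mA); congr (leb _); apply/seteqP; split => y.
    by move=> /ball_rVE[].
  by move=> h'; apply/ball_rVE.
elim/big_ind : _ => [|a b|i _]; [exact: lte01|exact: mule_gt0|].
by rewrite lebesgue_measure_ball ?ltW// lte_fin mulrn_wgt0.
Qed.

Section cells.
Context {R : realType} {d : nat}.
Local Notation Rd := 'rV[R]_d.
Local Notation Zd := 'rV[int]_d.
Local Notation leb := (lebesgue_rV d : {measure set Rd -> \bar R}).
Variable B : 'M[R]_d.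
Hypothesis hB : B \in unitmx.

(** A reference cell. Unlike an arbitrary unit cell it is bounded, and its
    translates cover each point exactly once rather than almost everywhere. *)
Definition parallelepiped : set Rd :=
  [set x | forall i, `[0, 1[%classic ((x *m invmx B) ord0 i)].

Lemma continuous_mulmxr n (A : 'M[R]_(n, d)) (i : 'I_d) :
  continuous (fun x : 'rV[R]_n => (x *m A) ord0 i).
Proof.
rewrite (_ : (fun _ => _) = (fun x : 'rV[R]_n => \sum_j x ord0 j * A j i)); last first.
  by apply/funext => x; rewrite mxE.
apply: continuous_sum_fun => j x.
have c1 : {for x, continuous (fun x : 'rV[R]_n => x ord0 j)} by exact: coord_continuous.
exact: (continuousM c1 (@cst_continuous _ _ (A j i) x)).
Qed.

Lemma parallelepiped_sub_cbox : exists M, 0 <= M /\ parallelepiped `<=` cbox M.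
Proof.
exists (\sum_i \sum_j `|B i j|); split.
  by apply: sumr_ge0 => i _; apply: sumr_ge0.
move=> x Px j; rewrite /= in_itv/= -ler_norml -(mulmxKV hB x) mxE.
apply: le_trans (ler_norm_sum _ _ _) _; apply: ler_sum => i _.
rewrite (bigD1 j)//= normrM ler_wpDr ?sumr_ge0// ler_piMl//.
have := Px i; rewrite /= in_itv/= => /andP[h0 h1].
by rewrite ger0_norm// ltW.
Qed.

Lemma lattice_point_coord z i : (lattice_point B z *m invmx B) ord0 i = (z ord0 i)%:~R.
Proof. by rewrite /lattice_point mulmxK// mxE. Qed.

Lemma parallelepiped_cover x : exists z, parallelepiped (x - lattice_point B z).
Proof.
pose z : Zd := \row_i Num.floor ((x *m invmx B) ord0 i).
exists z => i; rewrite /= mulmxBl mxE [X in _ + X]mxE lattice_point_coord [z _ _]mxE in_itv/=.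
set a := (_ *m _) _ _; have /andP[h1 h2] := floor_itv a.
by move: h2; rewrite intrD => h2; apply/andP; split; lra.
Qed.

Lemma parallelepiped_unique z z' x : parallelepiped (x - lattice_point B z) ->
  parallelepiped (x - lattice_point B z') -> z = z'.
Proof.
have E w i : ((x - lattice_point B w) *m invmx B) ord0 i =
    (x *m invmx B) ord0 i - (w ord0 i)%:~R.
  by rewrite mulmxBl mxE [X in _ + X]mxE lattice_point_coord.
move=> Pz Pz'; apply/rowP => i; have := Pz i; have := Pz' i.
rewrite /= !E !in_itv/= => /andP[h1 h2] /andP[h3 h4].
have : (z ord0 i)%:~R < (z' ord0 i + 1)%:~R :> R by rewrite intrD; lra.
have : (z' ord0 i)%:~R < (z ord0 i + 1)%:~R :> R by rewrite intrD; lra.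
rewrite !ltr_int -[z 0 i]/(z ord0 i) -[z' 0 i]/(z' ord0 i).
by move: (z ord0 i) (z' ord0 i) => a b; lia.
Qed.

Lemma unit_cell_parallelepiped : unit_cell B parallelepiped.
Proof.
split.
- rewrite (_ : parallelepiped = (fun x : Rd => x *m invmx B) @^-1`
     [set x | forall i, `[0, 1[%classic (x ord0 i)])//.
  rewrite -[X in measurable X]setTI.
  have mm : measurable_fun setT (fun x : Rd => x *m invmx B).
    apply/measurable_fun_rVP => i; apply: continuous_measurable_rV.
    exact: continuous_mulmxr.
  apply: mm => //.
  have mI (i : 'I_d) : measurable `[(0:R), 1[%classic by exact: measurable_itv.
  exact: measurable_forall_coord mI.
- move=> r [z ->] r0.
  rewrite (_ : _ `&` _ = set0); first exact: negligible_set0.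
  apply/seteqP; split => // x /= [Px Pxz]; move/eqP: r0; apply.
  have P0 : parallelepiped (x - lattice_point B 0).
    by rewrite /lattice_point map_mx0 mul0mx subr0.
  by rewrite (parallelepiped_unique Pxz P0) map_mx0 mul0mx.
- apply: aeW => x.
  by have [z Pz] := parallelepiped_cover x; exists (lattice_point B z); first exact: lattice_latticeP.
Qed.

Lemma unit_cell_translation V y : unit_cell B V ->
  unit_cell B ((fun x => x + y) @^-1` V).
Proof.
case=> mV dV cV; split.
- exact: measurable_preimage_translation.
- move=> r Br r0; have [N [mN N0 VN]] := dV r Br r0.
  exists ((fun x => x + y) @^-1` N); split.
  + exact: measurable_preimage_translation.
  + by rewrite lebesgue_rV_translation.
  + by move=> x /= [Vx Vxr]; apply: VN; split => //=; rewrite addrAC.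
- have := ae_translation y cV; apply: filterS => x [r Br Vr].
  by exists r => //=; rewrite addrAC.
Qed.

Lemma integrable_unit_cell V V' (f : Rd -> R) : unit_cell B V -> unit_cell B V' ->
  measurable_fun setT f -> lattice_periodic B f ->
  leb.-integrable V (fun x => (f x)%:E) -> leb.-integrable V' (fun x => (f x)%:E).
Proof.
move=> cV cV' mf pf /integrableP [_ fi]; apply/integrableP; split.
  by apply/measurable_EFinP; exact: measurable_funS measurableT _ _.
rewrite (ge0_integral_unit_cell hB cV' cV (f := fun x => `|f x|))//.
- exact: measurableT_comp.
- by move=> r /pf; apply: filterS => x ->.
Qed.

Lemma Rintegral_unit_cell_translation V (f : Rd -> R) y : unit_cell B V ->
  measurable_fun setT f -> lattice_periodic B f ->
  \int[leb]_(x in V) f (x + y) = \int[leb]_(x in V) f x.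
Proof.
move=> cV mf pf; have mV : measurable V by case: cV.
have cV' := unit_cell_translation (- y) cV.
rewrite [RHS]/Rintegral (integral_unit_cell hB cV cV')//.
rewrite -/(Rintegral _ _ _) [LHS]Rintegral_mkcond [RHS]Rintegral_mkcond.
rewrite -[RHS](Rintegral_translation y); last first.
  apply/(measurable_restrictT _ _).1; last exact: measurable_funTS.
  by case: cV'.
congr Rintegral; apply/funext => x; rewrite !patchE.
rewrite (_ : (x + y \in _) = (x \in V))//.
by apply/idP/idP; rewrite !inE /= addrK.
Qed.

(** If the cell were null, countably many null translates would cover almost all
    of the space. Its measure is finite because it equals that of the bounded
    parallelepiped. *)
Lemma lebesgue_unit_cell V : unit_cell B V -> (0 < leb V < +oo)%E.
Proof.
move=> cV; have mV : measurable V by case: cV.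
apply/andP; split.
  rewrite lt0e measure_ge0 andbT; apply/eqP => V0.
  have aeV z : \forall x \ae leb, ~ V (x - lattice_point B z).
    apply: (ae_translation (- lattice_point B z) (P := fun x => ~ V x)).
    by exists V; split => // x /= /contrapT.
  have [_ _ cov] := cV.
  have aeF : \forall x \ae leb, False.
    apply: filterS2 cov (ae_forall_countable aeV) => x [_ [z ->] Vx] h.
    exact: (h z).
  by have [] := ae_ball_rV (0 : Rd) ltr01 aeF.
have E : leb V = leb parallelepiped.
  have cP := unit_cell_parallelepiped.
  have := ge0_integral_unit_cell hB cV cP (f := cst 1).
  rewrite /= !integral_cst ?mul1e//; last by case: cP.
  by apply => //; move=> r _; exact: aeW.
rewrite E; have [M [M0 PM]] := parallelepiped_sub_cbox.
apply: le_lt_trans (lebesgue_cbox_lty M).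
apply: le_measure; rewrite ?inE//; first by case: unit_cell_parallelepiped.
exact: measurable_cbox.
Qed.

(** The bound on a stiffness is given on the cell only; its countably many
    translates carry it to the whole space. *)
Lemma ae_unit_cell V (P : Rd -> Prop) : unit_cell B V ->
  (forall r, lattice B r -> \forall x \ae leb, P (x - r) -> P x) ->
  (\forall x \ae leb, V x -> P x) -> \forall x \ae leb, P x.
Proof.
move=> [_ _ cov] Pp PV.
have PVz : \forall x \ae leb, forall z, V (x - lattice_point B z) -> P (x - lattice_point B z).
  by apply: ae_forall_countable => z; exact: (ae_translation (- lattice_point B z) PV).
have Ppz : \forall x \ae leb, forall z, P (x - lattice_point B z) -> P x.
  by apply: ae_forall_countable => z; apply: Pp; exact: lattice_latticeP.
by apply: filterS3 cov PVz Ppz => x [_ [z ->] Vx] /(_ z Vx) Pxz h; exact: h Pxz.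
Qed.

Definition L2periodic (f : Rd -> R) := L2loc f /\ lattice_periodic B f.

Lemma lattice_periodic2 (T1 T2 T3 : Type) (op : T1 -> T2 -> T3) (f : Rd -> T1) (g : Rd -> T2) :
  lattice_periodic B f -> lattice_periodic B g ->
  lattice_periodic B (fun x => op (f x) (g x)).
Proof.
move=> pf pg r Br.
by apply: filterS2 (pf r Br) (pg r Br) => x -> ->.
Qed.

Lemma lattice_periodic1 (T1 T3 : Type) (op : T1 -> T3) (f : Rd -> T1) :
  lattice_periodic B f -> lattice_periodic B (fun x => op (f x)).
Proof. by move=> pf r Br; apply: filterS (pf r Br) => x ->. Qed.

(** Periodicity moves the integral to the bounded cell, where local square
    integrability applies. *)
Lemma integrableM_unit_cell V (f g : Rd -> R) : unit_cell B V ->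
  L2periodic f -> L2periodic g ->
  leb.-integrable V (fun x => (f x * g x)%:E).
Proof.
move=> cV [f2 pf] [g2 pg].
apply: (integrable_unit_cell unit_cell_parallelepiped cV).
- by apply: measurable_funM; exact: L2loc_measurable.
- exact: lattice_periodic2.
have [M [M0 PM]] := parallelepiped_sub_cbox.
apply: (integrableS (measurable_cbox M)) => //; last exact: integrableM_cbox.
by case: unit_cell_parallelepiped.
Qed.

Lemma L2periodic_integrable V (f : Rd -> R) : unit_cell B V -> L2periodic f ->
  leb.-integrable V (fun x => (f x)%:E).
Proof.
move=> cV hf; have one : L2periodic (fun=> 1).
  by split; [exact: L2loc_cst|move=> r _; exact: aeW].
have := integrableM_unit_cell cV hf one.
by under eq_fun do rewrite mulr1.
Qed.

End cells.

(** * Derivatives and integration by parts *)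

Section lines.
Context {R : realType} {n : nat}.
Local Notation Rn := 'rV[R]_n.

Lemma derive_line (f : Rn -> R) (y v : Rn) (t : R) : derivable f (y + t *: v) v ->
  is_derive t 1 (fun s => f (y + s *: v)) ('D_v f (y + t *: v)).
Proof.
move=> df.
have E : (fun h : R => h^-1 *: (((fun s => f (y + s *: v)) \o shift t) (h *: 1) - f (y + t *: v)))
   = (fun h : R => h^-1 *: ((f \o shift (y + t *: v)) (h *: v) - f (y + t *: v))).
  apply/funext => h /=; congr (_ *: (f _ - _)).
  by rewrite [h *: (1 : R)]mulr1 scalerDl addrCA.
split.
  by rewrite /derivable E.
by rewrite /derive E.
Qed.
End lines.

Section C1.
Context {R : realType} {n : nat}.
Local Notation Rn := 'rV[R]_n.
Local Notation leb := (lebesgue_rV n : {measure set Rn -> \bar R}).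

Definition C1 (f : Rn -> R) := continuous f /\
  forall i, (forall x, derivable f x (basis_vec i)) /\ continuous (pderiv i f).

Lemma smooth_C1 (f : Rn -> R) : smooth_rV f -> C1 f.
Proof.
move=> sf; split; first exact: smooth_continuous.
move=> i; split; first exact: smooth_derivable.
exact/smooth_continuous/smooth_pderiv.
Qed.

Lemma pderivM i (f g : Rn -> R) x : C1 f -> C1 g ->
  pderiv i (fun x => f x * g x) x = f x * pderiv i g x + pderiv i f x * g x.
Proof.
move=> [_ /(_ i)[df _]] [_ /(_ i)[dg _]].
by rewrite /pderiv (deriveM (df x) (dg x)) [g x *: _]mulrC.
Qed.

Lemma continuousM_fun (f g : Rn -> R) : continuous f -> continuous g ->
  continuous (fun x => f x * g x).
Proof. by move=> cf cg x; exact: (continuousM (cf x) (cg x)). Qed.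

Lemma continuousD_fun (f g : Rn -> R) : continuous f -> continuous g ->
  continuous (fun x => f x + g x).
Proof. by move=> cf cg x; exact: (continuousD (cf x) (cg x)). Qed.

Lemma C1M (f g : Rn -> R) : C1 f -> C1 g -> C1 (fun x => f x * g x).
Proof.
move=> Cf Cg; have [cf df] := Cf; have [cg dg] := Cg.
split; first exact: continuousM_fun.
move=> i; split; first by move=> x; exact: derivableM ((df i).1 x) ((dg i).1 x).
rewrite (_ : pderiv i _ = fun x => f x * pderiv i g x + pderiv i f x * g x).
  by apply: continuousD_fun; apply: continuousM_fun => //; [exact: (dg i).2|exact: (df i).2].
by apply/funext => x; exact: pderivM.
Qed.

Lemma pderivD i (f g : Rn -> R) x : C1 f -> C1 g ->
  pderiv i (fun x => f x + g x) x = pderiv i f x + pderiv i g x.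
Proof.
move=> [_ /(_ i)[df _]] [_ /(_ i)[dg _]].
by rewrite /pderiv (deriveD (df x) (dg x)).
Qed.

Lemma C1D (f g : Rn -> R) : C1 f -> C1 g -> C1 (fun x => f x + g x).
Proof.
move=> Cf Cg; have [cf df] := Cf; have [cg dg] := Cg.
split; first exact: continuousD_fun.
move=> i; split; first by move=> x; exact: derivableD ((df i).1 x) ((dg i).1 x).
rewrite (_ : pderiv i _ = fun x => pderiv i f x + pderiv i g x).
  by apply: continuousD_fun => //; [exact: (df i).2|exact: (dg i).2].
by apply/funext => x; exact: pderivD.
Qed.

Lemma C1_cst (c : R) : C1 (fun _ : Rn => c).
Proof.
have d0 i : pderiv i (fun=> c) = fun _ : Rn => 0 by apply/funext => x; exact: derive_cst.
split; first exact: cst_continuous.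
move=> i; rewrite d0; split; first by move=> x; exact: derivable_cst.
exact: cst_continuous.
Qed.

Lemma C1_sum (I : Type) (r : seq I) (F : I -> Rn -> R) : (forall k, C1 (F k)) ->
  C1 (fun x => \sum_(k <- r) F k x).
Proof.
move=> CF; elim: r => [|k r IHr].
  under eq_fun do rewrite big_nil; exact: C1_cst.
by under eq_fun do rewrite big_cons; exact: C1D.
Qed.

Lemma pderiv_sum (I : Type) (r : seq I) (F : I -> Rn -> R) i x : (forall k, C1 (F k)) ->
  pderiv i (fun x => \sum_(k <- r) F k x) x = \sum_(k <- r) pderiv i (F k) x.
Proof.
move=> CF; elim: r => [|k r IHr].
  by under eq_fun do rewrite big_nil; rewrite big_nil; exact: derive_cst.
under eq_fun do rewrite big_cons; rewrite big_cons pderivD ?IHr//.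
exact: C1_sum.
Qed.

(** When an integral is unchanged by translations of the function,
    differentiation under the integral sign shows that the directional
    derivative has zero integral. The function [G] dominates the difference
    quotients. Both integration by parts on the whole space and that over a cell
    are instances. *)
Lemma integral_pderiv_eq0 (D : set Rn) (f : Rn -> R) (i : 'I_n) (G : Rn -> R) :
  measurable D -> C1 f -> (forall x, 0 <= G x) ->
  leb.-integrable D (fun x => (G x)%:E) ->
  (forall t, `|t| < 1 -> leb.-integrable D (fun x => (f (x + t *: basis_vec i))%:E)) ->
  (forall t x, `|t| < 1 -> D x -> `|pderiv i f (x + t *: basis_vec i)| <= G x) ->
  (forall t, \int[leb]_(x in D) f (x + t *: basis_vec i) = \int[leb]_(x in D) f x) ->
  \int[leb]_(x in D) pderiv i f x = 0.
Proof.
move=> mD [cf /(_ i)[df _]] G0 iG fi fG ft.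
pose g t (x : Rn) := f (x + t *: basis_vec i).
have dg (t : R) (x : Rn) : is_derive t 1 (g ^~ x) (pderiv i f (x + t *: basis_vec i)).
  by apply: derive_line; exact: df.
have I0 : `](-1), 1[%classic (0 : R) by rewrite /= in_itv/= ltrN10 ltr01.
have I1 (t : R) : `](-1), 1[%classic t -> `|t| < 1 by rewrite /= in_itv/= ltr_norml.
have d1g (t : R) (x : Rn) : partial1of2 g t x = pderiv i f (x + t *: basis_vec i).
  by rewrite partial1of2E; exact: derive_val.
have dt (t : R) (x : Rn) : derivable (g ^~ x) t 1 by apply: ex_derive; exact: dg.
have := @cvg_differentiation_under_integral R _ _ leb g D mD 0 (-1) 1 I0
  (fun t It => fi t (I1 t It)) (fun t x _ _ => dt t x) G G0 iG.
have Gub (t : R) (x : Rn) : `](-1), 1[%classic t -> D x -> `|partial1of2 g t x| <= G x.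
  by move=> /I1 t1 Dx; rewrite d1g; exact: fG.
move=> /(_ Gub).
rewrite (_ : (\int[leb]_(y in D) partial1of2 g 0 y) = \int[leb]_(x in D) pderiv i f x); last first.
  by apply: eq_Rintegral => x _; rewrite d1g scale0r addr0.
rewrite (_ : (fun h : R => _) = cst 0); last first.
  by apply/funext => h /=; rewrite /g !ft subrr scaler0.
move=> h; have := cvg_unique (@Rhausdorff R) h (cvg_cst 0); exact.
Qed.

Lemma integral_pderiv_compact (f : Rn -> R) (i : 'I_n) M : 0 <= M -> C1 f ->
  (forall x, ~ cbox M x -> f x = 0) -> \int[leb]_x pderiv i f x = 0.
Proof.
move=> M0 Cf f0; have [cf df] := Cf.
have pf0 x : ~ cbox M x -> pderiv i f x = 0.
  move=> Mx; apply: pderiv_locally0.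
  have oc : open (~` (cbox M : set Rn)).
    apply: closed_openC; apply: compact_closed; first exact: norm_hausdorff.
    exact: compact_cbox.
  have : nbhs x (~` cbox M) by exact: open_nbhs_nbhs.
  by apply: filterS.
have [C [C0 fC]] := continuous_bounded_cbox M (df i).2.
have shift_box t x : `|t| < 1 -> ~ cbox (M + 1) x -> ~ cbox M (x + t *: basis_vec i).
  move=> t1 Mx Mxt; apply: Mx => j; have := Mxt j.
  rewrite /= !mxE !in_itv/=.
  have : `|t * ((ord0 == ord0 :> 'I_1) && (j == i))%:R| < 1.
    by case: (_ && _); rewrite ?mulr1// mulr0 normr0.
  by rewrite ltr_norml => /andP[h1 h2] /andP[h3 h4]; apply/andP; split; lra.
have f2 := continuous_L2loc cf.
apply: (integral_pderiv_eq0 (G := fun x => C * \1_(cbox (M + 1)) x)) => //.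
- by move=> x; rewrite mulr_ge0// indicE.
- have := @integrable_cst_cbox R n (M + 1) C; rewrite (integrable_mkcond _ (measurable_cbox (M + 1))).
  congr (_.-integrable _ _); apply/funext => x.
  by rewrite patchE indicE; case: ifPn => _; rewrite ?mulr1 ?mulr0.
- move=> t t1; apply: (integrable_translation _ (f := fun x => (f x)%:E)).
  have := integrableM_compact_support (L2loc_cst 1) f2 f0.
  by under eq_fun do rewrite mul1r.
- move=> t x t1 _; rewrite indicE; have [Mx|Mx] := pselect (cbox (M + 1) x).
    rewrite mem_set// mulr1.
    by have [/fC//|/pf0 ->] := pselect (cbox M (x + t *: basis_vec i)); rewrite normr0.
  by rewrite memNset// mulr0 pf0 ?normr0//; exact: shift_box.
- by move=> t; apply: Rintegral_translation; exact: continuous_measurable_rV.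
Qed.

Lemma weak_pderiv_C1 (u : Rn -> R) (i : 'I_n) : C1 u -> weak_pderiv i u (pderiv i u).
Proof.
move=> Cu phi tphi; have [M [M0 phi0 _ _]] := test_function_bounded tphi.
have Cphi := smooth_C1 tphi.1.
apply/eqP; rewrite -subr_eq0 opprK -RintegralD//; last 2 first.
- apply: integrableM_test; first exact: continuous_L2loc Cu.1.
  exact: test_function_pderiv.
- by apply: integrableM_test => //; exact: continuous_L2loc (Cu.2 i).2.
have uphi0 x : ~ cbox M x -> u x * phi x = 0 by move=> /phi0 ->; rewrite mulr0.
rewrite -(integral_pderiv_compact i M0 (C1M Cu Cphi) uphi0); apply/eqP.
by apply: eq_Rintegral => x _; rewrite pderivM.
Qed.

End C1.

Section C1_periodic.
Context {R : realType} {d : nat}.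
Local Notation Rd := 'rV[R]_d.
Local Notation leb := (lebesgue_rV d : {measure set Rd -> \bar R}).
Variable B : 'M[R]_d.
Hypothesis hB : B \in unitmx.

Definition everywhere_periodic (f : Rd -> R) :=
  forall z x, f (x + lattice_point B z) = f x.

Lemma everywhere_lattice_periodic f : everywhere_periodic f -> lattice_periodic B f.
Proof. by move=> pf r [z ->]; apply: aeW => x; exact: pf. Qed.

Lemma periodic_bounded (f : Rd -> R) : continuous f -> everywhere_periodic f ->
  exists C, 0 <= C /\ forall x, `|f x| <= C.
Proof.
move=> cf pf; have [M [M0 PM]] := parallelepiped_sub_cbox hB.
have [C [C0 fC]] := continuous_bounded_cbox M cf.
exists C; split => // x.
have [z Pz] := parallelepiped_cover hB x.
rewrite -(subrK (lattice_point B z) x) pf; apply: fC; exact: PM.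
Qed.

Lemma everywhere_periodic_pderiv i (f : Rd -> R) :
  everywhere_periodic f -> everywhere_periodic (pderiv i f).
Proof.
move=> pf z x; rewrite /pderiv /derive pf.
rewrite (_ : f \o shift (x + lattice_point B z) = f \o shift x)//.
by apply/funext => h /=; rewrite addrA pf.
Qed.

(** The translation invariance required by [integral_pderiv_eq0] comes here from
    periodicity. *)
Lemma integral_pderiv_periodic V (f : Rd -> R) (i : 'I_d) : unit_cell B V ->
  C1 f -> everywhere_periodic f -> \int[leb]_(x in V) pderiv i f x = 0.
Proof.
move=> cV Cf pf; have mV : measurable V by case: cV.
have [C [C0 fC]] := periodic_bounded (Cf.2 i).2 (everywhere_periodic_pderiv i pf).
have [C' [C'0 fC']] := periodic_bounded Cf.1 pf.
have Voo : (leb V < +oo)%E by have /andP[] := lebesgue_unit_cell hB cV.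
have ic (c : R) : leb.-integrable V (fun=> c%:E).
  apply/integrableP; split; first exact: measurable_cst.
  by rewrite integral_cst// lte_mul_pinfty.
apply: (integral_pderiv_eq0 (G := fun=> C)) => //.
- move=> t t1; apply: (le_integrable mV _ _ (ic C')).
    apply/measurable_EFinP; apply: measurable_funTS.
    exact: measurableT_comp (continuous_measurable_rV Cf.1) (measurable_translation _).
  by move=> x Vx /=; rewrite lee_fin (le_trans (fC' _))// ler_norm.
- move=> t; apply: (Rintegral_unit_cell_translation hB _ cV).
    exact: continuous_measurable_rV Cf.1.
  exact: everywhere_lattice_periodic.
Qed.
End C1_periodic.

(** * Mollification *)

Section sequential.
Context {R : realType} {n : nat}.
Local Notation Rn := 'rV[R]_n.
Local Notation leb := (lebesgue_rV n : {measure set Rn -> \bar R}).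

(** Dominated convergence is a statement on sequences. Restricting them to the
    unit ball lets a single function dominate the integrands. *)
Lemma continuous_at_sequences (f : Rn -> R) (x : Rn) :
  (forall u : nat -> Rn, (forall k, ball x 1 (u k)) -> u k @[k --> \oo] --> x ->
    f (u k) @[k --> \oo] --> f x) -> {for x, continuous f}.
Proof.
move=> H; apply/(@cvgrPdist_lt R R^o Rn (nbhs x) _ f (f x)) => e e0; apply: contrapT => nH.
have ch (k : nat) : exists y, ball x k.+1%:R^-1 y /\ e <= `|f x - f y|.
  apply: contrapT => h; apply: nH; apply/nbhs_ballP; exists k.+1%:R^-1 => /=.
    by rewrite invr_gt0.
  by move=> y xy; rewrite ltNge; apply/negP => ey; apply: h; exists y.
have [u uP] := choice ch.
have ub k : ball x 1 (u k).
  by apply: (le_ball _ (uP k).1); rewrite invf_le1 ?ler1n.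
have uc : u k @[k --> \oo] --> x.
  apply/cvg_ballP => r r0.
  have := near_infty_natSinv_lt (PosNum r0); apply: filterS => k kr.
  exact: (le_ball (ltW kr) (uP k).1).
have /cvgrPdist_lt /(_ e e0)[N _ /(_ N (leqnn N)) /=] := H u ub uc.
by rewrite ltNge (uP N).2.
Qed.

Lemma cbox_ball (x : Rn) : exists N, 0 <= N /\ forall y, ball x 1 y -> cbox N y.
Proof.
have [N [N0 xN]] := compact_sub_cbox (@compact_set1 _ x).
exists (N + 1); split; first by rewrite addr_ge0.
move=> y /ball_rVE[_ xy] i; have := xN x erefl i; have := xy i.
by rewrite /= !in_itv/= ltr_norml => /andP[h1 h2] /andP[h3 h4]; apply/andP; split; lra.
Qed.

Lemma cbox_sub (x y : Rn) M N : cbox M (x - y) -> cbox N x -> cbox (M + N) y.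
Proof.
move=> h1 h2 i; move: (h1 i) (h2 i); rewrite /= !mxE !in_itv/=.
by move=> /andP[a1 a2] /andP[a3 a4]; apply/andP; split; lra.
Qed.

Lemma test_function_box (f : Rn -> R) M : smooth_rV f ->
  (forall x, ~ cbox M x -> f x = 0) -> test_function f.
Proof.
move=> sf f0; split => //.
apply: (subclosed_compact _ (@compact_cbox R n M)); first exact: closed_closure.
apply: closed_support_subset => //.
by apply: compact_closed; [exact: norm_hausdorff|exact: compact_cbox].
Qed.

Lemma continuous_reflect (f : Rn -> R) (x : Rn) : continuous f ->
  continuous (fun y : Rn => f (x - y)).
Proof.
move=> cf y; apply: (@continuous_comp Rn Rn R (fun y => x - y) f); last exact: cf.
by apply: (@continuousB R Rn Rn (cst x) id); [exact: cst_continuous|by move=> z].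
Qed.

Lemma is_derive_reflect (f : Rn -> R) (x y v : Rn) : derivable f (x - y) v ->
  is_derive y v (fun y => f (x - y)) (- 'D_v f (x - y)).
Proof.
move=> df.
have cN : (fun h : R => - h) @ 0^' --> 0^'.
  move=> A [e /= e0 eA]; exists e => // h /= he h0.
  apply: eA; last by rewrite oppr_eq0.
  by move: he; rewrite /= !sub0r !normrN.
have E : (fun h : R => h^-1 *: (((fun y => f (x - y)) \o shift y) (h *: v) - f (x - y)))
   = (fun h : R => - ((- h)^-1 *: ((f \o shift (x - y)) ((- h) *: v) - f (x - y)))).
  apply/funext => h /=; rewrite invrN scaleNr opprK; congr (_ *: (f _ - _)).
  by rewrite scaleNr opprD addrCA.
have h : h^-1 *: (((fun y => f (x - y)) \o shift y) (h *: v) - f (x - y)) @[h --> 0^'] -->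
    - 'D_v f (x - y).
  rewrite E; apply: cvgN.
  exact: (cvg_comp _ _ cN df).
by split; [apply/cvg_ex; exists (- 'D_v f (x - y))|exact: cvg_lim].
Qed.

Lemma pderiv_reflect i (f : Rn -> R) (x y : Rn) : derivable f (x - y) (basis_vec i) ->
  pderiv i (fun y => f (x - y)) y = - pderiv i f (x - y).
Proof. by move=> df; have h := is_derive_reflect df; exact: derive_val. Qed.

Lemma smooth_reflect (f : Rn -> R) (x : Rn) : smooth_rV f ->
  smooth_rV (fun y => f (x - y)).
Proof.
move=> sf.
have E s : foldr pderiv (fun y => f (x - y)) s =
    fun y => (-1) ^+ size s * foldr pderiv f s (x - y).
  elim: s => [|i s IHs]; first by apply/funext => y /=; rewrite mul1r.
  apply/funext => y; rewrite /= IHs.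
  have [_ ds] := sf s.
  rewrite /pderiv (_ : (fun y => _) = (-1) ^+ size s \*o (fun y => foldr pderiv f s (x - y)))//.
  have h := is_derive_reflect (ds i (x - y)).
  rewrite deriveMl; last exact: ex_derive.
  by rewrite derive_val exprS mulN1r mulrN mulNr.
move=> s; have [cs ds] := sf s; rewrite E; split.
  apply: continuousM_fun; first exact: cst_continuous.
  exact: continuous_reflect.
move=> i y; have h := is_derive_reflect (ds i (x - y)).
apply: derivableM; first exact: derivable_cst.
exact: ex_derive.
Qed.

Lemma test_function_reflect (f : Rn -> R) (x : Rn) : test_function f ->
  test_function (fun y => f (x - y)).
Proof.
move=> tf; have [M [_ f0 _ _]] := test_function_bounded tf.
have [N [_ xN]] := cbox_ball x.
apply: (@test_function_box _ (M + N)); first exact/smooth_reflect/tf.1.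
move=> y My; apply: f0 => h; apply: My; apply: cbox_sub h _.
by apply: xN; exact: ballxx.
Qed.

End sequential.

Section mollify.
Context {R : realType} {n : nat}.
Local Notation Rn := 'rV[R]_n.
Local Notation leb := (lebesgue_rV n : {measure set Rn -> \bar R}).
Implicit Types rho v : Rn -> R.

(** Convolution with a test function that is neither normalised nor rescaled: a
    field vanishes almost everywhere as soon as all its convolutions vanish. *)
Definition mollify rho v (x : Rn) : R := \int[leb]_y (v y * rho (x - y)).

Lemma mollify_integrable rho v x : test_function rho -> L2loc v ->
  leb.-integrable setT (fun y => (v y * rho (x - y))%:E).
Proof. by move=> trho v2; apply: integrableM_test => //; exact: test_function_reflect. Qed.

(** For centres in a ball the supports of the translated kernels stay in one
    box. *)
Lemma mollify_dominated rho v x : test_function rho -> L2loc v ->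
  exists G : Rn -> R, [/\ forall y, 0 <= G y, leb.-integrable setT (fun y => (G y)%:E) &
    forall x' y, ball x 1 x' -> `|v y * rho (x' - y)| <= G y].
Proof.
move=> trho v2; have [M [M0 rho0 _ [C [C0 rhoC]]]] := test_function_bounded trho.
have [N [N0 xN]] := cbox_ball x.
have mv := L2loc_measurable v2.
exists ((fun y => `|v y| * C) \_ (cbox (M + N))); split.
- by move=> y; rewrite patchE; case: ifPn => // _; rewrite mulr_ge0.
- have iv : leb.-integrable (cbox (M + N)) (fun y => (v y * C)%:E).
    exact: (integrableM_cbox _ v2 (L2loc_cst C)).
  have := integrable_norm iv; rewrite (integrable_mkcond _ (measurable_cbox (M + N))).
  congr (_.-integrable _ _); apply/funext => y; rewrite !patchE.
  by case: ifPn => //= _; rewrite normrM (ger0_norm C0).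
- move=> x' y xx'; rewrite patchE; case: ifPn => [_|/negP].
    by rewrite normrM ler_wpM2l.
  rewrite inE => My; rewrite rho0 ?mulr0 ?normr0// => h; apply: My.
  by apply: cbox_sub h _; exact: xN.
Qed.

Lemma mollify_continuous rho v : test_function rho -> L2loc v ->
  continuous (mollify rho v).
Proof.
move=> trho v2 x; apply: continuous_at_sequences => u ux uc.
have [G [G0 iG vG]] := mollify_dominated x trho v2.
rewrite /mollify /Rintegral.
apply: fine_cvg.
rewrite fineK; last exact: (integrable_fin_num _ (mollify_integrable x trho v2)).
apply: (@dominated_cvg _ _ _ leb setT measurableT
  (fun k y => (v y * rho (u k - y))%:E) _ (fun y => (G y)%:E)) => //.
- by move=> k; exact: measurable_int (mollify_integrable (u k) trho v2).
- move=> y _; apply: cvg_EFin; first exact: nearW.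
  apply: cvgMl_tmp.
  have cr : continuous (fun z : Rn => rho (z - y)).
    move=> z; apply: (@continuous_comp Rn Rn R (fun z => z - y) rho).
      by apply: (@continuousB R Rn Rn id (cst y)); [by move=> w|exact: cst_continuous].
    exact: (smooth_continuous trho.1).
  exact: (cvg_comp _ _ uc (cr x)).
- by move=> k y _; rewrite lee_fin; exact: vG.
Qed.

Lemma mollify_is_derive rho v i x : test_function rho -> L2loc v ->
  is_derive x (basis_vec i) (mollify rho v) (mollify (pderiv i rho) v x).
Proof.
move=> trho v2.
have tprho := test_function_pderiv i trho.
have [G [G0 iG vG]] := mollify_dominated x tprho v2.
pose g t (y : Rn) := v y * rho (x + t *: basis_vec i - y).
have dg (t : R) (y : Rn) : is_derive t 1 (g ^~ y) (v y * pderiv i rho (x + t *: basis_vec i - y)).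
  have dl : is_derive t 1 (fun s => rho ((x - y) + s *: basis_vec i))
      ('D_(basis_vec i) rho ((x - y) + t *: basis_vec i)).
    by apply: derive_line; exact: (smooth_derivable trho.1).
  have E : g ^~ y = v y \*o (fun s => rho ((x - y) + s *: basis_vec i)).
    by apply/funext => s; rewrite /g /= addrAC.
  rewrite E addrAC; split.
    by apply: derivableM; [exact: derivable_cst|exact: ex_derive].
  by rewrite deriveMl; [rewrite derive_val|exact: ex_derive].
have I0 : `](-1), 1[%classic (0 : R) by rewrite /= in_itv/= ltrN10 ltr01.
have I1 (t : R) : `](-1), 1[%classic t -> ball x 1 (x + t *: basis_vec i).
  rewrite /= in_itv/= -ltr_norml => t1; apply/ball_rVE; split => // j.
  rewrite !mxE opprD addrA subrr sub0r normrN.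
  by case: (_ && _); rewrite ?mulr1// mulr0 normr0.
have d1g (t : R) (y : Rn) : partial1of2 g t y = v y * pderiv i rho (x + t *: basis_vec i - y).
  by rewrite partial1of2E; exact: derive_val.
have dt (t : R) (y : Rn) : derivable (g ^~ y) t 1 by apply: ex_derive; exact: dg.
have Gub (t : R) (y : Rn) : `](-1), 1[%classic t -> setT y -> `|partial1of2 g t y| <= G y.
  by move=> /I1 t1 _; rewrite d1g; exact: vG.
have := @cvg_differentiation_under_integral R _ _ leb g setT measurableT 0 (-1) 1 I0
  (fun t It => mollify_integrable _ trho v2) (fun t y _ _ => dt t y) G G0 iG Gub.
rewrite (_ : (\int[leb]_(y in setT) partial1of2 g 0 y) = mollify (pderiv i rho) v x); last first.
  by apply: eq_Rintegral => y _; rewrite d1g scale0r addr0.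
rewrite (_ : (fun h : R => _) = (fun h : R =>
    h^-1 *: ((mollify rho v \o shift x) (h *: basis_vec i) - mollify rho v x))); last first.
  apply/funext => h; congr (_ *: (_ - _)); apply: eq_Rintegral => y _; rewrite /g.
    by rewrite addr0; congr (_ * rho (_ - _)); exact: addrC.
  by rewrite scale0r addr0.
by move=> h; split; [apply/cvg_ex; exists (mollify (pderiv i rho) v x)|exact: cvg_lim].
Qed.

Lemma pderiv_mollify rho v i : test_function rho -> L2loc v ->
  pderiv i (mollify rho v) = mollify (pderiv i rho) v.
Proof.
by move=> trho v2; apply/funext => x; have h := mollify_is_derive i x trho v2; exact: derive_val.
Qed.

Lemma C1_mollify rho v : test_function rho -> L2loc v -> C1 (mollify rho v).
Proof.
move=> trho v2; split; first exact: mollify_continuous.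
move=> i; split.
  by move=> x; have h := mollify_is_derive i x trho v2; exact: ex_derive.
rewrite pderiv_mollify//; apply: mollify_continuous => //.
exact: test_function_pderiv.
Qed.

(** The derivative falls on the kernel, whence on the reflected kernel as a test
    function with the opposite sign. *)
Lemma mollify_weak_pderiv rho v g i : test_function rho -> L2loc v -> L2loc g ->
  weak_pderiv i v g -> pderiv i (mollify rho v) = mollify rho g.
Proof.
move=> trho v2 g2 vg; rewrite pderiv_mollify//; apply/funext => x.
have := vg _ (test_function_reflect x trho).
rewrite -/(mollify rho g x) => /(congr1 -%R); rewrite opprK => <-.
have E y : pderiv i (fun y => rho (x - y)) y = - pderiv i rho (x - y).
  by apply: pderiv_reflect; exact: (smooth_derivable trho.1).
transitivity (- \int[leb]_y ((-1) * (v y * pderiv i rho (x - y)))).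
  rewrite RintegralZl//; first by rewrite mulN1r opprK.
  by apply: mollify_integrable => //; exact: test_function_pderiv.
by congr (- _); apply: eq_Rintegral => y _; rewrite E mulN1r mulrN.
Qed.

Lemma mollifyD rho v w x : test_function rho -> L2loc v -> L2loc w ->
  mollify rho (fun y => v y + w y) x = mollify rho v x + mollify rho w x.
Proof.
move=> trho v2 w2; rewrite /mollify -RintegralD//; try exact: mollify_integrable.
by apply: eq_Rintegral => y _; rewrite mulrDl.
Qed.

Lemma mollifyZ rho v c x : test_function rho -> L2loc v ->
  mollify rho (fun y => c * v y) x = c * mollify rho v x.
Proof.
move=> trho v2; rewrite /mollify -RintegralZl//; last exact: mollify_integrable.
by apply: eq_Rintegral => y _; rewrite mulrA.
Qed.

Lemma mollify_sum rho (I : Type) (r : seq I) (F : I -> Rn -> R) x : test_function rho ->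
  (forall k, L2loc (F k)) ->
  mollify rho (fun y => \sum_(k <- r) F k y) x = \sum_(k <- r) mollify rho (F k) x.
Proof.
move=> trho F2; elim: r => [|k r IHr].
  under eq_fun do rewrite big_nil; rewrite big_nil /mollify.
  under eq_Rintegral do rewrite mul0r.
  by rewrite /Rintegral integral0.
under eq_fun do rewrite big_cons; rewrite big_cons mollifyD ?IHr//.
exact: L2loc_sum.
Qed.

Lemma mollify_ae_eq rho v w x : test_function rho -> L2loc v -> L2loc w ->
  (\forall y \ae leb, v y = w y) -> mollify rho v x = mollify rho w x.
Proof.
move=> trho v2 w2 vw; congr fine; apply: ae_eq_integral => //.
- exact: measurable_int (mollify_integrable x trho v2).
- exact: measurable_int (mollify_integrable x trho w2).
by apply: filterS vw => y -> _.
Qed.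

Lemma mollify_periodic (B : 'M[R]_n) rho v : test_function rho -> L2loc v ->
  lattice_periodic B v -> everywhere_periodic B (mollify rho v).
Proof.
move=> trho v2 pv z x.
have mv : measurable_fun setT (fun y => v y * rho (x + lattice_point B z - y)).
  by apply/measurable_EFinP; exact: measurable_int (mollify_integrable _ trho v2).
rewrite /mollify -(Rintegral_translation (lattice_point B z) mv).
have mv' := measurableT_comp mv (measurable_translation (lattice_point B z)).
congr fine; apply: ae_eq_integral => //.
- exact/measurable_EFinP.
- exact: measurable_int (mollify_integrable x trho v2).
apply: filterS (pv _ (lattice_latticeP B z)) => y -> _.
by rewrite opprD addrACA subrr addr0.
Qed.

End mollify.

(** * Smooth bumps on boxes *)

Section flat.
Context {R : realType}.
Implicit Types (t : R) (k : nat).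

(** The functions [t^-k exp(-1/t)], extended by 0 to the left. The derivative of
    one of them is a combination of two others of the family, which makes them
    smooth. *)
Definition flat k t : R := if 0 < t then t^-1 ^+ k * expR (- t^-1) else 0.

Lemma flat_ge0 k t : 0 <= flat k t.
Proof.
rewrite /flat; case: ifP => // t0; rewrite mulr_ge0 ?expR_ge0// exprn_ge0//.
by rewrite invr_ge0 ltW.
Qed.

Lemma flat0_le1 t : flat 0 t <= 1.
Proof.
rewrite /flat; case: ifP => // t0; rewrite mul1r -expR0 ler_expR oppr_le0 invr_ge0.
exact: ltW.
Qed.

(** The exponential series at [1/t] gives [t^-(k+2) <= (k+2)! exp(1/t)]. A
    quadratic bound yields the zero derivative at 0. *)
Lemma flat_le_sqr k t : flat k t <= k.+2`!%:R * t ^+ 2.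
Proof.
rewrite /flat; case: ifP => t0; last by rewrite mulr_ge0 ?sqr_ge0.
have u0 : 0 <= t^-1 by rewrite invr_ge0 ltW.
have := expR_ge1Dxn k.+1 u0; rewrite expRN => h.
have f0 : (0 : R) < k.+2`!%:R by rewrite ltr0n fact_gt0.
have {}h : t^-1 ^+ k.+2 <= k.+2`!%:R * expR (t^-1).
  by rewrite mulrC -ler_pdivrMr// (le_trans _ h)// lerDr.
rewrite ler_pdivrMr ?expR_gt0//.
rewrite (_ : t^-1 ^+ k = t^-1 ^+ k.+2 * t ^+ 2); last first.
  by rewrite -addn2 exprD -mulrA -exprMn mulVf ?expr1n ?mulr1// gt_eqF.
by rewrite [leRHS]mulrAC ler_wpM2r// sqr_ge0.
Qed.

Lemma is_derive_comp1 (f g : R -> R) (x df dg : R) : is_derive x 1 f df ->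
  is_derive (f x) 1 g dg -> is_derive x 1 (g \o f) (dg * df).
Proof.
move=> [f1 f2] [g1 g2]; split.
  apply/derivable1_diffP/differentiable_comp; exact/derivable1_diffP.
by rewrite -derive1E derive1_comp// !derive1E f2 g2.
Qed.

Lemma is_derive_affine (c d x : R) : is_derive x 1 (fun s => c * s + d) c.
Proof.
rewrite (_ : (fun s => _) = c *: (id : R -> R) + cst d); last exact/funext.
by apply: is_derive_eq; rewrite addr0 [c *: _]mulr1.
Qed.

Lemma is_derive_flat_pos k t : 0 < t ->
  is_derive t 1 (fun s => s^-1 ^+ k * expR (- s^-1))
    (flat k.+2 t - k%:R * flat k.+1 t).
Proof.
move=> t0; have tn0 : t != 0 by rewrite gt_eqF.
have dV : is_derive t 1 (fun s : R => s^-1) (- t ^- 2).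
  split; first exact: derivableV.
  by rewrite deriveV// derive_id /GRing.scale/= mulr1.
pose h (u : R) := u ^+ k * expR (- u).
have dh (u : R) : is_derive u 1 h (u ^+ k * - expR (- u) + expR (- u) * (k%:R * u ^+ k.-1)).
  have de : is_derive u 1 (fun u : R => expR (- u)) (expR (- u) * -1).
    by apply: (@is_derive_comp1 (fun u => - u) expR); exact: is_deriveNid.
  have dX : is_derive u 1 (fun u : R => u ^+ k) (k%:R * u ^+ k.-1).
    split; first exact: exprn_derivable.
    by rewrite exp_derive /GRing.scale/= mulr1.
  apply: is_derive_eq (is_deriveM dX de) _.
  by rewrite /GRing.scale/= mulrN1.
apply: is_derive_eq (is_derive_comp1 dV (dh t^-1)) _.
rewrite /flat t0.
case: k {h dh} => [|k]; rewrite /= ?mul0r ?mulr0 ?subr0 ?addr0 -?exprVn.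
  by rewrite expr0 mul1r mulrNN mulrC.
rewrite !exprS; ring.
Qed.

Lemma is_derive_flat k t : is_derive t 1 (flat k) (flat k.+2 t - k%:R * flat k.+1 t).
Proof.
have [t0|t0|<-] := ltgtP 0 t.
- apply: near_eq_is_derive (is_derive_flat_pos k t0).
  have : \forall s \near t, 0 < s by exact: lt_nbhsr.
  by apply: filterS => s s0; rewrite /flat s0.
- rewrite {2 3}/flat ltNge (ltW t0)/= mulr0 subr0.
  apply: near_eq_is_derive (is_derive_cst 0 t 1).
  have : \forall s \near t, s < 0 by exact: lt_nbhsl.
  by apply: filterS => s s0; rewrite /flat ltNge (ltW s0).
rewrite {2 3}/flat ltxx mulr0 subr0.
(* The difference quotient at [h] is at most [k.+2`! * |h|]. *)
have h : h^-1 *: ((flat k \o shift 0) (h *: 1) - flat k 0) @[h --> 0^'] --> (0 : R).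
  apply/cvgrPdist_lt => e e0.
  pose K : R := k.+2`!%:R; have K0 : 0 < K by rewrite ltr0n fact_gt0.
  exists (e / K) => /=; first exact: divr_gt0.
  move=> h /=; rewrite !sub0r !normrN => he h0.
  rewrite addr0 {2}/flat ltxx subr0 [h *: _]mulr1 normrM normfV.
  rewrite (ger0_norm (flat_ge0 _ _)) mulrC ltr_pdivrMr ?normr_gt0//.
  apply: le_lt_trans (flat_le_sqr _ _) _.
  rewrite -(real_normK (num_real h)) expr2 mulrA ltr_pM2r ?normr_gt0//.
  by rewrite mulrC -ltr_pdivlMr.
by split; [apply/cvg_ex; exists 0|exact: cvg_lim].
Qed.

Lemma continuous_flat k : continuous (flat k).
Proof.
move=> t; apply/differentiable_continuous/derivable1_diffP.
have h := is_derive_flat k t; exact: ex_derive.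
Qed.
End flat.

Section bump_algebra.
Context {R : realType} {n : nat}.
Local Notation Rn := 'rV[R]_n.

(** The algebra generated by flat functions of one coordinate is closed under
    partial derivatives, so that all its members are smooth. *)
Inductive bump_algebra : (Rn -> R) -> Prop :=
| bump_cst c : bump_algebra (fun=> c)
| bump_flat k a b j : bump_algebra (fun x => flat k (a * x ord0 j + b))
| bump_add f g : bump_algebra f -> bump_algebra g -> bump_algebra (fun x => f x + g x)
| bump_mul f g : bump_algebra f -> bump_algebra g -> bump_algebra (fun x => f x * g x).

Lemma is_derive_lineP (f : Rn -> R) (x v : Rn) df :
  is_derive (0 : R) 1 (fun s => f (x + s *: v)) df -> is_derive x v f df.
Proof.
have E : (fun h : R => h^-1 *: (((fun s => f (x + s *: v)) \o shift 0) (h *: 1) - f (x + 0 *: v)))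
   = (fun h : R => h^-1 *: ((f \o shift x) (h *: v) - f x)).
  apply/funext => h /=; rewrite [h *: (1 : R)]mulr1 addr0 scale0r addr0.
  by rewrite [x + _]addrC.
move=> [d1 d2]; split.
  by move: d1; rewrite /derivable E.
by move: d2; rewrite /derive E.
Qed.

Lemma bump_algebra_derive f : bump_algebra f -> forall i, exists2 g, bump_algebra g &
  forall x, is_derive x (basis_vec i) f (g x).
Proof.
elim=> [c|k a b j|f1 f2 _ IH1 _ IH2|f1 f2 B1 IH1 B2 IH2] i.
- by exists (fun=> 0); [exact: bump_cst|move=> x; exact: is_derive_cst].
- pose c : R := a * (j == i)%:R.
  exists (fun x => c * (flat k.+2 (a * x ord0 j + b) + (- k%:R) * flat k.+1 (a * x ord0 j + b))).
    apply: bump_mul; first exact: bump_cst.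
    apply: bump_add; first exact: bump_flat.
    by apply: bump_mul; [exact: bump_cst|exact: bump_flat].
  move=> x; apply: is_derive_lineP.
  have da : is_derive (0 : R) 1 (fun s : R => c * s + (a * x ord0 j + b)) c.
    exact: is_derive_affine.
  have := is_derive_comp1 da (is_derive_flat k (c * 0 + (a * x ord0 j + b))).
  rewrite mulr0 add0r mulNr [_ * c]mulrC.
  congr (is_derive _ _ _ _); apply/funext => s /=; congr flat.
  by rewrite !mxE eqxx /= /c; case: eqP => _; ring.
- have [g1 B1 d1] := IH1 i; have [g2 B2 d2] := IH2 i.
  by exists (fun x => g1 x + g2 x); [exact: bump_add|move=> x; exact: is_deriveD].
- have [g1 C1 d1] := IH1 i; have [g2 C2 d2] := IH2 i.
  exists (fun x => f1 x * g2 x + f2 x * g1 x).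
    by apply: bump_add; exact: bump_mul.
  by move=> x; exact: is_deriveM.
Qed.

Lemma bump_algebra_continuous f : bump_algebra f -> continuous f.
Proof.
elim=> [c|k a b j|f1 f2 _ c1 _ c2|f1 f2 _ c1 _ c2].
- exact: cst_continuous.
- move=> x; apply: (@continuous_comp Rn R R (fun x => a * x ord0 j + b) (flat k)).
    apply: continuousD_fun; last exact: cst_continuous.
    apply: continuousM_fun; first exact: cst_continuous.
    exact: coord_continuous.
  exact: continuous_flat.
- exact: continuousD_fun.
- exact: continuousM_fun.
Qed.

Lemma bump_algebra_smooth f : bump_algebra f -> smooth_rV f.
Proof.
move=> Bf; suff Bs s : bump_algebra (foldr pderiv f s).
  move=> s; split; first exact: bump_algebra_continuous.
  by move=> i x; have [g _ /(_ x) h] := bump_algebra_derive (Bs s) i; exact: ex_derive.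
elim: s => [//|i s IHs] /=.
have [g Bg dg] := bump_algebra_derive IHs i.
rewrite (_ : pderiv i _ = g)//; apply/funext => x.
by have h := dg x; exact: derive_val.
Qed.

Lemma bump_algebra_prod (I : Type) (r : seq I) (F : I -> Rn -> R) :
  (forall i, bump_algebra (F i)) -> bump_algebra (fun x => \prod_(i <- r) F i x).
Proof.
move=> BF; elim: r => [|i r IHr].
  by under eq_fun do rewrite big_nil; exact: bump_cst.
by under eq_fun do rewrite big_cons; exact: bump_mul.
Qed.

End bump_algebra.

Section box_bump.
Context {R : realType} {n : nat}.
Local Notation Rn := 'rV[R]_n.
Local Notation leb := (lebesgue_rV n : {measure set Rn -> \bar R}).
Implicit Types a b : 'I_n -> R.

Definition open_box a b : set Rn := [set x | forall i, `]a i, b i[%classic (x ord0 i)].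

Lemma measurable_open_box a b : measurable (open_box a b).
Proof.
have mI (i : 'I_n) : measurable `]a i, b i[%classic by exact: measurable_itv.
exact: measurable_forall_coord mI.
Qed.

Lemma open_box_sub_cbox a b : exists M, 0 <= M /\ open_box a b `<=` cbox M.
Proof.
exists (\sum_i (`|a i| + `|b i|)); split.
  by apply: sumr_ge0 => i _; rewrite addr_ge0.
move=> x abx i; have := abx i; rewrite /= !in_itv/= => /andP[ax xb].
rewrite (bigD1 i)//=; set S := \sum_(_ | _) _.
have S0 : 0 <= S by apply: sumr_ge0 => j _; rewrite addr_ge0.
have := ler_norm (b i); have := ler_norm (- a i); rewrite normrN.
have := normr_ge0 (b i); have := normr_ge0 (a i).
by move=> h1 h2 h3 h4; apply/andP; split; lra.
Qed.

(** For [k] tending to infinity, [flat 0 (k * s)] tends to 1 for [s > 0] and is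
    0 for [s <= 0]; these test functions thus tend, boundedly, to the indicator
    of the box. *)
Definition box_bump a b (k : nat) (x : Rn) : R :=
  \prod_(i < n) (flat 0 (k.+1%:R * (x ord0 i - a i)) *
                 flat 0 (k.+1%:R * (b i - x ord0 i))).

Lemma box_bump_ge0 a b k x : 0 <= box_bump a b k x.
Proof. by apply: prodr_ge0 => i _; rewrite mulr_ge0// flat_ge0. Qed.

Lemma box_bump_le1 a b k x : box_bump a b k x <= 1.
Proof.
by apply: prodr_ile1 => i _; rewrite mulr_ge0 ?flat_ge0//= mulr_ile1// ?flat_ge0// flat0_le1.
Qed.

Lemma box_bump_eq0 a b k x : ~ open_box a b x -> box_bump a b k x = 0.
Proof.
move=> /existsNP[i xi]; rewrite /box_bump (bigD1 i)//=.
have k0 : (0 : R) < k.+1%:R by rewrite ltr0n.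
move: xi; rewrite /= in_itv/= => /negP; rewrite negb_and -!leNgt => /orP[h|h].
  by rewrite /flat ltNge pmulr_rle0// subr_le0 h !mul0r.
by rewrite {2}/flat ltNge pmulr_rle0// subr_le0 h/= mulr0 mul0r.
Qed.

Lemma box_bump_test a b k : test_function (box_bump a b k).
Proof.
have [M [_ abM]] := open_box_sub_cbox a b.
apply: (@test_function_box _ _ _ M).
  apply: bump_algebra_smooth; apply: bump_algebra_prod => i.
  pose K : R := k.+1%:R.
  rewrite (_ : (fun x : Rn => _) = fun x : Rn =>
    flat 0 (K * x ord0 i + - (K * a i)) * flat 0 (- K * x ord0 i + K * b i)).
    by apply: bump_mul; exact: bump_flat.
  by apply/funext => x; congr (flat 0 _ * flat 0 _); rewrite /K; ring.
by move=> x Mx; apply: box_bump_eq0 => /abM.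
Qed.

Lemma flat0_scale_cvg (s : R) : 0 < s -> flat 0 (k.+1%:R * s) @[k --> \oo] --> (1 : R).
Proof.
move=> s0.
rewrite (_ : (fun k : nat => _) = (fun k => expR (- (k.+1%:R^-1 * s^-1)))); last first.
  by apply/funext => k; rewrite /flat mulr_gt0// mul1r invfM.
rewrite -[X in _ --> X]expR0; apply: continuous_cvg; first exact: continuous_expR.
rewrite -[X in _ --> X]oppr0; apply: cvgN.
rewrite -[X in _ --> X](mul0r s^-1). exact: (cvgMr_tmp (b := s^-1) (@cvg_harmonic R)).
Qed.

Lemma cvg_prod_fun (I : Type) (r : seq I) (F : I -> nat -> R) :
  (forall i, F i k @[k --> \oo] --> (1 : R)) ->
  \prod_(i <- r) F i k @[k --> \oo] --> (1 : R).
Proof.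
move=> F1; elim: r => [|i r IHr].
  by under eq_fun do rewrite big_nil; exact: cvg_cst.
have h := cvgM (F1 i) IHr; rewrite mulr1 in h.
by under eq_fun do rewrite big_cons; exact: h.
Qed.

Lemma box_bump_cvg a b x : open_box a b x -> box_bump a b k x @[k --> \oo] --> (1 : R).
Proof.
move=> abx; apply: cvg_prod_fun => i.
have := abx i; rewrite /= in_itv/= => /andP[ax xb].
rewrite -[X in _ --> X]mulr1; apply: cvgM.
  by apply: flat0_scale_cvg; rewrite subr_gt0.
by apply: flat0_scale_cvg; rewrite subr_gt0.
Qed.

Lemma integral_open_box_eq0 (v : Rn -> R) a b : L2loc v ->
  (forall phi, test_function phi -> \int[leb]_x (v x * phi x) = 0) ->
  (\int[leb]_(x in open_box a b) (v x)%:E = 0)%E.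
Proof.
move=> v2 v0; have mv := L2loc_measurable v2.
have [M [_ abM]] := open_box_sub_cbox a b.
rewrite integral_mkcond.
have iv : leb.-integrable (cbox M) (fun x => (v x * 1)%:E).
  exact: (integrableM_cbox _ v2 (L2loc_cst 1)).
have iG : leb.-integrable setT (fun x => (((fun y => `|v y|) \_ (cbox M)) x)%:E).
  have := integrable_norm iv; rewrite (integrable_mkcond _ (measurable_cbox M)).
  congr (_.-integrable _ _); apply/funext => y; rewrite !patchE.
  by case: ifPn => //= _; rewrite mulr1.
have h : (\int[leb]_x (v x * box_bump a b k x)%:E)%E @[k --> \oo] -->
    (\int[leb]_x ((fun x => (v x)%:E) \_ (open_box a b)) x)%E.
  apply: (@dominated_cvg _ _ _ leb setT measurableT
    (fun k x => (v x * box_bump a b k x)%:E) _ _ _ _ _ iG) => //.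
  - by move=> k; exact: measurable_int (integrableM_test v2 (box_bump_test a b k)).
  - move=> x _; rewrite patchE; case: ifPn => [|/negP]; rewrite inE => abx.
      apply: cvg_EFin; first exact: nearW.
      rewrite -[X in _ --> X]mulr1; apply: cvgMl_tmp; exact: box_bump_cvg.
    by under eq_fun do rewrite box_bump_eq0// mulr0; exact: cvg_cst.
  - move=> k x _; rewrite /= lee_fin patchE; case: ifPn => [_|/negP].
      rewrite normrM (ger0_norm (box_bump_ge0 _ _ _ _)).
      by rewrite ler_piMr// box_bump_le1.
    rewrite inE => Mx; rewrite box_bump_eq0 ?mulr0 ?normr0// => /abM //.
have : (\int[leb]_x (v x * box_bump a b k x)%:E)%E @[k --> \oo] --> (0%E : \bar R).
  rewrite (_ : (fun k => _) = cst 0%E); first exact: cvg_cst.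
  apply/funext => k /=.
  have ft := integrable_fin_num measurableT (integrableM_test v2 (box_bump_test a b k)).
  by rewrite -(fineK ft) -/(Rintegral _ _ _) v0//; exact: box_bump_test.
exact: (cvg_unique _ h).
Qed.

End box_bump.

(** * The fundamental lemma of the calculus of variations *)

Section fundamental_lemma.
Context {R : realType} {n : nat}.
Local Notation Rn := 'rV[R]_n.
Local Notation leb := (lebesgue_rV n : {measure set Rn -> \bar R}).

Definition open_boxes : set (set Rn) := [set A | exists a b, A = open_box a b].

Lemma open_box_cover (x : Rn) : exists k : nat, forall i, `|x ord0 i| < k%:R.
Proof.
exists (Num.bound (\sum_i `|x ord0 i|)) => i.
apply: le_lt_trans (archi_boundP _); last by apply: sumr_ge0.
by rewrite (bigD1 i)//= lerDl sumr_ge0.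
Qed.

Lemma setI_closed_open_boxes : setI_closed open_boxes.
Proof.
move=> _ _ [a [b ->]] [a' [b' ->]].
exists (fun i => Num.max (a i) (a' i)), (fun i => Num.min (b i) (b' i)).
apply/seteqP; split => [x [h h'] i|x h].
  by have := h i; have := h' i; rewrite /= !in_itv/= gt_max lt_min => /andP[-> ->] /andP[-> ->].
by split => i; have := h i; rewrite /= !in_itv/= gt_max lt_min => /andP[/andP[? ?] /andP[? ?]]; apply/andP.
Qed.

(** Dynkin's theorem asks for a generating family closed under intersections. *)
Lemma measurable_rV_open_boxes :
  @measurable _ Rn = <<s open_boxes >>.
Proof.
apply/seteqP; split; last first.
  apply: smallest_sub; first exact: sigma_algebra_measurable.
  by move=> _ [a [b ->]]; exact: measurable_open_box.
have mc (i : 'I_n) : @measurable_fun _ _ (g_sigma_algebraType open_boxes) R setT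
    (fun x : Rn => x ord0 i).
  apply: (measurability _ (RGenOpens.measurableE R)) => //.
  move=> _ [_ [a [b ->]] <-]; rewrite setTI.
  rewrite (_ : _ @^-1` _ = \bigcup_k open_box
    (fun j => if j == i then a else - k%:R) (fun j => if j == i then b else k%:R)).
    apply: bigcupT_measurable => k; apply: sub_sigma_algebra.
    by eexists; eexists; reflexivity.
  apply/seteqP; split => [x /= abx|x [k _] /(_ i)]; last by rewrite eqxx.
  have [k xk] := open_box_cover x; exists k => // j /=.
  by case: eqP => [->//|_]; rewrite in_itv/= -ltr_norml.
apply: smallest_sub; first exact: smallest_sigma_algebra.
move=> A; rewrite -bigcup_seq/= => -[i _ [Y mY <-]].
rewrite setTI; have := mc i measurableT Y mY; by rewrite setTI.
Qed.

Lemma integral_box_measurable_eq0 (v : Rn -> R) a b : L2loc v ->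
  (forall phi, test_function phi -> \int[leb]_x (v x * phi x) = 0) ->
  forall A, measurable A -> (\int[leb]_(x in open_box a b `&` A) (v x)%:E = 0)%E.
Proof.
move=> v2 v0 A; have mv := L2loc_measurable v2.
have [M [_ abM]] := open_box_sub_cbox a b.
have mK := measurable_open_box a b; set K := open_box a b.
have iK : leb.-integrable K (fun x => (v x)%:E).
  apply: (integrableS (measurable_cbox M)) => //.
  have := integrableM_cbox M v2 (L2loc_cst 1).
  by under eq_fun do rewrite mulr1.
have iKA A' : measurable A' -> leb.-integrable (K `&` A') (fun x => (v x)%:E).
  by move=> mA; apply: integrableS iK => //; exact: measurableI.
rewrite measurable_rV_open_boxes; move: A.
apply: (@dynkin_induction _ Rn open_boxes
  (fun A => \int[leb]_(x in K `&` A) (v x)%:E = 0)%E).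
- exact: measurable_rV_open_boxes.
- exact: setI_closed_open_boxes.
- by rewrite setIT; exact: integral_open_box_eq0.
- move=> _ [a' [b' ->]]; have [a'' [b'' E]] := setI_closed_open_boxes
    (ex_intro _ a (ex_intro _ b erefl)) (ex_intro _ a' (ex_intro _ b' erefl)).
  by rewrite E; exact: integral_open_box_eq0.
- move=> S mS S0.
  have := integral_open_box_eq0 a b v2 v0; rewrite -/K.
  rewrite -{1}(setIT K) -(setUv S) setIUr integral_setU_EFin//.
  + by move: S0 => ->; rewrite add0e.
  + exact: measurableI.
  + by apply: measurableI => //; exact: measurableC.
  + exact: measurable_funTS.
  + by apply/disj_setPS => x [[_ Sx] [_ nSx]]; exact: nSx.
- move=> F mF tF F0; rewrite setI_bigcupr integral_bigcup.
  + by apply: eseries0 => k _ _; exact: F0.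
  + exact: trivIset_setIl.
  + by move=> k; exact: measurableI.
  + by rewrite -setI_bigcupr; apply: iKA; exact: bigcupT_measurable.
Qed.

(** Test functions tend boundedly to the indicator of any box, and boxes form a
    pi-system that generates the Borel sets; so the integral of [v] over every
    bounded Borel set is 0. *)
Lemma fundamental_lemma (v : Rn -> R) : L2loc v ->
  (forall phi, test_function phi -> \int[leb]_x (v x * phi x) = 0) ->
  \forall x \ae leb, v x = 0.
Proof.
move=> v2 v0; have mv := L2loc_measurable v2.
pose K (k : nat) : set Rn := open_box (fun=> - k%:R) (fun=> k%:R).
have aeK k : \forall x \ae leb, K k x -> v x = 0.
  have mK : measurable (K k) by exact: measurable_open_box.
  have [M [_ abM]] := open_box_sub_cbox (fun _ : 'I_n => - k%:R : R) (fun=> k%:R).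
  have iK : leb.-integrable (K k) (fun x => (v x)%:E).
    apply: (integrableS (measurable_cbox M)) => //.
    have := integrableM_cbox M v2 (L2loc_cst 1).
    by under eq_fun do rewrite mulr1.
  have := @integral_ae_eq _ _ _ leb (K k) mK (cst 0%E) _ iK (measurable_cst _).
  have h E : E `<=` K k -> measurable E ->
      (\int[leb]_(x in E) (v x)%:E = \int[leb]_(x in E) cst 0 x)%E.
    move=> EK mE; rewrite integral0 -(setIidr EK).
    exact: integral_box_measurable_eq0.
  by move=> /(_ h); apply: filterS => x /= vx /vx [].
have : \forall x \ae leb, forall k, K k x -> v x = 0 by exact: ae_foralln.
apply: filterS => x /= h.
have [k xk] := open_box_cover x; apply: (h k) => i /=.
by rewrite in_itv/= -ltr_norml.
Qed.

End fundamental_lemma.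

(** * Fourth-order tensors and their inverses *)

Section tensor_algebra.
Context {R : realType} {d : nat}.
Local Notation Md := 'M[R]_d.
Implicit Types (s e f : Md) (T S : tensor4 R d).

Lemma ddotC s e : ddot s e = ddot e s.
Proof. by apply: eq_bigr => i _; apply: eq_bigr => j _; rewrite mulrC. Qed.

Lemma ddotDl s s' e : ddot (s + s') e = ddot s e + ddot s' e.
Proof.
rewrite -big_split; apply: eq_bigr => i _; rewrite -big_split; apply: eq_bigr => j _.
by rewrite mxE mulrDl.
Qed.

Lemma ddotZl c s e : ddot (c *: s) e = c * ddot s e.
Proof.
rewrite /ddot mulr_sumr; apply: eq_bigr => i _; rewrite mulr_sumr; apply: eq_bigr => j _.
by rewrite mxE mulrA.
Qed.

Lemma ddotDr s e e' : ddot s (e + e') = ddot s e + ddot s e'.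
Proof. by rewrite ddotC ddotDl ![ddot _ s]ddotC. Qed.

Lemma ddotZr c s e : ddot s (c *: e) = c * ddot s e.
Proof. by rewrite ddotC ddotZl ddotC. Qed.

Lemma ddot_tr s e : ddot s^T e = ddot s e^T.
Proof.
rewrite /ddot exchange_big; apply: eq_bigr => i _; apply: eq_bigr => j _.
by rewrite !mxE.
Qed.

Lemma ddot_sqr_ge0 e : 0 <= ddot e e.
Proof. by apply: sumr_ge0 => i _; apply: sumr_ge0 => j _; rewrite -expr2 sqr_ge0. Qed.

Lemma ddot_entry e i j : e i j ^+ 2 <= ddot e e.
Proof.
rewrite /ddot (bigD1 i)//= (bigD1 j)//= -expr2 -addrA lerDl addr_ge0//.
  by apply: sumr_ge0 => k _; rewrite -expr2 sqr_ge0.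
by apply: sumr_ge0 => k _; apply: sumr_ge0 => l _; rewrite -expr2 sqr_ge0.
Qed.

Lemma ddot_sqr_eq0 e : ddot e e = 0 -> e = 0.
Proof.
move=> e0; apply/matrixP => i j; rewrite mxE; apply/eqP.
by rewrite -sqrf_eq0 eq_le sqr_ge0 andbT -e0 ddot_entry.
Qed.

Lemma tensor4_appD T e f : tensor4_app T (e + f) = tensor4_app T e + tensor4_app T f.
Proof.
apply/matrixP => i j; rewrite !mxE -big_split; apply: eq_bigr => k _.
by rewrite -big_split; apply: eq_bigr => l _; rewrite mxE mulrDr.
Qed.

Lemma tensor4_appZ T c e : tensor4_app T (c *: e) = c *: tensor4_app T e.
Proof.
apply/matrixP => i j; rewrite !mxE mulr_sumr; apply: eq_bigr => k _.
by rewrite mulr_sumr; apply: eq_bigr => l _; rewrite mxE mulrCA.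
Qed.

Lemma tensor4_app_lin T c e f :
  tensor4_app T (c *: e + f) = c *: tensor4_app T e + tensor4_app T f.
Proof. by rewrite tensor4_appD tensor4_appZ. Qed.

Lemma tensor4_appB T e f : tensor4_app T (e - f) = tensor4_app T e - tensor4_app T f.
Proof. by rewrite tensor4_appD -scaleN1r tensor4_appZ scaleN1r. Qed.

Lemma tensor4_app0 T : tensor4_app T 0 = 0.
Proof. by rewrite -(scale0r (0 : Md)) tensor4_appZ !scale0r. Qed.

Lemma tensor4_app_sym T e : minor_symmetric T -> sym_mx (tensor4_app T e).
Proof.
move=> mT; apply/matrixP => i j; rewrite !mxE.
by apply: eq_bigr => k _; apply: eq_bigr => l _; rewrite (mT j i k l).1.
Qed.

Lemma tensor4_app_tr T e : minor_symmetric T -> tensor4_app T e^T = tensor4_app T e.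
Proof.
move=> mT; apply/matrixP => i j; rewrite !mxE exchange_big.
by apply: eq_bigr => k _; apply: eq_bigr => l _; rewrite mxE (mT i j l k).2.
Qed.

Lemma tensor4_app_major T e f : major_symmetric T ->
  ddot (tensor4_app T e) f = ddot e (tensor4_app T f).
Proof.
move=> MT.
have E (a b : Md) : ddot (tensor4_app T a) b =
    \sum_(p : 'I_d * 'I_d) \sum_(q : 'I_d * 'I_d)
      T p.1 p.2 q.1 q.2 * a q.1 q.2 * b p.1 p.2.
  rewrite /ddot pair_bigA; apply: eq_bigr => p _; rewrite mxE pair_bigA mulr_suml.
  exact: eq_bigr.
rewrite [RHS]ddotC !E exchange_big; apply: eq_bigr => p _; apply: eq_bigr => q _.
by rewrite MT mulrAC.
Qed.

Lemma half_double e : 2^-1 *: (e + e) = e.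
Proof. by rewrite -{1 2}(scale1r e) -scalerDl scalerA mulVf ?scale1r// pnatr_eq0. Qed.

Definition symm e : Md := 2^-1 *: (e + e^T).

Lemma symm_sym e : sym_mx (symm e).
Proof. by rewrite /sym_mx /symm linearZ/= [(e + _)^T]linearD/= trmxK addrC. Qed.

Lemma symm_id e : sym_mx e -> symm e = e.
Proof. by rewrite /symm => ->; rewrite half_double. Qed.

Lemma symmD e f : symm (e + f) = symm e + symm f.
Proof. by rewrite /symm [(e + f)^T]linearD/= addrACA scalerDr. Qed.

Lemma symmZ c e : symm (c *: e) = c *: symm e.
Proof. by rewrite /symm [(c *: e)^T]linearZ/= -scalerDr !scalerA mulrC. Qed.

Lemma symm_lin c e f : symm (c *: e + f) = c *: symm e + symm f.
Proof. by rewrite symmD symmZ. Qed.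

Lemma symmB e f : symm (e - f) = symm e - symm f.
Proof. by rewrite symmD -scaleN1r symmZ scaleN1r. Qed.

Lemma tensor4_app_symm T e : minor_symmetric T -> tensor4_app T (symm e) = tensor4_app T e.
Proof.
move=> mT; rewrite /symm tensor4_appZ tensor4_appD tensor4_app_tr//.
exact: half_double.
Qed.

Lemma ddot_symm s e : sym_mx s -> ddot s (symm e) = ddot s e.
Proof.
by move=> ss; rewrite /symm ddotZr ddotDr -ddot_tr ss; lra.
Qed.

Definition inverse_tensor T S := minor_symmetric S /\
  forall e, sym_mx e -> tensor4_app S (tensor4_app T e) = e /\
                        tensor4_app T (tensor4_app S e) = e.

(** [T] on symmetric matrices and the identity on skew-symmetric ones, so that
    the inversion of [T] becomes that of one square matrix. *)
Definition sym_extension T e : Md := symm (tensor4_app T (symm e)) + (e - symm e).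

Lemma sym_extension_linear T : linear (sym_extension T).
Proof.
move=> c e f; rewrite /sym_extension symm_lin tensor4_app_lin symm_lin.
by rewrite opprD [c *: e + f + _]addrACA [LHS]addrACA !scalerDr scalerN.
Qed.

HB.instance Definition _ T := GRing.isLinear.Build R Md Md *:%R (sym_extension T) (sym_extension_linear T).

(** The entries of the inverse of [sym_extension T], symmetrised in both pairs
    of indices. They are rational functions of the entries of [T], whereas the
    inverse tensor itself is given by a choice, which says nothing about
    measurability. *)
Definition explicit_inverse T : tensor4 R d := fun i j k l =>
  symm (vec_mx (mxvec (symm (delta_mx k l)) *m invmx (lin_mx (sym_extension T)))) i j.

Lemma explicit_inverse_app T e : tensor4_app (explicit_inverse T) e =
  symm (vec_mx (mxvec (symm e) *m invmx (lin_mx (sym_extension T)))).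
Proof.
pose F e := symm (vec_mx (mxvec (symm e) *m invmx (lin_mx (sym_extension T)))).
have FD a b : F (a + b) = F a + F b.
  by rewrite /F symmD [mxvec (_ + _)]linearD/= mulmxDl [vec_mx (_ + _)]linearD/= symmD.
have FZ c a : F (c *: a) = c *: F a.
  by rewrite /F symmZ [mxvec (_ *: _)]linearZ/= -scalemxAl [vec_mx (_ *: _)]linearZ/= symmZ.
rewrite -/(F e) [in RHS](matrix_sum_delta e).
have Fsum (I : Type) (r : seq I) (h : I -> Md) : F (\sum_(i <- r) h i) = \sum_(i <- r) F (h i).
  elim: r => [|i r IHr]; last by rewrite !big_cons FD IHr.
  by rewrite !big_nil -[X in F X = _](scale0r (0 : Md)) FZ scale0r.
apply/matrixP => i j; rewrite Fsum summxE mxE; apply: eq_bigr => k _.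
rewrite Fsum summxE; apply: eq_bigr => l _.
by rewrite FZ [RHS]mxE mulrC.
Qed.

(** Extended by the identity on skew-symmetric matrices, [S] becomes an inverse
    of [sym_extension T]. *)
Lemma inverse_tensor_unique T S : inverse_tensor T S -> S = explicit_inverse T.
Proof.
move=> TS; have [mS iS] := TS.
pose G e : Md := tensor4_app S (symm e) + (e - symm e).
have GL : linear G.
  move=> c e f; rewrite /G symm_lin tensor4_app_lin.
  by rewrite opprD [c *: e + f + _]addrACA [LHS]addrACA !scalerDr scalerN.
pose Glin := GRing.isLinear.Build R Md Md *:%R G GL.
pose G' : {linear Md -> Md} := HB.pack G Glin.
have symm_skew e : symm (e - symm e) = 0 by rewrite symmB (symm_id (symm_sym e)) subrr.
have GT e : sym_extension T (G e) = e.
  have E : symm (G e) = tensor4_app S (symm e).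
    by rewrite /G symmD symm_skew addr0 symm_id//; exact: tensor4_app_sym.
  rewrite /sym_extension E (iS _ (symm_sym e)).2 (symm_id (symm_sym e)) /G.
  by rewrite [_ + (e - _)]addrC addrK addrC subrK.
have GTm : lin_mx G' *m lin_mx (sym_extension T) = 1%:M.
  apply/row_matrixP => i; rewrite row_mul.
  rewrite !rowE !mulmx1.
  by rewrite -[delta_mx 0 i]vec_mxK !mul_vec_lin/= -/(G _) GT.
have iE : invmx (lin_mx (sym_extension T)) = lin_mx G'.
  have [u _] := mulmx1_unit GTm; have := mulmx1C GTm => h.
  have [uT _] := mulmx1_unit h.
  by rewrite -[LHS]mul1mx -GTm -mulmxA mulmxV// mulmx1.
apply/funext => i; apply/funext => j; apply/funext => k; apply/funext => l.
rewrite /explicit_inverse iE mul_vec_lin mxvecK /= /G (symm_id (symm_sym _)) subrr addr0.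
rewrite symm_id; last exact: tensor4_app_sym.
rewrite tensor4_app_symm// mxE (bigD1 k)//= (bigD1 l)//= !mxE !eqxx mulr1.
rewrite !big1 ?addr0//.
  by move=> k' /negPf k'k; apply: big1 => l' _; rewrite mxE k'k mulr0.
by move=> l' /negPf l'l; rewrite mxE l'l andbF mulr0.
Qed.

End tensor_algebra.

Section tensor_inverse.
Context {R : realType} {d : nat}.
Local Notation Md := 'M[R]_d.
Implicit Types (s e f : Md) (T S : tensor4 R d).

Lemma tensor4_invE T : tensor4_inv T =
  if `[< inverse_tensor T (explicit_inverse T) >] then explicit_inverse T
  else fun _ _ _ _ => 0.
Proof.
rewrite /tensor4_inv; case: asboolP => h.
  by apply: xget_unique => // S /inverse_tensor_unique.
apply: xgetPN => S /[dup] TS /inverse_tensor_unique ES; apply: h; by rewrite -ES.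
Qed.

Lemma inverse_tensor_exists T : minor_symmetric T -> posdef_tensor4 T ->
  inverse_tensor T (explicit_inverse T).
Proof.
move=> mT pT.
have inj e : sym_mx e -> tensor4_app T e = 0 -> e = 0.
  move=> se Te; apply/eqP; apply: contrapT => /negP e0.
  by have := pT e se e0; rewrite Te -(scale0r (0 : Md)) ddotZl mul0r ltxx.
have ext e : sym_extension T e = 0 -> e = 0.
  rewrite /sym_extension (symm_id (tensor4_app_sym _ mT)) => h.
  have /(congr1 symm) := h.
  rewrite symmD symmB (symm_id (symm_sym e)) subrr addr0 (symm_id (tensor4_app_sym _ mT)).
  rewrite -[in RHS](scale0r (0 : Md)) symmZ scale0r => /(inj _ (symm_sym e)) se.
  by move: h; rewrite se tensor4_app0 add0r subr0.
have u : lin_mx (sym_extension T) \in unitmx.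
  rewrite -row_free_unit -kermx_eq0; apply/rowV0P => v /sub_kermxP.
  rewrite -[v]vec_mxK mul_vec_lin/= => /(congr1 vec_mx); rewrite mxvecK linear0 => /ext ->.
  by rewrite linear0.
pose Psi e := vec_mx (mxvec e *m invmx (lin_mx (sym_extension T))).
have PsiK e : sym_extension T (Psi e) = e.
  apply: (can_inj mxvecK); rewrite -mul_vec_lin vec_mxK mulmxKV//.
have key e : sym_mx e -> tensor4_app T (symm (Psi e)) = e.
  move=> se; have /(congr1 symm) := PsiK e.
  rewrite /sym_extension symmD symmB (symm_id (symm_sym (Psi e))) subrr addr0.
  by rewrite (symm_id (symm_sym _)) (symm_id (tensor4_app_sym _ mT)) (symm_id se).
split.
- move=> i j k l; split.
    rewrite /explicit_inverse; set X := vec_mx _.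
    have E : (symm X)^T j i = symm X j i by rewrite symm_sym.
    by rewrite -E [RHS]mxE.
  by rewrite /explicit_inverse /symm !trmx_delta [delta_mx k l + _]addrC.
move=> e se; rewrite !explicit_inverse_app (symm_id se).
rewrite -/(Psi e) key//; split => //.
rewrite (symm_id (tensor4_app_sym e mT)) -/(Psi _).
apply/eqP; rewrite -subr_eq0; apply/eqP; apply: inj.
  rewrite /sym_mx linearB/= se; congr (_ - _); exact: symm_sym.
rewrite tensor4_appB key ?subrr//; exact: tensor4_app_sym.
Qed.

Lemma tensor4_invP T : minor_symmetric T -> posdef_tensor4 T ->
  inverse_tensor T (tensor4_inv T).
Proof.
move=> mT pT; have h := inverse_tensor_exists mT pT.
by rewrite tensor4_invE; case: asboolP.
Qed.

(** For symmetric arguments this is the major symmetry of [T] read at [S e] and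
    [S f]; the minor symmetries reduce general arguments to symmetric ones. *)
Lemma inverse_tensor_ddot T S e f : major_symmetric T -> inverse_tensor T S ->
  ddot (tensor4_app S e) f = ddot e (tensor4_app S f).
Proof.
move=> MT [mS TS].
have ES := tensor4_app_sym _ mS.
have key a b : sym_mx a -> sym_mx b ->
    ddot (tensor4_app S a) b = ddot a (tensor4_app S b).
  move=> sa sb.
  have h := tensor4_app_major (tensor4_app S a) (tensor4_app S b) MT.
  by move: h; rewrite (TS a sa).2 (TS b sb).2 => <-.
rewrite -(ddot_symm _ (ES e)) -(tensor4_app_symm e)// key//; last 2 first.
- exact: symm_sym.
- exact: symm_sym.
by rewrite (tensor4_app_symm f)// ddotC (ddot_symm _ (ES f)) ddotC.
Qed.

Lemma tensor4_app_delta T i j k l : tensor4_app T (delta_mx k l) i j = T i j k l.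
Proof.
rewrite mxE (bigD1 k)//= (bigD1 l)//= !mxE !eqxx mulr1 !big1 ?addr0//.
  by move=> k' /negPf k'k; apply: big1 => l' _; rewrite mxE k'k mulr0.
by move=> l' /negPf l'l; rewrite mxE l'l andbF mulr0.
Qed.

Lemma ddot_delta e i j : ddot e (delta_mx i j) = e i j.
Proof.
rewrite /ddot (bigD1 i)//= (bigD1 j)//= !mxE !eqxx mulr1 !big1 ?addr0//.
  by move=> k' /negPf k'k; apply: big1 => l' _; rewrite mxE k'k mulr0.
by move=> l' /negPf l'l; rewrite mxE l'l andbF mulr0.
Qed.

Lemma inverse_tensor_major T S : major_symmetric T -> inverse_tensor T S ->
  major_symmetric S.
Proof.
move=> MT TS i j k l.
rewrite -(tensor4_app_delta S i j k l) -(tensor4_app_delta S k l i j).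
by rewrite -!ddot_delta (inverse_tensor_ddot _ _ MT TS) ddotC.
Qed.

(** With [e = S f], coercivity gives [mu |e|^2 <= f : e], and [0 <= |f - mu
    e|^2] does the rest. *)
Lemma inverse_tensor_coercive T S mu f : 0 < mu ->
  (forall e, sym_mx e -> mu * ddot e e <= ddot (tensor4_app T e) e) ->
  inverse_tensor T S -> sym_mx f ->
  ddot (tensor4_app S f) (tensor4_app S f) <= mu ^- 2 * ddot f f.
Proof.
move=> mu0 cT [mS TS] sf; set e := tensor4_app S f.
have := cT e (tensor4_app_sym f mS); rewrite (TS f sf).2.
have := ddot_sqr_ge0 (f - mu *: e).
rewrite -scaleNr !(ddotDl, ddotDr, ddotZl, ddotZr) (ddotC e f) => h1 h2.
rewrite ler_pdivlMl ?exprn_gt0//; nra.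
Qed.

Lemma inverse_tensor_bounded T S mu i j k l : 0 < mu ->
  (forall e, sym_mx e -> mu * ddot e e <= ddot (tensor4_app T e) e) ->
  inverse_tensor T S ->
  `|S i j k l| <= mu ^- 2 * ddot (symm (delta_mx k l)) (symm (delta_mx k l) : Md) + 1.
Proof.
move=> mu0 cT TS.
have h := inverse_tensor_coercive mu0 cT TS (symm_sym (delta_mx k l)).
have := le_trans (ddot_entry _ i j) h.
rewrite tensor4_app_symm; last by case: TS.
rewrite tensor4_app_delta -(real_normK (num_real (S i j k l))).
(* [x <= x^2 + 1] *)
set x := `|_|; set C := _ * _ => xC; have := sqr_ge0 (x - 1); rewrite !expr2 in xC *; nra.
Qed.

Lemma coercive_posdef T mu : 0 < mu ->
  (forall e, sym_mx e -> mu * ddot e e <= ddot (tensor4_app T e) e) -> posdef_tensor4 T.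
Proof.
move=> mu0 cT e se e0; apply: lt_le_trans (cT e se); rewrite mulr_gt0//.
rewrite lt_neqAle ddot_sqr_ge0 andbT eq_sym; apply: contra_neq e0; exact: ddot_sqr_eq0.
Qed.

End tensor_inverse.

(** * Measurability of the inverse tensor *)

Section measurable_inverse.
Context {R : realType} {d : nat} {disp : measure_display} {X : measurableType disp}.
Local Notation Md := 'M[R]_d.

Definition measurable_mx m n (M : X -> 'M[R]_(m, n)) :=
  forall i j, measurable_fun setT (fun x => M x i j).

Definition measurable_tensor (T : X -> tensor4 R d) :=
  forall i j k l, measurable_fun setT (fun x => T x i j k l).

Lemma measurable_inv_fun (f : X -> R) : measurable_fun setT f ->
  measurable_fun setT (fun x => (f x)^-1).
Proof.
move=> mf; apply: (measurableT_comp (f := fun y : R => y^-1)) mf.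
rewrite -(setUv [set (0 : R)]); apply/measurable_funU => //; first exact: measurableC.
split.
  exact: measurable_fun_set1.
apply: open_continuous_measurable_fun; first exact: closed_openC.
by move=> y; rewrite inE /= => /eqP y0; exact: inv_continuous.
Qed.

Lemma measurable_mulmx m n p (M : X -> 'M[R]_(m, n)) (N : X -> 'M[R]_(n, p)) :
  measurable_mx M -> measurable_mx N -> measurable_mx (fun x => M x *m N x).
Proof.
move=> mM mN i j; under eq_fun do rewrite mxE.
by apply: measurable_sum => k; exact: measurable_funM.
Qed.

Lemma measurable_det n (M : X -> 'M[R]_n) : measurable_mx M ->
  measurable_fun setT (fun x => \det (M x)).
Proof.
move=> mM; rewrite /determinant; apply: measurable_sum => s.
apply: measurable_funM; first exact: measurable_cst.
by apply: measurable_prod => i _; exact: mM.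
Qed.

Lemma measurable_invmx n (M : X -> 'M[R]_n) : measurable_mx M ->
  measurable_mx (fun x => invmx (M x)).
Proof.
move=> mM i j; rewrite /invmx.
rewrite (_ : (fun x => _) = fun x => if \det (M x) == 0 then M x i j
    else (\det (M x))^-1 * cofactor (M x) j i); last first.
  by apply/funext => x; rewrite unitmxE unitfE; case: eqP => //= _; rewrite !mxE.
apply: measurable_fun_ifT.
- by apply: measurable_fun_eqr => //; exact: measurable_det.
- exact: mM.
apply: measurable_funM; first exact/measurable_inv_fun/measurable_det.
rewrite /cofactor; apply: measurable_funM; first exact: measurable_cst.
by apply: measurable_det => k l; under eq_fun do rewrite !mxE; exact: mM.
Qed.

Lemma measurable_symm (M : X -> Md) : measurable_mx M ->
  measurable_mx (fun x => symm (M x)).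
Proof.
move=> mM i j; under eq_fun do rewrite !mxE.
by apply: measurable_funM => //; apply: measurable_funD.
Qed.

Lemma measurable_tensor4_app (T : X -> tensor4 R d) (M : X -> Md) :
  measurable_tensor T -> measurable_mx M -> measurable_mx (fun x => tensor4_app (T x) (M x)).
Proof.
move=> mT mM i j; under eq_fun do rewrite mxE.
apply: measurable_sum => k; apply: measurable_sum => l.
by apply: measurable_funM; [exact: mT|exact: mM].
Qed.

Lemma measurable_explicit_inverse (T : X -> tensor4 R d) :
  measurable_tensor T -> measurable_tensor (fun x => explicit_inverse (T x)).
Proof.
move=> mT i j k l; rewrite /explicit_inverse.
apply: measurable_symm => {i j} i j; under eq_fun do rewrite mxE.
apply: measurable_mulmx; first by move=> p q; exact: measurable_cst.
apply: measurable_invmx => p q.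
under eq_fun do rewrite mxE.
case: (mxvec_indexP q) => {q} q1 q2; under eq_fun do rewrite mxvecE.
under eq_fun do rewrite /= mxE.
apply: measurable_funD; last exact: measurable_cst.
apply: measurable_symm; apply: measurable_tensor4_app => // r s; exact: measurable_cst.
Qed.

Lemma measurable_forall_eq (I : finType) (f g : I -> X -> R) :
  (forall i, measurable_fun setT (f i)) -> (forall i, measurable_fun setT (g i)) ->
  measurable [set x | forall i, f i x = g i x].
Proof.
move=> mf mg.
rewrite (_ : [set x | _] = \bigcap_(i in [set: I]) [set x | f i x == g i x]); last first.
  by apply/seteqP; split => [x h i _|x h i]; [exact/eqP|exact/eqP/(h i)].
apply: fin_bigcap_measurable; first exact: finite_finset.
move=> i _; have mt : measurable [set true] by [].
have := measurable_fun_eqr (mf i) (mg i) measurableT mt.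
by rewrite setTI.
Qed.

(** By linearity it is enough to test the symmetrised basis matrices. The set of
    tensors with a given inverse is then cut out by finitely many equations. *)
Lemma inverse_tensor_basis (T S : tensor4 R d) : inverse_tensor T S <->
  [/\ forall p : 'I_d * 'I_d * ('I_d * 'I_d), S p.1.1 p.1.2 p.2.1 p.2.2 = S p.1.2 p.1.1 p.2.1 p.2.2,
    forall p : 'I_d * 'I_d * ('I_d * 'I_d), S p.1.1 p.1.2 p.2.1 p.2.2 = S p.1.1 p.1.2 p.2.2 p.2.1,
    forall p : 'I_d * 'I_d * ('I_d * 'I_d),
      tensor4_app S (tensor4_app T (symm (delta_mx p.1.1 p.1.2))) p.2.1 p.2.2 =
      symm (delta_mx p.1.1 p.1.2) p.2.1 p.2.2 &
    forall p : 'I_d * 'I_d * ('I_d * 'I_d),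
      tensor4_app T (tensor4_app S (symm (delta_mx p.1.1 p.1.2))) p.2.1 p.2.2 =
      symm (delta_mx p.1.1 p.1.2) p.2.1 p.2.2].
Proof.
split=> [[mS TS]|[h1 h2 h3 h4]].
  split=> p; [exact: (mS _ _ _ _).1|exact: (mS _ _ _ _).2| |].
    by rewrite (TS _ (symm_sym _)).1.
  by rewrite (TS _ (symm_sym _)).2.
split; first by move=> i j k l; split; [exact: (h1 (i, j, (k, l)))|exact: (h2 (i, j, (k, l)))].
have gen (F : Md -> Md) : (forall c a b, F (c *: a + b) = c *: F a + F b) ->
    (forall k l, F (symm (delta_mx k l)) = symm (delta_mx k l)) ->
    forall e, sym_mx e -> F e = e.
  move=> FL Fd e se.
  have F0 : F 0 = 0.
    have := FL 1 0 0; rewrite !scale1r addr0 => /eqP.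
    by rewrite -subr_eq0 opprD addrA subrr sub0r oppr_eq0 => /eqP.
  have Fs (I : Type) (r : seq I) (c : I -> R) (h : I -> Md) :
      F (\sum_(i <- r) c i *: h i) = \sum_(i <- r) c i *: F (h i).
    by elim: r => [|i r IHr]; rewrite ?big_nil// !big_cons FL IHr.
  have ss (I : Type) (r : seq I) (c : I -> R) (h : I -> Md) :
      symm (\sum_(i <- r) c i *: h i) = \sum_(i <- r) c i *: symm (h i).
    elim: r => [|i r IHr]; rewrite ?big_nil// ?big_cons.
      by rewrite -[X in symm X = _](scale0r (0 : Md)) symmZ scale0r.
    by rewrite symm_lin IHr.
  rewrite -(symm_id se) (matrix_sum_delta e) pair_bigA/= ss Fs.
  by apply: eq_bigr => p _; rewrite Fd.
move=> e se; split.
  apply: (gen (fun e => tensor4_app S (tensor4_app T e))) se.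
    by move=> c a b; rewrite !tensor4_app_lin.
  by move=> k l; apply/matrixP => i j; exact: (h3 (k, l, (i, j))).
apply: (gen (fun e => tensor4_app T (tensor4_app S e))) se.
  by move=> c a b; rewrite !tensor4_app_lin.
by move=> k l; apply/matrixP => i j; exact: (h4 (k, l, (i, j))).
Qed.

(** The inverse is a rational function of the entries where it exists, and the
    set where it exists is given by finitely many equations between such
    functions. *)
Lemma measurable_tensor4_inv (T : X -> tensor4 R d) :
  measurable_tensor T -> measurable_tensor (fun x => tensor4_inv (T x)).
Proof.
move=> mT; have mC := measurable_explicit_inverse mT.
have mc (M : Md) : measurable_mx (fun _ : X => M) by move=> i j; exact: measurable_cst.
pose G := [set x | inverse_tensor (T x) (explicit_inverse (T x))].
have mG : measurable G.
  rewrite (_ : G = [set x | forall p : 'I_d * 'I_d * ('I_d * 'I_d),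
       explicit_inverse (T x) p.1.1 p.1.2 p.2.1 p.2.2 = explicit_inverse (T x) p.1.2 p.1.1 p.2.1 p.2.2] `&`
    [set x | forall p : 'I_d * 'I_d * ('I_d * 'I_d),
       explicit_inverse (T x) p.1.1 p.1.2 p.2.1 p.2.2 = explicit_inverse (T x) p.1.1 p.1.2 p.2.2 p.2.1] `&`
    [set x | forall p : 'I_d * 'I_d * ('I_d * 'I_d),
      tensor4_app (explicit_inverse (T x)) (tensor4_app (T x) (symm (delta_mx p.1.1 p.1.2))) p.2.1 p.2.2 =
      symm (delta_mx p.1.1 p.1.2) p.2.1 p.2.2] `&`
    [set x | forall p : 'I_d * 'I_d * ('I_d * 'I_d),
      tensor4_app (T x) (tensor4_app (explicit_inverse (T x)) (symm (delta_mx p.1.1 p.1.2))) p.2.1 p.2.2 =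
      symm (delta_mx p.1.1 p.1.2) p.2.1 p.2.2]).
    apply: measurableI; first apply: measurableI; first apply: measurableI;
      apply: measurable_forall_eq => p; rewrite /=; try exact: mC; try exact: measurable_cst.
      by do 2 apply: measurable_tensor4_app => //.
    by do 2 apply: measurable_tensor4_app => //.
  apply/seteqP; split => x /=.
    by move=> /inverse_tensor_basis[].
  by move=> [[[]]] *; apply/inverse_tensor_basis.
move=> i j k l.
rewrite (_ : (fun x => _) = (fun x => explicit_inverse (T x) i j k l) \_ G).
  apply/(measurable_restrictT _ mG).1; exact: measurable_funTS.
apply/funext => x; rewrite patchE tensor4_invE.
by case: asboolP => h; [rewrite mem_set|rewrite memNset].
Qed.

End measurable_inverse.

(** * Periodic tensor fields and their pairing *)

Section fields.
Context {R : realType} {d : nat}.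
Local Notation Rd := 'rV[R]_d.
Local Notation Md := 'M[R]_d.
Local Notation leb := (lebesgue_rV d : {measure set Rd -> \bar R}).
Variable B : Md.
Hypothesis hB : B \in unitmx.
Implicit Types (f g eta tau : tensor_field R d) (T : Rd -> tensor4 R d).

Definition pairing (V : set Rd) f g : R := cell_mean V (fun x => ddot (f x) (g x)).

Lemma L2per_symD f g : L2per_sym B f -> L2per_sym B g -> L2per_sym B (f + g).
Proof.
move=> [f2 sf pf] [g2 sg pg]; split.
- move=> i j; rewrite (_ : (fun x => _) = fun x => f x i j + g x i j); first exact: L2locD.
  by apply/funext => x; rewrite mxE.
- by apply: filterS2 sf sg => x fx gx; rewrite /sym_mx [(_ + _)^T]linearD/= fx gx.
- exact: (lattice_periodic2 (fun a b : Md => a + b)).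
Qed.

Lemma L2per_symZ c f : L2per_sym B f -> L2per_sym B (c *: f).
Proof.
move=> [f2 sf pf]; split.
- move=> i j; rewrite (_ : (fun x => _) = fun x => c * f x i j); first exact: L2locZ.
  by apply/funext => x; rewrite mxE.
- by apply: filterS sf => x fx; rewrite /sym_mx [(_ *: _)^T]linearZ/= fx.
- exact: (lattice_periodic1 (fun a : Md => c *: a)).
Qed.

Lemma L2per_symB f g : L2per_sym B f -> L2per_sym B g -> L2per_sym B (f - g).
Proof.
by move=> hf hg; rewrite -scaleN1r; apply: L2per_symD => //; exact: L2per_symZ.
Qed.

Lemma L2per_sym_cst (c : Md) : sym_mx c -> L2per_sym B (cst c).
Proof.
move=> sc; split; first by move=> i j; exact: L2loc_cst.
  exact: aeW.
by move=> r _; exact: aeW.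
Qed.

Lemma L2per_sym_entry f i j : L2per_sym B f -> L2periodic B (fun x => f x i j).
Proof.
by move=> [f2 _ pf]; split; [exact: f2|exact: (lattice_periodic1 (fun a : Md => a i j))].
Qed.

(** What the stiffness, its inverse and the uniform reference tensors have in
    common: their pointwise action preserves the space of fields and is
    self-adjoint for the pairing. *)
Record bounded_tensor_field T : Prop := {
  btf_measurable : measurable_tensor T;
  btf_bounded : forall i j k l, exists M, \forall x \ae leb, `|T x i j k l| <= M;
  btf_periodic : lattice_periodic B T;
  btf_sym : \forall x \ae leb, minor_symmetric (T x) /\ major_symmetric (T x) }.

Lemma L2loc_bounded_mul (a f : Rd -> R) M : measurable_fun setT a ->
  (\forall x \ae leb, `|a x| <= M) -> L2loc f -> L2loc (fun x => a x * f x).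
Proof.
move=> ma aM f2; apply: (@L2loc_dominated _ _ _ f (M ^+ 2)) => //.
  by apply: measurable_funM => //; exact: L2loc_measurable.
apply: filterS aM => x aM; rewrite exprMn ler_wpM2r ?sqr_ge0//.
by rewrite -(real_normK (num_real (a x))) lerXn2r ?nnegrE// (le_trans _ aM).
Qed.

Lemma L2per_sym_tensor T f : bounded_tensor_field T -> L2per_sym B f ->
  L2per_sym B (tensor4_fapp T f).
Proof.
move=> bT [f2 sf pf]; split.
- move=> i j; rewrite (_ : (fun x => _) = fun x => \sum_k \sum_l T x i j k l * f x k l).
    apply: L2loc_sum => k; apply: L2loc_sum => l.
    have [M TM] := btf_bounded bT i j k l.
    by apply: (L2loc_bounded_mul _ TM) => //; exact: btf_measurable.
  by apply/funext => x; rewrite mxE.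
- by apply: filterS (btf_sym bT) => x [mT _]; exact: tensor4_app_sym.
- exact: (lattice_periodic2 (@tensor4_app R d) (btf_periodic bT) pf).
Qed.

Lemma bounded_tensor_field_cst (S : tensor4 R d) : minor_symmetric S ->
  major_symmetric S -> bounded_tensor_field (fun=> S).
Proof.
move=> mS MS; split.
- by move=> i j k l; exact: measurable_cst.
- by move=> i j k l; exists `|S i j k l|; exact: aeW.
- by move=> r _; exact: aeW.
- exact: aeW.
Qed.

Section cell.
Variable V : set Rd.
Hypothesis cV : unit_cell B V.

Lemma integrable_ddot f g : L2per_sym B f -> L2per_sym B g ->
  leb.-integrable V (fun x => (ddot (f x) (g x))%:E).
Proof.
move=> hf hg; have mV : measurable V by case: cV.
rewrite (_ : (fun x => _) = fun x => (\sum_i \sum_j (f x i j * g x i j)%:E)%E); last first.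
  by apply/funext => x; rewrite /ddot -sumEFin; apply: eq_bigr => i _; rewrite -sumEFin.
apply: integrable_sum => // i _; apply: integrable_sum => // j _.
by apply: (integrableM_unit_cell hB cV); exact: L2per_sym_entry.
Qed.

Lemma pairingDl f f' g : L2per_sym B f -> L2per_sym B f' -> L2per_sym B g ->
  pairing V (f + f') g = pairing V f g + pairing V f' g.
Proof.
move=> hf hf' hg; have mV : measurable V by case: cV.
rewrite /pairing /cell_mean -mulrDr -RintegralD//; try exact: integrable_ddot.
by congr (_ * _); apply: eq_Rintegral => x _; exact: ddotDl.
Qed.

Lemma pairingZl c f g : L2per_sym B f -> L2per_sym B g ->
  pairing V (c *: f) g = c * pairing V f g.
Proof.
move=> hf hg; have mV : measurable V by case: cV.
rewrite /pairing /cell_mean mulrCA -[c * _]RintegralZl//; last exact: integrable_ddot.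
by congr (_ * _); apply: eq_Rintegral => x _; exact: ddotZl.
Qed.

Lemma pairingC f g : pairing V f g = pairing V g f.
Proof. by congr (_ * _); apply: eq_Rintegral => x _; exact: ddotC. Qed.

Lemma pairingBl f f' g : L2per_sym B f -> L2per_sym B f' -> L2per_sym B g ->
  pairing V (f - f') g = pairing V f g - pairing V f' g.
Proof.
move=> hf hf' hg; rewrite -scaleN1r pairingDl ?pairingZl ?mulN1r//.
exact: L2per_symZ.
Qed.

Lemma cell_mean_ae (a b : Rd -> R) : measurable_fun setT a -> measurable_fun setT b ->
  (\forall x \ae leb, a x = b x) -> cell_mean V a = cell_mean V b.
Proof.
move=> ma mb ab; have mV : measurable V by case: cV.
congr (_ * fine _); apply: ae_eq_integral => //.
- by apply/measurable_EFinP; exact: measurable_funTS.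
- by apply/measurable_EFinP; exact: measurable_funTS.
by apply: filterS ab => x -> _.
Qed.

Lemma measurable_ddot f g : L2per_sym B f -> L2per_sym B g ->
  measurable_fun setT (fun x => ddot (f x) (g x)).
Proof.
move=> [f2 _ _] [g2 _ _]; apply: measurable_sum => i; apply: measurable_sum => j.
by apply: measurable_funM; exact: L2loc_measurable.
Qed.

Lemma pairing_ae f f' g g' : L2per_sym B f -> L2per_sym B f' -> L2per_sym B g -> L2per_sym B g' ->
  (\forall x \ae leb, f x = f' x) -> (\forall x \ae leb, g x = g' x) ->
  pairing V f g = pairing V f' g'.
Proof.
move=> hf hf' hg hg' ff gg; apply: cell_mean_ae; try exact: measurable_ddot.
by apply: filterS2 ff gg => x -> ->.
Qed.

Lemma cell_mean_ge0 (a : Rd -> R) : measurable_fun setT a ->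
  (\forall x \ae leb, 0 <= a x) -> 0 <= cell_mean V a.
Proof.
move=> ma a0; rewrite (@cell_mean_ae a (fun x => Num.max (a x) 0))//.
- apply: mulr_ge0; first by rewrite invr_ge0 fine_ge0.
  by apply: Rintegral_ge0 => x _; rewrite le_max lexx orbT.
- exact: measurable_maxr.
- by apply: filterS a0 => x ax; rewrite max_l.
Qed.

Lemma pairing_tensor T f g : bounded_tensor_field T -> L2per_sym B f -> L2per_sym B g ->
  pairing V (tensor4_fapp T f) g = pairing V f (tensor4_fapp T g).
Proof.
move=> bT hf hg; apply: cell_mean_ae.
- by apply: measurable_ddot => //; exact: L2per_sym_tensor.
- by apply: measurable_ddot => //; exact: L2per_sym_tensor.
- by apply: filterS (btf_sym bT) => x [_ MT]; exact: tensor4_app_major.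
Qed.

Lemma ddot_cell_mean f (c : Md) : L2per_sym B f -> sym_mx c ->
  ddot (cell_mean_mx V f) c = pairing V f (cst c).
Proof.
move=> hf sc; have mV : measurable V by case: cV.
have hc := L2per_sym_cst sc.
have ie i j : leb.-integrable V (fun x => (f x i j * c i j)%:E).
  exact: (integrableM_unit_cell hB cV (L2per_sym_entry i j hf) (L2per_sym_entry i j hc)).
have if_ i j : leb.-integrable V (fun x => (f x i j)%:E).
  exact: (L2periodic_integrable hB cV (L2per_sym_entry i j hf)).
rewrite /pairing /cell_mean /ddot.
rewrite (Rintegral_sum _ mV); last first.
  by move=> i; under eq_fun do rewrite -sumEFin; exact: integrable_sum.
rewrite mulr_sumr; apply: eq_bigr => i _; rewrite (Rintegral_sum _ mV)// mulr_sumr.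
apply: eq_bigr => j _; rewrite mxE /cell_mean -mulrA; congr (_ * _).
by symmetry; rewrite RintegralZr//; exact: if_.
Qed.

End cell.
End fields.

(** * Strains built from test functions *)

Section periodization.
Context {R : realType} {d : nat}.
Local Notation Rd := 'rV[R]_d.
Local Notation Zd := 'rV[int]_d.
Local Notation Md := 'M[R]_d.
Local Notation leb := (lebesgue_rV d : {measure set Rd -> \bar R}).
Variable B : Md.
Hypothesis hB : B \in unitmx.

Lemma finite_bounded_int (K : nat) :
  finite_set [set z : Zd | forall i, (`|z ord0 i| <= K%:Z)%R].
Proof.
pose h (k : {ffun 'I_d -> 'I_(K.*2.+1)}) : Zd := \row_i ((k i : nat)%:Z - K%:Z).
apply: (@sub_finite_set _ _ (h @` setT)); last first.
  by apply: finite_image; exact: finite_finset.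
move=> z zK; exists [ffun i => inord (absz (z ord0 i + K%:Z))] => //.
apply/rowP => i; rewrite !mxE ffunE.
have := zK i; rewrite ler_norml -[z 0 i]/(z ord0 i); move: (z ord0 i) => a /andP[a1 a2].
by rewrite inordK; lia.
Qed.

(** The coordinates of such a lattice vector in the basis [B] are integers with
    an explicit bound. *)
Lemma lattice_near_finite (M N : R) : exists A : {fset Zd},
  forall x z, cbox N x -> cbox M (x + lattice_point B z) -> z \in A.
Proof.
pose C : R := \sum_i \sum_j (`|M| + `|N|) * `|invmx B j i|.
pose K := Num.bound C.
exists (fset_set [set z : Zd | forall i, (`|z ord0 i| <= K%:Z)%R]).
move=> x z Nx Mxz; rewrite in_fset_set; last exact: finite_bounded_int.
apply: mem_set => i.
have C0 : 0 <= C by do 2 (apply: sumr_ge0 => ? _); rewrite mulr_ge0// addr_ge0.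
have : `|(z ord0 i)%:~R| <= C :> R.
  rewrite -(lattice_point_coord hB z i) -[lattice_point B z](addKr x) addrC mxE.
  apply: le_trans (ler_norm_sum _ _ _) _.
  apply: (@le_trans _ _ (\sum_j (`|M| + `|N|) * `|invmx B j i|)).
    apply: ler_sum => j _; rewrite normrM ler_wpM2r// !mxE.
    apply: le_trans (ler_normB _ _) _.
    have := Nx j; have := Mxz j; rewrite /= !in_itv/= -!ler_norml !mxE => h1 h2.
    by apply: lerD; rewrite (le_trans _ (ler_norm _)).
  rewrite /C [leRHS](bigD1 i)//= lerDl; apply: sumr_ge0 => ? _; apply: sumr_ge0 => ? _.
  by rewrite mulr_ge0// addr_ge0.
move=> h; have := le_lt_trans h (archi_boundP C0).
rewrite -/K -intr_norm -[K%:R]/(K%:Z%:~R) ltr_int; exact: ltW.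
Qed.

Definition periodize (phi : Rd -> R) (x : Rd) : R :=
  \sum_(z \in [set: Zd]) phi (x + lattice_point B z).

Lemma periodize_finite (phi : Rd -> R) (A : {fset Zd}) x :
  (forall z, phi (x + lattice_point B z) != 0 -> z \in A) ->
  periodize phi x = \sum_(z <- A) phi (x + lattice_point B z).
Proof.
move=> phiA; rewrite /periodize (fsbigTE A)// => z zA.
by apply/eqP; apply: contraNT zA; exact: phiA.
Qed.

Lemma periodize_periodic (phi : Rd -> R) : everywhere_periodic B (periodize phi).
Proof.
move=> w x; rewrite /periodize [RHS](reindex_fsbigT (fun z => z + w)); last first.
  by exists (fun z => z - w) => z; rewrite ?addrK ?subrK.
by under [RHS]eq_fsbigr do rewrite lattice_pointD addrA addrAC.
Qed.

Lemma is_derive_translate (f : Rd -> R) (r x v : Rd) : derivable f (x + r) v ->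
  is_derive x v (fun y => f (y + r)) ('D_v f (x + r)).
Proof.
have E : (fun h : R => h^-1 *: (((fun y => f (y + r)) \o shift x) (h *: v) - f (x + r)))
   = (fun h : R => h^-1 *: ((f \o shift (x + r)) (h *: v) - f (x + r))).
  by apply/funext => h /=; rewrite addrA.
by move=> df; split; [rewrite /derivable E|rewrite /derive E].
Qed.

Lemma C1_translate (f : Rd -> R) r : C1 f -> C1 (fun x => f (x + r)).
Proof.
move=> [cf df].
have ct (g : Rd -> R) : continuous g -> continuous (fun x : Rd => g (x + r)).
  move=> cg x; apply: (@continuous_comp Rd Rd R (fun y => y + r) g); last exact: cg.
  by apply: (@continuousD R Rd Rd id (cst r)); [by move=> z|exact: cst_continuous].
split; first exact: ct.
move=> i; split.
  by move=> x; have h := is_derive_translate ((df i).1 (x + r)); exact: ex_derive.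
rewrite (_ : pderiv i _ = fun x => pderiv i f (x + r)); first exact/ct/(df i).2.
by apply/funext => x; have h := is_derive_translate ((df i).1 (x + r)); exact: derive_val.
Qed.

Lemma pderiv_translate i (f : Rd -> R) r x : C1 f ->
  pderiv i (fun x => f (x + r)) x = pderiv i f (x + r).
Proof.
by move=> [_ df]; have h := is_derive_translate ((df i).1 (x + r)); exact: derive_val.
Qed.

(** Near a point one finite set of lattice vectors serves for the function and
    for its derivatives, so that the periodised function inherits their
    regularity. *)
Lemma periodize_local (phi : Rd -> R) (x : Rd) : test_function phi ->
  exists A : {fset Zd}, forall y, ball x 1 y ->
    periodize phi y = \sum_(z <- A) phi (y + lattice_point B z) /\
    forall i, periodize (pderiv i phi) y = \sum_(z <- A) pderiv i phi (y + lattice_point B z).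
Proof.
move=> tphi; have [M [M0 phi0 dphi0 _]] := test_function_bounded tphi.
have [N [N0 xN]] := cbox_ball x.
have [A hA] := lattice_near_finite M N.
exists A => y /xN Ny; split.
  apply: periodize_finite => z /eqP hz; apply: hA Ny _; apply: contrapT => /phi0; exact.
move=> i; apply: periodize_finite => z /eqP hz; apply: hA Ny _; apply: contrapT => nh; apply: hz; exact: dphi0.
Qed.

Lemma near_ball (x : Rd) (P : Rd -> Prop) : (forall y, ball x 1 y -> P y) ->
  \forall y \near x, P y.
Proof. by move=> h; apply/nbhs_ballP; exists 1 => //=. Qed.

Lemma continuous_periodize (phi : Rd -> R) : test_function phi -> continuous (periodize phi).
Proof.
move=> tphi x; have [A hA] := periodize_local x tphi.
have C : continuous (fun y : Rd => \sum_(z <- A) phi (y + lattice_point B z)).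
  by apply: continuous_sum_fun => z; exact: (C1_translate _ (smooth_C1 tphi.1)).1.
have hn : \forall y \near x, (\sum_(z <- A) phi (y + lattice_point B z)) = periodize phi y.
  by apply: near_ball => y /hA[->].
rewrite /continuous_at (hA x (ballxx x ltr01)).1.
exact: (cvg_trans (near_eq_cvg hn) (C x)).
Qed.

Lemma is_derive_periodize (phi : Rd -> R) i x : test_function phi ->
  is_derive x (basis_vec i) (periodize phi) (periodize (pderiv i phi) x).
Proof.
move=> tphi; have [A hA] := periodize_local x tphi.
have CF z : C1 (fun y => phi (y + lattice_point B z)).
  exact: C1_translate (smooth_C1 tphi.1).
have hn : \forall y \near x, (\sum_(z <- A) phi (y + lattice_point B z)) = periodize phi y.
  by apply: near_ball => y /hA[->].
apply: (near_eq_is_derive hn).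
have CS := C1_sum (A : seq Zd) CF.
split; first exact: (CS.2 i).1.
rewrite -/(pderiv i (fun y => \sum_(z <- A) phi (y + lattice_point B z)) x).
rewrite pderiv_sum// (hA x (ballxx x ltr01)).2; apply: eq_bigr => z _.
by rewrite pderiv_translate//; exact: smooth_C1 tphi.1.
Qed.

Lemma C1_periodize (phi : Rd -> R) : test_function phi -> C1 (periodize phi).
Proof.
move=> tphi; split; first exact: continuous_periodize.
move=> i; split.
  by move=> x; have h := is_derive_periodize i x tphi; exact: ex_derive.
rewrite (_ : pderiv i _ = periodize (pderiv i phi)).
  by apply: continuous_periodize; exact: test_function_pderiv.
by apply/funext => x; have h := is_derive_periodize i x tphi; exact: derive_val.
Qed.

Lemma pderiv_periodize (phi : Rd -> R) i : test_function phi ->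
  pderiv i (periodize phi) = periodize (pderiv i phi).
Proof.
by move=> tphi; apply/funext => x; have h := is_derive_periodize i x tphi; exact: derive_val.
Qed.

End periodization.

Section smooth_strains.
Context {R : realType} {d : nat}.
Local Notation Rd := 'rV[R]_d.
Local Notation Zd := 'rV[int]_d.
Local Notation Md := 'M[R]_d.
Local Notation leb := (lebesgue_rV d : {measure set Rd -> \bar R}).
Variable B : Md.
Hypothesis hB : B \in unitmx.

Definition grad_mx (w : Rd -> Rd) (x : Rd) : Md :=
  \matrix_(j, i) pderiv i (fun y => w y ord0 j) x.

Lemma strain_fluct_C1 (w : Rd -> Rd) : (forall j, C1 (fun x => w x ord0 j)) ->
  (forall j, everywhere_periodic B (fun x => w x ord0 j)) ->
  strain_fluct B (fun x => symm (grad_mx w x)).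
Proof.
move=> Cw pw.
have G2 j i : L2loc (fun x => grad_mx w x j i).
  rewrite (_ : (fun x => _) = pderiv i (fun y => w y ord0 j)).
    exact: continuous_L2loc ((Cw j).2 i).2.
  by apply/funext => x; rewrite mxE.
have weak j i : weak_pderiv i (fun x => w x ord0 j) (fun x => grad_mx w x j i).
  rewrite (_ : (fun x => grad_mx w x j i) = pderiv i (fun y => w y ord0 j)).
    exact: weak_pderiv_C1.
  by apply/funext => x; rewrite mxE.
split.
  split.
  - move=> i j; rewrite (_ : (fun x => _) = fun x => 2^-1 * (grad_mx w x i j + grad_mx w x j i)).
      by apply: L2locZ; exact: L2locD.
    by apply/funext => x; rewrite !mxE.
  - by apply: aeW => x; exact: symm_sym.
  - move=> r [z ->]; apply: aeW => x; congr symm; apply/matrixP => i j; rewrite !mxE.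
    exact: (everywhere_periodic_pderiv j (pw i)).
exists w; split.
  move=> j; split; last exact: everywhere_lattice_periodic.
  split; first exact: continuous_L2loc (Cw j).1.
  by move=> i; exists (fun x => grad_mx w x j i).
exists (grad_mx w); first by move=> j i; split.
exact: aeW.
Qed.

(** The space is the disjoint union of the translates of the parallelepiped, and
    only finitely many of them meet the support. *)
Lemma Rintegral_unfold (h : Rd -> R) (A : {fset Zd}) :
  leb.-integrable setT (fun x => (h x)%:E) ->
  (forall x z, parallelepiped B x -> h (x + lattice_point B z) != 0 -> z \in A) ->
  \int[leb]_x h x = \sum_(z <- A) \int[leb]_(x in parallelepiped B) h (x + lattice_point B z).
Proof.
move=> ih hA; have [mP _ _] := unit_cell_parallelepiped hB.
have mh : measurable_fun setT h by apply/measurable_EFinP; exact: measurable_int ih.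
have m1 (z : Zd) : measurable_fun setT (fun x : Rd => \1_(parallelepiped B) (x - lattice_point B z) : R).
  apply: (@measurableT_comp _ _ _ _ _ _ (\1_(parallelepiped B) : Rd -> R)) (measurable_translation _).
  exact: measurable_indic.
have mhz (z : Zd) : measurable_fun setT (fun x : Rd => \1_(parallelepiped B) (x - lattice_point B z) * h x).
  by apply: measurable_funM => //; exact: m1.
transitivity (\int[leb]_x \sum_(z <- A) \1_(parallelepiped B) (x - lattice_point B z) * h x).
  apply: eq_Rintegral => x _; have [z0 Pz0] := parallelepiped_cover hB x.
  have [hx|hx] := eqVneq (h x) 0.
    by rewrite hx big1// => z _; rewrite mulr0.
  have z0A : z0 \in A by apply: (hA (x - lattice_point B z0)) => //; rewrite subrK.
  rewrite (big_fsetD1 z0)//= indicE mem_set// mul1r big1_fset ?addr0// => z.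
  rewrite in_fsetD1 => /andP[zz0 _] _; rewrite indicE memNset ?mul0r// => Pz.
  by move: zz0; rewrite (parallelepiped_unique hB Pz Pz0) eqxx.
rewrite Rintegral_sum//; last first.
  move=> z; apply: (le_integrable measurableT _ _ ih); first exact/measurable_EFinP.
  move=> x _ /=; rewrite lee_fin normrM ler_piMl// indicE ger0_norm//.
  by case: (_ \in _).
apply: eq_bigr => z _; rewrite -(Rintegral_translation (lattice_point B z) (mhz z)).
rewrite [RHS]Rintegral_mkcond; apply: eq_Rintegral => x _.
rewrite addrK patchE indicE; case: ifPn => _; by rewrite ?mul1r ?mul0r.
Qed.

(** Periodise [phi] and take the symmetrised gradient of the displacement along
    the [i]-th axis with this amplitude. Unfolding its pairing with a periodic
    field gives back an integral over the whole space, so that the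
    distributional divergence is seen by periodic strains. *)
Lemma test_strain V (i : 'I_d) (phi : Rd -> R) : unit_cell B V -> test_function phi ->
  exists2 k, strain_fluct B k & forall tau, L2per_sym B tau ->
    fine (leb V) * pairing V tau k = \int[leb]_x (\sum_j tau x i j * pderiv j phi x).
Proof.
move=> cV tphi; have cP := unit_cell_parallelepiped hB; have [mP _ _] := cP.
have /andP[V0 Voo] := lebesgue_unit_cell hB cV.
have tdphi j := test_function_pderiv j tphi.
pose Phi := periodize B phi.
have CPhi : C1 Phi by exact: C1_periodize.
pose w x : Rd := Phi x *: basis_vec i.
have wE j : (fun x => w x ord0 j) = if j == i then Phi else fun=> 0.
  by apply/funext => x; rewrite !mxE eqxx /=; case: eqP => _; rewrite ?mulr1 ?mulr0.
have Cw j : C1 (fun x => w x ord0 j) by rewrite wE; case: eqP => // _; exact: C1_cst.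
have pw j : everywhere_periodic B (fun x => w x ord0 j).
  by rewrite wE; case: eqP => // _; exact: periodize_periodic.
have kE := strain_fluct_C1 Cw pw.
exists (fun x => symm (grad_mx w x)) => // tau htau; have [t2 st pt] := htau.
have gE x j l : grad_mx w x j l = if j == i then periodize B (pderiv l phi) x else 0.
  rewrite mxE wE; case: eqP => _; first by rewrite pderiv_periodize.
  exact: derive_cst.
pose h x := \sum_j tau x i j * pderiv j phi x.
pose H x := \sum_j tau x i j * periodize B (pderiv j phi) x.
have mH : measurable_fun setT H.
  apply: measurable_sum => j; apply: measurable_funM; first exact: L2loc_measurable.
  by apply: continuous_measurable_rV; exact: continuous_periodize.
have pH : lattice_periodic B H.
  move=> r Br; have [z zE] := Br; apply: filterS (pt r Br) => x tx; rewrite /H tx.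
  by apply: eq_bigr => j _; rewrite zE (periodize_periodic B (pderiv j phi) z x).
have ih : leb.-integrable setT (fun x => (h x)%:E).
  under eq_fun do rewrite -sumEFin; apply: integrable_sum => // j _.
  exact: integrableM_test.
rewrite /pairing /cell_mean mulrA mulfV ?mul1r; last first.
  by rewrite gt_eqF// fine_gt0// V0.
transitivity (\int[leb]_(x in V) H x).
  congr fine; apply: ae_eq_integral.
  - by case: cV.
  - by apply/measurable_EFinP; apply: measurable_funTS; apply: measurable_ddot htau kE.1.
  - by apply/measurable_EFinP; exact: measurable_funTS.
  apply: filterS st => x stx _; rewrite ddot_symm// /ddot (bigD1 i)//= [X in _ + X]big1 ?addr0.
    by congr EFin; apply: eq_bigr => j _; rewrite gE eqxx.
  by move=> j /negPf ji; apply: big1 => l _; rewrite gE ji mulr0.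
rewrite [LHS]/Rintegral (integral_unit_cell hB cV cP mH pH) -/(Rintegral _ _ _).
have [M [M0 phi0 dphi0 _]] := test_function_bounded tphi.
have [N [N0 PN]] := parallelepiped_sub_cbox hB.
have [A hA] := lattice_near_finite hB M N.
have hAd x z j : parallelepiped B x -> pderiv j phi (x + lattice_point B z) != 0 -> z \in A.
  move=> /PN Nx /eqP nz; apply: hA Nx _; apply: contrapT => nM; apply: nz; exact: dphi0.
rewrite -/(Rintegral leb setT h) (Rintegral_unfold (A := A) ih); last first.
  move=> x z Px hnz; have [j] : exists j, pderiv j phi (x + lattice_point B z) != 0.
    apply: contrapT => /forallNP nj; move/eqP: hnz; apply; apply: big1 => j _.
    by have := nj j => /negP; rewrite negbK => /eqP ->; rewrite mulr0.
  exact: hAd.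
rewrite -Rintegral_sum//; last first.
  move=> z; apply: (integrableS measurableT) => //.
  exact: (integrable_translation _ ih).
have mhz : measurable_fun setT (fun x : Rd => \sum_(z <- A) h (x + lattice_point B z)).
  apply: measurable_sum => z; apply: (measurableT_comp (f := h)) (measurable_translation _).
  by apply/measurable_EFinP; exact: measurable_int ih.
congr fine; apply: ae_eq_integral => //.
- by apply/measurable_EFinP; exact: measurable_funTS.
- by apply/measurable_EFinP; exact: measurable_funTS.
apply: filterS (ae_periodic pt) => x tx Px; congr EFin.
rewrite /H /h exchange_big /=; apply: eq_bigr => j _.
rewrite (periodize_finite (A := A)); last by move=> z; exact: hAd.
by rewrite mulr_sumr; apply: eq_bigr => z _; rewrite tx.
Qed.

End smooth_strains.

(** * Strain fluctuations with a divergence-free stress vanish *)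

Section uniqueness.
Context {R : realType} {d : nat}.
Local Notation Rd := 'rV[R]_d.
Local Notation Md := 'M[R]_d.
Local Notation leb := (lebesgue_rV d : {measure set Rd -> \bar R}).
Variable B : Md.
Hypothesis hB : B \in unitmx.

Lemma ae_continuous_eq0 (f : Rd -> R) : continuous f ->
  (\forall x \ae leb, f x = 0) -> forall x, f x = 0.
Proof.
move=> cf f0 x; apply/eqP; apply: contrapT => /negP fx.
have fx0 : 0 < `|f x| by rewrite normr_gt0.
have h : \forall y \near x, `|f x - f y| < `|f x|.
  exact: (@cvgrPdist_lt R R^o Rd (nbhs x) _ f (f x)).1 (cf x) _ fx0.
have /nbhs_ballP[e /= e0 xe] := h.
have [y /xe /= fxy fy0] := ae_ball_rV x e0 f0.
by move: fxy; rewrite fy0 subr0 ltxx.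
Qed.

Lemma continuous_integral_eq0 V (f : Rd -> R) : unit_cell B V -> continuous f ->
  everywhere_periodic B f -> (forall x, 0 <= f x) ->
  \int[leb]_(x in V) f x = 0 -> forall x, f x = 0.
Proof.
move=> cV cf pf f0 if0; have mV : measurable V by case: cV.
have mf := continuous_measurable_rV cf.
have f2 : L2periodic B f.
  by split; [exact: continuous_L2loc|exact: everywhere_lattice_periodic].
have ifV : leb.-integrable V (fun x => (f x)%:E) by exact: (L2periodic_integrable hB).
have fV0 : (\int[leb]_(x in V) (f x)%:E = 0)%E.
  by rewrite -(fineK (integrable_fin_num mV ifV)) -/(Rintegral leb V f) if0.
apply: ae_continuous_eq0 => //.
apply: (ae_unit_cell (P := fun x => f x = 0) cV).
  move=> r [z zE]; apply: aeW => x; rewrite -{2}(subrK r x) zE.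
  by rewrite (pf z (x - map_mx intr z *m B)).
have mfV : measurable_fun V (fun x => (f x)%:E).
  by apply/measurable_EFinP; exact: measurable_funTS.
have /(ae_eq_integral_abs leb mV mfV) : (\int[leb]_(x in V) `|(f x)%:E| = 0)%E.
  rewrite -fV0; apply: eq_integral => x _; by rewrite gee0_abs// lee_fin.
by apply: filterS => x h Vx; have := h Vx => -[].
Qed.

Variable L0 : tensor4 R d.
Hypothesis hL0 : uniform_stiffness L0.

Let L0f : Rd -> tensor4 R d := fun=> L0.

(** The divergence of the convolution at [x] is the distributional divergence
    tested against the kernel reflected about [x]. *)
Lemma mollify_divergence_free (rho : Rd -> R) (sigma : tensor_field R d) i x :
  test_function rho -> stress_adm B sigma ->
  \sum_j pderiv j (mollify rho (fun y => sigma y i j)) x = 0.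
Proof.
move=> trho [[s2 _ _] ds].
have := ds i _ (test_function_reflect x trho).
have E j y : pderiv j (fun y => rho (x - y)) y = - pderiv j rho (x - y).
  by apply: pderiv_reflect; exact: (smooth_derivable trho.1).
have ij j : leb.-integrable setT (fun y => (sigma y i j * pderiv j rho (x - y))%:E).
  exact: mollify_integrable (test_function_pderiv j trho) (s2 i j).
under eq_bigr do rewrite pderiv_mollify//.
rewrite -(Rintegral_sum _ measurableT ij) => h.
have isum : leb.-integrable setT
    (fun y => (\sum_j sigma y i j * pderiv j rho (x - y))%:E).
  by under eq_fun do rewrite -sumEFin; exact: integrable_sum.
apply: oppr_inj; rewrite oppr0 -[RHS]h -mulN1r -RintegralZl//.
apply: eq_Rintegral => y _; rewrite mulN1r -sumrN.
by apply: eq_bigr => j _; rewrite E mulrN.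
Qed.

(** Mollification turns [v] into the symmetrised gradient of a periodic C1
    displacement and [L0 v] into a divergence-free C1 field. Their product is a
    divergence, so it has zero mean over the cell, and positivity of [L0] makes
    the mollified field vanish. *)
Lemma strain_stress_eq0 V (v : tensor_field R d) : unit_cell B V -> strain_fluct B v ->
  stress_adm B (tensor4_fapp L0f v) -> \forall x \ae leb, v x = 0.
Proof.
move=> cV [hv [w [Hw [G wG vG]]]] hs.
have [mL0 ML0 pL0] := hL0; have mV : measurable V by case: cV.
have [v2 vs vp] := hv; have [[s2 _ sp] _] := hs.
have w2 j : L2loc (fun x => w x ord0 j) by have [[]] := Hw j.
have wp j : lattice_periodic B (fun x => w x ord0 j) by have [] := Hw j.
suff key rho : test_function rho -> forall x k l, mollify rho (fun y => v y k l) x = 0.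
  have v0 k l : \forall x \ae leb, v x k l = 0.
    apply: fundamental_lemma => // phi tphi.
    (* The integral of [v] against [phi] is the convolution with the reflected
       [phi], taken at 0. *)
    rewrite -[RHS](key _ (test_function_reflect 0 tphi) 0 k l).
    by apply: eq_Rintegral => y _; rewrite !sub0r opprK.
  have : \forall x \ae leb, forall p : 'I_d * 'I_d, v x p.1 p.2 = 0.
    by apply: ae_forall_countable => -[k l]; exact: v0.
  by apply: filterS => x h; apply/matrixP => k l; rewrite mxE; exact: (h (k, l)).
move=> trho.
pose wr j := mollify rho (fun x => w x ord0 j).
pose vr x : Md := \matrix_(i, j) mollify rho (fun y => v y i j) x.
pose sr i j := mollify rho (fun y => tensor4_fapp L0f v y i j).
have Cw j : C1 (wr j) by exact: C1_mollify.
have Cs i j : C1 (sr i j) by exact: C1_mollify.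
have pw j : everywhere_periodic B (wr j) by exact: mollify_periodic.
have ps i j : everywhere_periodic B (sr i j).
  by apply: mollify_periodic => //; exact: (lattice_periodic1 (fun a : Md => a i j)).
have dw i j : pderiv j (wr i) = mollify rho (fun y => G y i j).
  by apply: mollify_weak_pderiv => //; [exact: (wG i j).1|exact: (wG i j).2].
have vE x : vr x = symm (\matrix_(i, j) pderiv j (wr i) x).
  apply/matrixP => i j; rewrite !mxE !dw.
  rewrite -mollifyD//; try exact: (wG _ _).1.
  rewrite -mollifyZ//; last by apply: L2locD; exact: (wG _ _).1.
  apply: mollify_ae_eq => //.
    by apply: L2locZ; apply: L2locD; exact: (wG _ _).1.
  by apply: filterS vG => y ->; rewrite !mxE.
have sE x : \matrix_(i, j) sr i j x = tensor4_app L0 (vr x).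
  apply/matrixP => i j; rewrite !mxE /sr.
  rewrite (_ : (fun y => _) = fun y => \sum_k \sum_l L0 i j k l * v y k l); last first.
    by apply/funext => y; rewrite mxE.
  rewrite mollify_sum//; last by move=> k; apply: L2loc_sum => l; exact: L2locZ.
  apply: eq_bigr => k _; rewrite mollify_sum//; last by move=> l; exact: L2locZ.
  by apply: eq_bigr => l _; rewrite mollifyZ// mxE.
have vrs x : sym_mx (vr x) by rewrite vE; exact: symm_sym.
(* The stress being divergence-free, the divergence of this flux is the energy
   density. *)
pose F j x := \sum_i sr i j x * wr i x.
have CF j : C1 (F j) by apply: C1_sum => i; exact: C1M.
have pF j : everywhere_periodic B (F j).
  by move=> z x; apply: eq_bigr => i _; rewrite ps pw.
have dF x : \sum_j pderiv j (F j) x = ddot (tensor4_app L0 (vr x)) (vr x).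
  rewrite [in X in _ = ddot _ X]vE ddot_symm; last exact: tensor4_app_sym.
  rewrite -sE /ddot exchange_big /=.
  transitivity (\sum_j \sum_i (sr i j x * pderiv j (wr i) x + pderiv j (sr i j) x * wr i x)).
    apply: eq_bigr => j _; rewrite /F pderiv_sum; last by move=> i; exact: C1M.
    by apply: eq_bigr => i _; rewrite pderivM.
  rewrite exchange_big /= [RHS]exchange_big /=; apply: eq_bigr => i _.
  rewrite big_split /= -mulr_suml mollify_divergence_free// mul0r addr0.
  by apply: eq_bigr => j _; rewrite !mxE.
have cvr k l : continuous (fun x => vr x k l).
  rewrite (_ : (fun x => _) = mollify rho (fun y => v y k l)).
    exact: mollify_continuous.
  by apply/funext => x; rewrite mxE.
have pvr z x : vr (x + lattice_point B z) = vr x.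
  apply/matrixP => i j; rewrite !mxE; apply: mollify_periodic => //.
  exact: (lattice_periodic1 (fun a : Md => a i j)).
have cddot : continuous (fun x => ddot (tensor4_app L0 (vr x)) (vr x)).
  apply: continuous_sum_fun => i; apply: continuous_sum_fun => j.
  apply: continuousM_fun; last exact: cvr.
  rewrite (_ : (fun x => _) = fun x => \sum_k \sum_l L0 i j k l * vr x k l); last first.
    by apply/funext => x; rewrite mxE.
  apply: continuous_sum_fun => k; apply: continuous_sum_fun => l.
  by apply: continuousM_fun; [exact: cst_continuous|exact: cvr].
have ge0 x : 0 <= ddot (tensor4_app L0 (vr x)) (vr x).
  have [->|v0] := eqVneq (vr x) 0; last exact/ltW/pL0.
  by rewrite -(scale0r (0 : Md)) ddotC ddotZl mul0r.
have int0 : \int[leb]_(x in V) ddot (tensor4_app L0 (vr x)) (vr x) = 0.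
  under eq_Rintegral do rewrite -dF.
  rewrite Rintegral_sum//; last first.
    move=> j.
    have Cp : L2periodic B (pderiv j (F j)).
      split; first exact: continuous_L2loc ((CF j).2 j).2.
      by apply: everywhere_lattice_periodic; exact: everywhere_periodic_pderiv.
    exact: (L2periodic_integrable hB cV Cp).
  by apply: big1 => j _; exact: (integral_pderiv_periodic hB).
have pE : everywhere_periodic B (fun x => ddot (tensor4_app L0 (vr x)) (vr x)).
  by move=> z x; rewrite pvr.
have zero := continuous_integral_eq0 cV cddot pE ge0 int0.
move=> x k l.
have : vr x = 0.
  apply/eqP; apply: contrapT => /negP vx; have := pL0 _ (vrs x) vx.
  by rewrite zero ltxx.
by move=> /matrixP /(_ k l); rewrite !mxE.
Qed.

End uniqueness.

(** * Stiffness fields, strains and stresses *)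

Section stiffness.
Context {R : realType} {d : nat}.
Local Notation Rd := 'rV[R]_d.
Local Notation Md := 'M[R]_d.
Local Notation leb := (lebesgue_rV d : {measure set Rd -> \bar R}).
Variable B : Md.
Hypothesis hB : B \in unitmx.
Variable V : set Rd.
Hypothesis cV : unit_cell B V.

Lemma stiffness_bounded L : stiffness_field B V L -> bounded_tensor_field B L.
Proof.
move=> [mL pL sL cL]; split => //.
  by move=> i j k l; exact: (mL i j k l).1.
move=> i j k l; have [M LM] := (mL i j k l).2; exists M.
apply: (ae_unit_cell (P := fun x => `|L x i j k l| <= M) cV) => // r Br.
have := ae_translation (- r) (pL r Br).
by apply: filterS => x; rewrite subrK => ->.
Qed.

Lemma stiffness_inverse L : stiffness_field B V L ->
  \forall x \ae leb, inverse_tensor (L x) (tensor4_inv (L x)).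
Proof.
move=> [_ _ sL [mu mu0 cL]]; apply: filterS2 sL cL => x [mLx _] cx.
by apply: tensor4_invP => //; exact: coercive_posdef cx.
Qed.

Lemma stiffness_inverse_bounded L : stiffness_field B V L ->
  bounded_tensor_field B (tensor4_finv L).
Proof.
move=> hL; have bL := stiffness_bounded hL; have iL := stiffness_inverse hL.
have [_ pL sL [mu mu0 cL]] := hL; split.
- exact: (measurable_tensor4_inv (btf_measurable bL)).
- move=> i j k l; eexists; apply: filterS2 cL iL => x cx ix.
  exact: (inverse_tensor_bounded i j k l mu0 cx ix).
- exact: (lattice_periodic1 (@tensor4_inv R d)).
- apply: filterS2 sL iL => x [_ ML] ix; split; first by case: ix.
  exact: inverse_tensor_major ML ix.
Qed.

End stiffness.

Section subspaces.
Context {R : realType} {d : nat}.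
Local Notation Rd := 'rV[R]_d.
Local Notation Md := 'M[R]_d.
Local Notation leb := (lebesgue_rV d : {measure set Rd -> \bar R}).
Variable B : Md.

Lemma L2locB (f g : Rd -> R) : L2loc f -> L2loc g -> L2loc (fun x => f x - g x).
Proof.
move=> f2 g2; rewrite (_ : (fun x => _) = fun x => f x + (-1) * g x).
  by apply: L2locD => //; exact: L2locZ.
by apply/funext => x; rewrite mulN1r.
Qed.

Lemma weak_pderivB i (u u' g g' : Rd -> R) : L2loc u -> L2loc u' -> L2loc g -> L2loc g' ->
  weak_pderiv i u g -> weak_pderiv i u' g' ->
  weak_pderiv i (fun x => u x - u' x) (fun x => g x - g' x).
Proof.
move=> u2 u2' g2 g2' ug ug' phi tphi; have tdphi := test_function_pderiv i tphi.
under eq_Rintegral do rewrite mulrBl.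
under [in RHS]eq_Rintegral do rewrite mulrBl.
rewrite RintegralB//; try exact: integrableM_test.
rewrite RintegralB//; try exact: integrableM_test.
by rewrite ug// ug'// opprB opprK addrC.
Qed.

Lemma strain_fluctB e e' : strain_fluct B e -> strain_fluct B e' -> strain_fluct B (e - e').
Proof.
move=> [he [w [Hw [G wG eG]]]] [he' [w' [Hw' [G' wG' eG']]]].
have E1 j : (fun x => (w x - w' x) ord0 j) = fun x => w x ord0 j - w' x ord0 j.
  by apply/funext => x; rewrite !mxE.
have E2 j i : (fun x => (G x - G' x) j i) = fun x => G x j i - G' x j i.
  by apply/funext => x; rewrite !mxE.
have w2 j : L2loc (fun x => w x ord0 j) by have [[]] := Hw j.
have w2' j : L2loc (fun x => w' x ord0 j) by have [[]] := Hw' j.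
have wGG j i : L2loc (fun x => (G x - G' x) j i) /\
    weak_pderiv i (fun x => (w x - w' x) ord0 j) (fun x => (G x - G' x) j i).
  rewrite E1 E2; have [G2 dG] := wG j i; have [G2' dG'] := wG' j i.
  by split; [exact: L2locB|exact: weak_pderivB].
split; first exact: L2per_symB.
exists (fun x => w x - w' x); split.
  move=> j; split; last first.
    rewrite E1; have [_ pw] := Hw j; have [_ pw'] := Hw' j.
    exact: (lattice_periodic2 (fun a b : R => a - b) pw pw').
  split; first by rewrite E1; exact: L2locB.
  by move=> i; exists (fun x => (G x - G' x) j i); [exact: (wGG j i).1|exact: (wGG j i).2].
exists (fun x => G x - G' x); first exact: wGG.
apply: filterS2 eG eG' => x ex ex'; rewrite [LHS](_ : _ = e x - e' x)// ex ex'.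
by rewrite -scalerBr opprD addrACA [(G x - G' x)^T]linearB.
Qed.

Lemma stress_admD s s' : stress_adm B s -> stress_adm B s' -> stress_adm B (s + s').
Proof.
move=> [hs ds] [hs' ds']; split; first exact: L2per_symD.
move=> i phi tphi.
have is_ (f : tensor_field R d) j : L2per_sym B f ->
    leb.-integrable setT (fun x => (f x i j * pderiv j phi x)%:E).
  by move=> [f2 _ _]; apply: integrableM_test => //; exact: test_function_pderiv.
have isum (f : tensor_field R d) : L2per_sym B f ->
    leb.-integrable setT (fun x => (\sum_j f x i j * pderiv j phi x)%:E).
  move=> hf; under eq_fun do rewrite -sumEFin.
  by apply: integrable_sum => // j _; exact: is_.
have := RintegralD measurableT (isum s hs) (isum s' hs').
rewrite (ds i phi tphi) (ds' i phi tphi) addr0 => E; rewrite -[RHS]E.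
apply: eq_Rintegral => x _; rewrite -[RHS]big_split /=; apply: eq_bigr => j _.
by rewrite [(s + s') x]/(s x + s' x) mxE mulrDl.
Qed.

Lemma stress_adm_cst (c : Md) : sym_mx c -> stress_adm B (cst c).
Proof.
move=> sc; split; first exact: L2per_sym_cst.
move=> i phi tphi; have [M [M0 phi0 _ _]] := test_function_bounded tphi.
have ij j : leb.-integrable setT (fun x => (c i j * pderiv j phi x)%:E).
  by apply: integrableM_test; [exact: L2loc_cst|exact: test_function_pderiv].
rewrite (Rintegral_sum _ measurableT ij); apply: big1 => j _.
have := weak_pderiv_C1 (u := fun=> c i j) j (C1_cst _) tphi => ->.
rewrite -[RHS]oppr0; congr (- _); rewrite -[RHS](_ : \int[leb]_x (cst 0 x : R) = 0).
  by apply: eq_Rintegral => x _; rewrite /pderiv derive_cst mul0r.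
by rewrite /Rintegral integral0.
Qed.

End subspaces.

(** * Projectors, gradients and the error functional *)

Section gradients.
Context {R : realType} {d : nat}.

Lemma quadratic_quotient_cvg (F : R -> R) (a b : R) :
  (forall t, F t = t * a + t ^+ 2 * b) -> t^-1 * F t @[t --> (0 : R)^'] --> a.
Proof.
move=> FE; have C : a + t * b @[t --> (0 : R)^'] --> a.
  have h : (fun t : R => a + t * b) x @[x --> (0 : R)] --> a + 0 * b.
    apply: (@cvgD _ _ _ _ _ (fun=> a) (fun t => t * b)); first exact: cvg_cst.
    by apply: cvgMr_tmp; exact: cvg_id.
  rewrite mul0r addr0 in h; exact: cvg_within_filter h.
apply: cvg_trans C; apply: near_eq_cvg.
exists 1 => //= t _ t0; rewrite FE.
by field.
Qed.

(** The gradient is a chosen element. Two elements with the defining property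
    have the same product with every member of [K], hence with each other. *)
Lemma energetic_gradient_norm (ip : tensor_field R d -> tensor_field R d -> R)
    (K : set (tensor_field R d)) J x g0 : K g0 ->
  (forall f g, K f -> K g -> ip f g = ip g f) ->
  (forall h, K h -> t^-1 * (J (x + t *: h) - J x) @[t --> (0 : R)^'] --> ip g0 h) ->
  ip (energetic_gradient ip K J x) (energetic_gradient ip K J x) = ip g0 g0.
Proof.
move=> Kg0 ipC g0h; set g := energetic_gradient ip K J x.
have [Kg gh] : K g /\ forall h, K h ->
    t^-1 * (J (x + t *: h) - J x) @[t --> (0 : R)^'] --> ip g h.
  by apply: (@xgetPex _ (cst 0) [set g | K g /\ forall h, K h ->
    t^-1 * (J (x + t *: h) - J x) @[t --> (0 : R)^'] --> ip g h]); exists g0; split.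
have E h : K h -> ip g h = ip g0 h.
  by move=> Kh; exact: (cvg_unique (@Rhausdorff R) (gh h Kh) (g0h h Kh)).
by rewrite E// ipC// E.
Qed.

End gradients.

Section duality.
Context {R : realType} {d : nat}.
Local Notation Rd := 'rV[R]_d.
Local Notation Md := 'M[R]_d.
Local Notation leb := (lebesgue_rV d : {measure set Rd -> \bar R}).
Variables (B : Md) (V : set Rd) (L0 : tensor4 R d).
Hypotheses (hB : B \in unitmx) (cV : unit_cell B V) (hL0 : uniform_stiffness L0).
Implicit Types f g e s k tau eta : tensor_field R d.

Let H := L2per_sym B.
Let E0 := strain_fluct B.
Let Stat := stress_adm B.
Let A f : tensor_field R d := tensor4_fapp (fun=> L0) f.
Let A' f : tensor_field R d := tensor4_fapp (fun=> tensor4_inv L0) f.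
Local Notation "<| f , g |>" := (pairing V f g) (at level 0).
Let ipe := ip_e V L0.
Let ips := ip_s V L0.

Let inv0 : inverse_tensor L0 (tensor4_inv L0).
Proof. by have [mL ML pL] := hL0; exact: tensor4_invP. Qed.

Let btA : bounded_tensor_field B (fun=> L0).
Proof. by have [mL ML pL] := hL0; exact: bounded_tensor_field_cst. Qed.

Let btA' : bounded_tensor_field B (fun=> tensor4_inv L0).
Proof.
have [mL ML pL] := hL0; apply: bounded_tensor_field_cst; first by case: inv0.
exact: inverse_tensor_major ML inv0.
Qed.

Let HA f : H f -> H (A f). Proof. exact: L2per_sym_tensor btA. Qed.
Let HA' f : H f -> H (A' f). Proof. exact: L2per_sym_tensor btA'. Qed.

Lemma tensor4_fappB (T : Rd -> tensor4 R d) f g :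
  tensor4_fapp T (f - g) = tensor4_fapp T f - tensor4_fapp T g.
Proof. by apply/funext => x; exact: tensor4_appB. Qed.

Lemma tensor4_fappD (T : Rd -> tensor4 R d) f g :
  tensor4_fapp T (f + g) = tensor4_fapp T f + tensor4_fapp T g.
Proof. by apply/funext => x; exact: tensor4_appD. Qed.

Lemma tensor4_fappZ (T : Rd -> tensor4 R d) c f :
  tensor4_fapp T (c *: f) = c *: tensor4_fapp T f.
Proof. by apply/funext => x; exact: tensor4_appZ. Qed.

Let AK f : H f -> \forall x \ae leb, A (A' f) x = f x.
Proof. by move=> [_ sf _]; apply: filterS sf => x sfx; exact: (inv0.2 _ sfx).2. Qed.

Let A'K f : H f -> \forall x \ae leb, A' (A f) x = f x.
Proof. by move=> [_ sf _]; apply: filterS sf => x sfx; exact: (inv0.2 _ sfx).1. Qed.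

Let pBl f f' g : H f -> H f' -> H g -> <| f - f', g |> = <| f, g |> - <| f', g |>.
Proof. exact: pairingBl. Qed.
Let pBr f g g' : H f -> H g -> H g' -> <| f, g - g' |> = <| f, g |> - <| f, g' |>.
Proof. by move=> *; rewrite pairingC pBl// !(pairingC _ _ f). Qed.

Lemma ip_sC f g : H f -> H g -> ips f g = ips g f.
Proof.
move=> hf hg; rewrite [LHS](_ : _ = <| f, A' g |>)// -(pairing_tensor cV btA')//.
exact: pairingC.
Qed.

Lemma ip_eC f g : H f -> H g -> ipe f g = ipe g f.
Proof.
move=> hf hg; rewrite [LHS](_ : _ = <| A f, g |>)// (pairing_tensor cV btA)//.
exact: pairingC.
Qed.

Lemma ip_s_A f g : H f -> H g -> ips f (A g) = <| f, g |>.
Proof.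
move=> hf hg; apply: (pairing_ae cV) => //; [exact/HA'/HA|exact: aeW|exact: A'K].
Qed.

Lemma ip_e_A' f g : H f -> H g -> ipe (A' f) g = <| f, g |>.
Proof.
move=> hf hg; apply: (pairing_ae cV) => //; [exact/HA/HA'|exact: AK|exact: aeW].
Qed.

Lemma ip_sBl f f' g : H f -> H f' -> H g -> ips (f - f') g = ips f g - ips f' g.
Proof. by move=> *; apply: pBl => //; exact: HA'. Qed.

Lemma ip_eBl f f' g : H f -> H f' -> H g -> ipe (f - f') g = ipe f g - ipe f' g.
Proof.
move=> hf hf' hg; rewrite [LHS](_ : _ = <| A (f - f'), g |>)// /A tensor4_fappB.
by apply: pBl => //; exact: HA.
Qed.

Lemma ip_e_ge0 f : H f -> 0 <= ipe f f.
Proof.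
move=> hf; have [mL ML pL] := hL0; have [_ sf _] := hf.
apply: (cell_mean_ge0 cV); first exact: measurable_ddot (HA hf) hf.
apply: filterS sf => x sx; have [->|v0] := eqVneq (f x) 0; last exact/ltW/pL.
by rewrite -(scale0r (0 : Md)) ddotC ddotZl mul0r.
Qed.

Lemma ip_s_ge0 f : H f -> 0 <= ips f f.
Proof.
move=> hf; rewrite (_ : ips f f = ipe (A' f) (A' f)); first exact/ip_e_ge0/HA'.
rewrite [LHS](_ : _ = <| f, A' f |>)//.
apply: (pairing_ae cV) => //;
  [exact/HA/HA'|exact: HA'|exact: HA'| |exact: aeW].
by apply: filterS (AK hf) => x h; rewrite -[LHS]h.
Qed.

(** The product is only semi-definite on functions, so this takes the place of
    [f = 0]; it is the degenerate case of the Cauchy-Schwarz inequality. *)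
Lemma ip_s_null f g : H f -> H g -> ips f f = 0 -> ips g f = 0.
Proof.
move=> hf hg f0; apply/eqP; apply: contrapT => /negP gf0.
pose b := ips g f; pose a := ips g g.
have q (t : R) : 0 <= a + 2 * t * b.
  have htf := L2per_symZ t hf.
  have hgt := L2per_symD hg htf.
  suff -> : a + 2 * t * b = ips (g + t *: f) (g + t *: f) by exact: ip_s_ge0.
  have Dl u u' w : H u -> H u' -> H w -> ips (u + u') w = ips u w + ips u' w.
    by move=> *; apply: (pairingDl hB cV) => //; exact: HA'.
  have Zl c u w : H u -> H w -> ips (c *: u) w = c * ips u w.
    by move=> *; apply: (pairingZl hB cV) => //; exact: HA'.
  rewrite Dl// (ip_sC hg hgt) Zl// (ip_sC hf hgt) !Dl// !Zl// f0 (ip_sC hf hg) /a /b.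
  ring.
(* The left-hand side is affine in [t]; it takes the value -1 here. *)
have := q (- (a + 1) / (2 * b)).
rewrite (_ : a + 2 * (- (a + 1) / (2 * b)) * b = -1); last first.
  by field; rewrite gf0.
by rewrite oppr_ge0 ler10.
Qed.

Lemma strain_L2per k : E0 k -> H k. Proof. by case. Qed.
Lemma stress_L2per s : Stat s -> H s. Proof. by case. Qed.

(** The test strains detect the divergence. Orthogonality is asked only of the
    strains known to be orthogonal to every stress, as the test strains are,
    because the orthogonality of all strains to all stresses is proved later
    with this lemma. *)
Lemma stress_adm_of_orthogonal tau : H tau ->
  (forall k, E0 k -> (forall s, Stat s -> <| s, k |> = 0) -> <| tau, k |> = 0) ->
  Stat tau.
Proof.
move=> htau orth; split => // i phi tphi.
have [k hk kE] := test_strain hB i cV tphi.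
rewrite -(kE _ htau) orth ?mulr0// => s hs.
have /andP[V0 Voo] := lebesgue_unit_cell hB cV.
have := kE _ (stress_L2per hs); rewrite hs.2// => /eqP.
by rewrite mulf_eq0 gt_eqF/= ?fine_gt0 ?V0// => /eqP.
Qed.

Variables (PE PS : tensor_field R d -> tensor_field R d).
Hypothesis hPE : orth_projector B ipe E0 PE.
Hypothesis hPS : orth_projector B ips (energetic_orthogonal B ips Stat) PS.

Let PE_E0 f : H f -> E0 (PE f). Proof. by move=> /hPE[]. Qed.
Let PE_orth f k : H f -> E0 k -> ipe (f - PE f) k = 0.
Proof. by move=> /hPE[_]; exact. Qed.
Let HPE f : H f -> H (PE f). Proof. by move=> /PE_E0/strain_L2per. Qed.
Let PS_L2 f : H f -> H (PS f). Proof. by move=> /hPS[[]]. Qed.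
Let PS_perp f s : H f -> Stat s -> ips (PS f) s = 0.
Proof. by move=> /hPS[[_ h] _]; exact: h. Qed.
Let PS_orth f k : H f -> H k -> (forall s, Stat s -> ips k s = 0) -> ips (f - PS f) k = 0.
Proof. by move=> /hPS[_ h] hk ks; apply: h. Qed.

(** The projectors yield a decomposition of [e]. Let [p] be the part of [L0 e]
    orthogonal to the stresses and [q] the strain part of [L0^-1 p]. Both [L0 e
    - p] and [p - L0 q] are divergence-free, so [e - q] is a strain fluctuation
    with a divergence-free stress and vanishes by [strain_stress_eq0]. Moreover
    [p - L0 q] is a stress orthogonal to [p] and to [L0 q], hence of zero norm,
    and the product of [s] with [e] is that of [s] with [q], hence with [p],
    hence 0. *)
Lemma stress_strain_orthogonal s e : Stat s -> E0 e -> <| s, e |> = 0.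
Proof.
move=> hs he; have He := strain_L2per he; have Hs := stress_L2per hs.
pose p := PS (A e); have Hp : H p by apply: PS_L2; exact: HA.
pose q := PE (A' p); have Eq : E0 q by apply: PE_E0; exact: HA'.
have Hq := strain_L2per Eq.
have st1 : Stat (A e - p).
  apply: stress_adm_of_orthogonal; first by apply: L2per_symB => //; exact: HA.
  move=> k hk kS; have Hk := strain_L2per hk.
  rewrite -ip_s_A//; last by apply: L2per_symB => //; exact: HA.
  apply: PS_orth; [exact: HA|exact: HA|] => s' hs'.
  by rewrite ip_sC ?ip_s_A ?kS//; [exact: stress_L2per|exact: HA|exact: stress_L2per].
have pq k : E0 k -> <| p - A q, k |> = 0.
  move=> hk; have Hk := strain_L2per hk.
  have := PE_orth (HA' Hp) hk; rewrite ip_eBl ?ip_e_A'//; last exact: HA'.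
  by rewrite pBl//; exact: HA.
have Hm : H (p - A q) by apply: L2per_symB => //; exact: HA.
have st2 : Stat (p - A q) by apply: stress_adm_of_orthogonal => // k hk _; exact: pq.
have m0 : ips (p - A q) (p - A q) = 0.
  rewrite ip_sBl//; last exact: HA.
  by rewrite PS_perp ?sub0r//; [rewrite ip_sC ?ip_s_A ?pq ?oppr0//; exact: HA|exact: HA].
have st3 : Stat (A (e - q)).
  rewrite (_ : A (e - q) = (A e - p) + (p - A q)); first exact: stress_admD.
  by rewrite /A tensor4_fappB addrA subrK.
have v0 := strain_stress_eq0 hB hL0 cV (strain_fluctB he Eq) st3.
have -> : <| s, e |> = <| s, q |>.
  apply: (pairing_ae cV) => //; first exact: aeW.
  by apply: filterS v0 => x /eqP; rewrite subr_eq0 => /eqP.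
rewrite -ip_s_A//.
have := ip_s_null Hm Hs m0; rewrite ip_sC// ip_sBl//; last exact: HA.
rewrite PS_perp//; last exact: HA.
by rewrite sub0r => /eqP; rewrite oppr_eq0 ip_sC//; [move/eqP|exact: HA].
Qed.

Lemma stress_admP tau : H tau -> Stat tau <-> forall k, E0 k -> <| tau, k |> = 0.
Proof.
move=> htau; split; first by move=> hs k hk; exact: stress_strain_orthogonal.
by move=> h; apply: stress_adm_of_orthogonal => // k hk _; exact: h.
Qed.

Lemma strain_orthogonal_stress e : E0 e -> forall s, Stat s -> ips (A e) s = 0.
Proof.
move=> he s hs; have He := strain_L2per he; have Hs := stress_L2per hs.
by rewrite ip_sC ?ip_s_A ?stress_strain_orthogonal//; exact: HA.
Qed.

(** [L0] intertwines the two projectors up to fields of zero norm: [L0 q], for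
    the strain part [q] of [L0^-1 tau], is orthogonal to the stresses and [tau -
    L0 q] is a stress. *)
Lemma ip_s_PS tau : H tau ->
  ips (PS tau) (PS tau) = ipe (PE (A' tau)) (PE (A' tau)).
Proof.
move=> htau; set q := PE _; have Eq : E0 q by apply: PE_E0; exact: HA'.
have Hq := strain_L2per Eq; have HPS := PS_L2 htau.
have Hd : H (tau - A q) by apply: L2per_symB => //; exact: HA.
have st : Stat (tau - A q).
  apply/stress_admP => // k hk; have Hk := strain_L2per hk.
  have := PE_orth (HA' htau) hk; rewrite ip_eBl ?ip_e_A'//; last exact: HA'.
  by rewrite pBl//; exact: HA.
have eq1 k : H k -> (forall s, Stat s -> ips k s = 0) -> ips (PS tau) k = ips (A q) k.
  move=> Hk ks; have := PS_orth htau Hk ks; rewrite ip_sBl// => /eqP; rewrite subr_eq0 => /eqP <-.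
  have := ks _ st; rewrite ip_sC// ip_sBl//; last exact: HA.
  by move=> /eqP; rewrite subr_eq0 => /eqP.
rewrite eq1//; last by move=> s hs; exact: PS_perp.
rewrite ip_sC//; last exact: HA.
rewrite eq1; [|exact: HA|exact: strain_orthogonal_stress].
by rewrite ip_s_A//; exact: HA.
Qed.

Lemma ip_s_PS_stress s : Stat s -> ips (PS s) (PS s) = 0.
Proof.
move=> hs; have Hs := stress_L2per hs; have HPS := PS_L2 Hs.
have := PS_orth Hs HPS (fun s' hs' => PS_perp Hs hs').
by rewrite ip_sBl// ip_sC// PS_perp// sub0r => /eqP; rewrite oppr_eq0 => /eqP.
Qed.

Variable L : Rd -> tensor4 R d.
Hypothesis hL : stiffness_field B V L.
Variable ebar : Md.
Hypothesis hebar : uniform_fields B (cst ebar).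

Let bL : bounded_tensor_field B L. Proof. exact: stiffness_bounded hL. Qed.
Let bLi : bounded_tensor_field B (tensor4_finv L).
Proof. exact: stiffness_inverse_bounded hL. Qed.
Let Hbar : H (cst ebar). Proof. by case: hebar. Qed.
Let HL f : H f -> H (tensor4_fapp L f). Proof. exact: L2per_sym_tensor. Qed.
Let HLi f : H f -> H (tensor4_fapp (tensor4_finv L) f).
Proof. exact: L2per_sym_tensor. Qed.

Let LLi f : H f -> \forall x \ae leb, tensor4_fapp L (tensor4_fapp (tensor4_finv L) f) x = f x.
Proof.
move=> [_ sf _]; apply: filterS2 (stiffness_inverse hL) sf => x ix sx.
exact: (ix.2 _ sx).2.
Qed.

Let ebar_sym : sym_mx ebar.
Proof. by have [_ sb _] := Hbar; have [] := ae_ball_rV (0 : Rd) ltr01 sb. Qed.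

(** Constant fields are stresses, so a fluctuation has zero mean. *)
Lemma strain_adm_fluct e : strain_adm B e -> cell_mean_mx V e = ebar ->
  exists2 e', E0 e' & \forall x \ae leb, e x = ebar + e' x.
Proof.
move=> [He [u [e' [[Hu [c uc]] he' ee']]]] em; exists e' => //.
have He' := strain_L2per he'.
have sc : sym_mx c.
  have [_ su _] := Hu.
  have cs : \forall x \ae leb, sym_mx c by apply: filterS2 uc su => x ->.
  by have [] := ae_ball_rV (0 : Rd) ltr01 cs.
have Hc := L2per_sym_cst B sc.
have eE : \forall x \ae leb, e x = (cst c + e') x.
  by apply: filterS2 uc ee' => x ux ->; rewrite ux.
suff cE : c = ebar by apply: filterS eE => x ->; rewrite cE.
have /andP[V0 Voo] := lebesgue_unit_cell hB cV; have mV : measurable V by case: cV.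
have key (m : Md) : sym_mx m -> ddot ebar m = ddot c m.
  move=> sm; have Hm := L2per_sym_cst B sm.
  rewrite -em (ddot_cell_mean hB cV)//.
  have -> : <| e, cst m |> = <| cst c + e', cst m |>.
    by apply: (pairing_ae cV) => //; [exact: L2per_symD|exact: aeW].
  have em0 : <| e', cst m |> = 0.
    by rewrite pairingC; apply: stress_strain_orthogonal => //; exact: stress_adm_cst.
  rewrite (pairingDl hB cV)// em0 addr0.
  rewrite /pairing /cell_mean /cst Rintegral_cst// mulrCA mulVf ?mulr1//.
  by rewrite gt_eqF// fine_gt0// V0.
apply/eqP; rewrite -subr_eq0; apply/eqP; apply: ddot_sqr_eq0.
have sd : sym_mx (c - ebar) by rewrite /sym_mx linearB/= sc ebar_sym.
have := key _ sd; set m := c - ebar => km.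
rewrite {1}/m ddotDl -[- ebar]scaleN1r ddotZl km.
by rewrite mulN1r subrr.
Qed.

(** By [strain_adm_fluct] the defect is almost everywhere the strain fluctuation
    [e' - PE e], to which both [e - PE e] and the constant [ebar] are
    orthogonal. *)
Lemma strain_defect e : strain_adm B e -> cell_mean_mx V e = ebar ->
  ipe (e - PE e - cst ebar) (e - PE e - cst ebar) = 0.
Proof.
move=> he em; have [e' he' eE] := strain_adm_fluct he em.
have He : H e by case: he. have He' := strain_L2per he'.
have Hd : H (e - PE e) by apply: L2per_symB => //; exact: HPE.
have Hy := L2per_symB Hd Hbar; set y := _ - cst ebar in Hy *.
have hk : E0 (e' - PE e) by apply: strain_fluctB => //; exact: PE_E0.
have Hk := strain_L2per hk.
have -> : ipe y y = ipe y (e' - PE e).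
  apply: (pairing_ae cV) => //; [exact: HA|exact: HA|exact: aeW|].
  apply: filterS eE => x ex; rewrite [LHS](_ : _ = e x - PE e x - ebar)// ex.
  by rewrite addrAC [ebar + _]addrC addrK.
rewrite /y ip_eBl// PE_orth// sub0r ip_eC//.
rewrite [X in - X](_ : _ = <| A (e' - PE e), cst ebar |>)// (pairing_tensor cV btA)//.
rewrite pairingC stress_strain_orthogonal ?oppr0//.
apply: (@stress_adm_cst _ _ B (tensor4_app L0 ebar)).
by have [mL _ _] := hL0; exact: tensor4_app_sym.
Qed.

Lemma measurable_residual tau eta : H tau -> H eta ->
  measurable_fun setT (residual L tau eta).
Proof.
move=> ht he; have Hz : H (tau - tensor4_fapp L eta).
  by apply: L2per_symB => //; exact: HL.
apply: measurable_funM; first exact: measurable_cst.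
exact: measurable_ddot Hz (HLi Hz).
Qed.

Lemma cell_mean_residual_eq0 tau eta : H tau -> H eta ->
  (\forall x \ae leb, tau x = tensor4_fapp L eta x) ->
  cell_mean V (residual L tau eta) = 0.
Proof.
move=> ht he te; rewrite (cell_mean_ae cV (b := cst 0))//.
- by rewrite /cell_mean /Rintegral integral0 mulr0.
- exact: measurable_residual.
- apply: filterS te => x tx; rewrite /residual tx /tensor4_fapp subrr.
  by rewrite -(scale0r (0 : Md)) ddotZl mul0r mulr0.
Qed.

(** The two residuals are the same quadratic form at opposite fields. *)
Lemma cell_mean_residual_swap e s : H e -> H s ->
  cell_mean V (residual L (tensor4_fapp L e) (tensor4_fapp (tensor4_finv L) s)) =
  cell_mean V (residual L s e).
Proof.
move=> he hs; apply: (cell_mean_ae cV).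
- by apply: measurable_residual; [exact: HL|exact: HLi].
- exact: measurable_residual.
apply: filterS (LLi hs) => x sx; rewrite /residual.
rewrite (_ : tensor4_app (L x) (tensor4_fapp (tensor4_finv L) s x) = s x)//.
rewrite -(opprB (s x)) -scaleN1r tensor4_appZ ddotZl ddotZr.
by rewrite !mulN1r opprK.
Qed.

Lemma pairing_tensor_quadratic (T : Rd -> tensor4 R d) f h t :
  bounded_tensor_field B T -> H f -> H h ->
  <| tensor4_fapp T (f + t *: h), f + t *: h |> =
  <| tensor4_fapp T f, f |> + t * (2 * <| tensor4_fapp T f, h |>) +
  t ^+ 2 * <| tensor4_fapp T h, h |>.
Proof.
move=> bT hf hh; have Hth := L2per_symZ t hh; have Hfh := L2per_symD hf Hth.
have HT g : H g -> H (tensor4_fapp T g) by exact: L2per_sym_tensor.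
have Dr u v w : H u -> H v -> H w -> <| w, u + v |> = <| w, u |> + <| w, v |>.
  by move=> *; rewrite pairingC (pairingDl hB cV)// !(pairingC _ _ w).
have Zr c u w : H u -> H w -> <| w, c *: u |> = c * <| w, u |>.
  by move=> *; rewrite pairingC (pairingZl hB cV)// (pairingC _ _ w).
rewrite tensor4_fappD tensor4_fappZ.
have HTh := HT _ hh; have HTf := HT _ hf; have HtTh := L2per_symZ t HTh.
rewrite (pairingDl hB cV)// (pairingZl hB cV)// !Dr// !Zr//.
rewrite (pairing_tensor cV bT hh hf) (pairingC _ h).
ring.
Qed.

(** The gradient is the strain part of [L0^-1 L e]; by [ip_s_PS] its norm is
    that of the part of [L e] orthogonal to the stresses. *)
Lemma primal_gradient_norm e : strain_adm B e ->
  ip_norm ipe (energetic_gradient ipe E0 (primal_energy V L ebar) (e - cst ebar)) ^+ 2 =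
  ips (PS (tensor4_fapp L e)) (PS (tensor4_fapp L e)).
Proof.
move=> [He _]; have HLe := HL He.
set g := energetic_gradient _ _ _ _; set q := PE (A' (tensor4_fapp L e)).
have Eq : E0 q by apply: PE_E0; exact: HA'.
have JE f : H f -> primal_energy V L ebar (f - cst ebar) = 2^-1 * <| tensor4_fapp L f, f |>.
  move=> hf; congr (_ * cell_mean V _); apply/funext => x.
  by rewrite [(f - cst ebar) x](_ : _ = f x - ebar)// addrC subrK.
have gq : ipe g g = ipe q q.
  apply: energetic_gradient_norm => //.
    by move=> f f' hf hf'; apply: ip_eC; exact: strain_L2per.
  move=> h hh; have Hh := strain_L2per hh; have Hq := strain_L2per Eq.
  have := PE_orth (HA' HLe) hh; rewrite ip_eBl ?ip_e_A'//; last exact: HA'.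
  move=> /eqP; rewrite subr_eq0 => /eqP <-.
  apply: (@quadratic_quotient_cvg _ _ _ (2^-1 * <| tensor4_fapp L h, h |>)) => t.
  rewrite addrAC !JE//; last by apply: L2per_symD => //; exact: L2per_symZ.
  by rewrite pairing_tensor_quadratic//; field.
rewrite sqr_sqrtr gq ?ip_s_PS//.
by apply: ip_e_ge0; exact: strain_L2per.
Qed.

(** The defect [y] of [L^-1 s] is orthogonal to the strains, so [L0 y] is a
    stress. It is the gradient, and [L0] is an isometry for the two products. *)
Lemma dual_gradient_norm s (eta := tensor4_fapp (tensor4_finv L) s) : Stat s ->
  ip_norm ips (energetic_gradient ips Stat (dual_energy V L ebar) s) ^+ 2 =
  ipe (eta - PE eta - cst ebar) (eta - PE eta - cst ebar).
Proof.
move=> hs; have Hs := stress_L2per hs; have Heta : H eta by exact: HLi.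
have HP := HPE Heta.
have Hd : H (eta - PE eta) by exact: L2per_symB.
have Hy := L2per_symB Hd Hbar; set y := _ - cst ebar in Hy *.
have HAy := HA Hy.
have yk k : E0 k -> <| A y, k |> = 0.
  move=> hk; have Hk := strain_L2per hk.
  rewrite -[LHS]/(ipe y k) /y ip_eBl// PE_orth// sub0r.
  rewrite [X in - X](_ : _ = <| A (cst ebar), k |>)// stress_strain_orthogonal ?oppr0//.
  apply: (@stress_adm_cst _ _ B (tensor4_app L0 ebar)).
  by have [mL _ _] := hL0; exact: tensor4_app_sym.
have Sy : Stat (A y) by apply/stress_admP.
set g := energetic_gradient _ _ _ _.
have JE f : H f -> dual_energy V L ebar f = 2^-1 * <| tensor4_fapp (tensor4_finv L) f, f |> - <| f, cst ebar |>.
  move=> hf; rewrite /dual_energy (ddot_cell_mean hB cV)//; congr (_ * _ - _).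
  by rewrite pairingC.
have gq : ips g g = ips (A y) (A y).
  apply: energetic_gradient_norm => //.
    by move=> f f' hf hf'; apply: ip_sC; exact: stress_L2per.
  move=> h hh; have Hh := stress_L2per hh; have Hth t := L2per_symZ t Hh.
  have -> : ips (A y) h = <| eta, h |> - <| h, cst ebar |>.
    rewrite ip_sC// ip_s_A// /y pBr// pBr//.
    by rewrite (stress_strain_orthogonal hh (PE_E0 Heta)) subr0 [<| h, eta |>]pairingC.
  apply: (@quadratic_quotient_cvg _ _ _ (2^-1 * <| tensor4_fapp (tensor4_finv L) h, h |>)) => t.
  rewrite !JE//; last exact: L2per_symD.
  rewrite pairing_tensor_quadratic// (pairingDl hB cV)// (pairingZl hB cV)//.
  by rewrite -/eta; field.
rewrite sqr_sqrtr; last by rewrite gq ip_s_ge0.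
by rewrite gq ip_s_A.
Qed.

End duality.

Theorem proposition5 (R : realType) (d : nat)
  (B : 'M[R]_d) (hB : B \in unitmx)
  (V : set 'rV[R]_d) (hV : unit_cell B V)
  (L0 : tensor4 R d) (hL0 : uniform_stiffness L0)
  (L : 'rV[R]_d -> tensor4 R d) (hL : stiffness_field B V L)
  (PE : tensor_field R d -> tensor_field R d)
  (hPE : orth_projector B (ip_e V L0) (strain_fluct B) PE)
  (PS : tensor_field R d -> tensor_field R d)
  (hPS : orth_projector B (ip_s V L0) (energetic_orthogonal B (ip_s V L0) (stress_adm B)) PS)
  (ebar : 'M[R]_d) (hebar : uniform_fields B (cst ebar))
  (e : tensor_field R d) (he : strain_adm B e) (hmean : cell_mean_mx V e = ebar)
  (s : tensor_field R d) (hs : stress_adm B s) :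
  let P := error_functional V L0 L PE PS ebar in
  let nJ := ip_norm (ip_e V L0)
    (energetic_gradient (ip_e V L0) (strain_fluct B) (primal_energy V L ebar) (e - cst ebar)) in
  let nJc := ip_norm (ip_s V L0)
    (energetic_gradient (ip_s V L0) (stress_adm B) (dual_energy V L ebar) s) in
  [/\ P s e = cell_mean V (residual L s e),
      P (tensor4_fapp L e) e = 2^-1 * nJ ^+ 2,
      P s (tensor4_fapp (tensor4_finv L) s) = 2^-1 * nJc ^+ 2 &
      P (tensor4_fapp L e) (tensor4_fapp (tensor4_finv L) s) =
        2^-1 * nJc ^+ 2 + cell_mean V (residual L s e) + 2^-1 * nJ ^+ 2].
Proof.
move=> P nJ nJc; rewrite /P /error_functional.
have He : L2per_sym B e by case: he.
have Hs : L2per_sym B s by case: hs.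
have HLe := L2per_sym_tensor (stiffness_bounded hV hL) He.
set eta := tensor4_fapp (tensor4_finv L) s.
have Heta : L2per_sym B eta := L2per_sym_tensor (stiffness_inverse_bounded hV hL) Hs.
have normS tau : L2per_sym B tau -> ip_norm (ip_s V L0) (PS tau) ^+ 2 = ip_s V L0 (PS tau) (PS tau).
  by move=> htau; rewrite sqr_sqrtr//; apply: (ip_s_ge0 hV hL0); have [[]] := hPS _ htau.
have normE eta' : L2per_sym B eta' ->
    ip_norm (ip_e V L0) (eta' - PE eta' - cst ebar) ^+ 2 =
    ip_e V L0 (eta' - PE eta' - cst ebar) (eta' - PE eta' - cst ebar).
  move=> h'; rewrite sqr_sqrtr//; apply: (ip_e_ge0 hV hL0).
  apply: L2per_symB; last by case: hebar.
  by apply: L2per_symB => //; have [[]] := hPE _ h'.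
have Js : ip_norm (ip_s V L0) (PS s) ^+ 2 = 0.
  by rewrite normS// (ip_s_PS_stress hB hV hL0 hPS hs).
have Je : ip_norm (ip_e V L0) (e - PE e - cst ebar) ^+ 2 = 0.
  by rewrite normE// (strain_defect hB hV hL0 hPE hPS hebar he hmean).
have JL : ip_norm (ip_s V L0) (PS (tensor4_fapp L e)) ^+ 2 = nJ ^+ 2.
  by rewrite normS// /nJ (primal_gradient_norm hB hV hL0 hPE hPS hL ebar he).
have Jeta : ip_norm (ip_e V L0) (eta - PE eta - cst ebar) ^+ 2 = nJc ^+ 2.
  by rewrite normE// /nJc (dual_gradient_norm hB hV hL0 hPE hPS hL hebar hs).
split.
- by rewrite Js Je !mulr0 add0r addr0.
- rewrite Je JL mulr0 add0r (cell_mean_residual_eq0 hV hL)// ?add0r//.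
  exact: aeW.
- rewrite Js Jeta mulr0 addr0 (cell_mean_residual_eq0 hV hL)// ?addr0//.
  have [_ ss _] := Hs.
  by apply: filterS2 (stiffness_inverse hL) ss => x ix /(ix.2 _)[].
- by rewrite JL Jeta (cell_mean_residual_swap hV hL).
Qed.
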